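(* Let $\mathcal{C}$ be either $\mathcal{C}_{HS}$ or $\mathcal{C}_P$. Let $G$ be a finitely generated $\mathcal{C}$-stable group, let $H$ be a finite group and let $i_1,i_2\colon H\to G$ be injective homomorphisms such that $i_1(H)$ and $i_2(H)$ are normal in $G$. Then the HNN extension $G*_{i_1,i_2}$ is $\mathcal{C}$-stable.
   Context: $\mathcal{C}_{HS}$ is the class of groups $\mathrm{Aut}(X)$, where $X$ is a finite-dimensional Hilbert space and $\mathrm{Aut}(X)$ is its unitary group, with the metric $d(A_1,A_2)=\|A_1-A_2\|_{HS}$, $\|A\|_{HS}=\mathrm{Tr}(A^*A)^{1/2}$, $\mathrm{Tr}$ the normalized trace. $\mathcal{C}_P$ is the class of groups $\mathrm{Aut}(X)$, where $X$ is a finite set and $\mathrm{Aut}(X)$ is its symmetric group, with the normalized Hamming metric $d(\sigma_1,\sigma_2)=\frac{1}{|X|}\#\{x\in X:\sigma_1(x)\neq\sigma_2(x)\}$. A group $G$ is $\mathcal{C}$-stable if for any sequence of maps $\varphi_n\colon G\to\mathrm{Aut}(X_n)\in\mathcal{C}$ with $d(\varphi_n(g)\varphi_n(h),\varphi_n(gh))\to0$ as $n\to\infty$ for all $g,h\in G$, there is a sequence of homomorphisms $\psi_n\colon G\to\mathrm{Aut}(X_n)$ with $d(\varphi_n(g),\psi_n(g))\to0$ for all $g\in G$. $G*_{i_1,i_2}:=(G*\mathbb{Z})/\langle\langle i_1(h)^{-1}\,t\,i_2(h)\,t^{-1}: h\in H\rangle\rangle$, where $\mathbb{Z}=\langle t\rangle$.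 *)

(* Defs.v *)
From HB Require Import structures.
From mathcomp Require Import all_boot all_order all_algebra fingroup perm.
From mathcomp Require Import generic_quotient complex.
From mathcomp Require Import all_classical all_reals all_analysis.
Set Implicit Arguments.
Unset Strict Implicit.
Unset Printing Implicit Defensive.
Import Order.TTheory GRing.Theory Num.Theory.
Import numFieldNormedType.Exports.

Local Open Scope classical_set_scope.
Local Open Scope quotient_scope.
Local Open Scope group_scope.

Section Subgroups.
Variable G : groupType.
Implicit Types A S : set G.

Definition is_subgroup A : Prop :=
  [/\ A 1, forall x y, A x -> A y -> A (x * y) & forall x, A x -> A x^-1].

Definition is_normal_subgroup A : Prop :=
  is_subgroup A /\ forall g x, A x -> A (g * x * g^-1).

Definition generated S : set G := smallest is_subgroup S.

Definition normal_closure S : set G := smallest is_normal_subgroup S.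

Definition finitely_generated : Prop :=
  exists2 S : set G, finite_set S & generated S = setT.

Lemma normal_closure_normal S : is_normal_subgroup (normal_closure S).
Proof.
split; first split.
- by move=> A /= [[[A1 _ _] _] _].
- by move=> x y Sx Sy A /= NA; move: (NA) => [[[_ AM _] _] _];
    apply: AM; [apply: Sx|apply: Sy].
- by move=> x Sx A /= NA; move: (NA) => [[[_ _ AV] _] _]; apply: AV; apply: Sx.
by move=> g x Sx A /= NA; move: (NA) => [[_ AJ] _]; apply: AJ; apply: Sx.
Qed.

End Subgroups.

(* The quotient group G / <<S>> by the normal closure of S. *)
Section QuotientByNormalClosure.
Variables (G : groupType) (S : set G).
Local Notation N := (normal_closure S).

Definition coset_rel (x y : G) : bool := `[< N (x^-1 * y) >].

Let N1 : N 1. Proof. by case: (normal_closure_normal S) => -[]. Qed.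
Let NM x y : N x -> N y -> N (x * y).
Proof. by case: (normal_closure_normal S) => -[_ + _] _; apply. Qed.
Let NV x : N x -> N x^-1.
Proof. by case: (normal_closure_normal S) => -[_ _ +] _; apply. Qed.
Let NJ g x : N x -> N (g * x * g^-1).
Proof. by case: (normal_closure_normal S) => _; apply. Qed.

Fact coset_rel_refl : reflexive coset_rel.
Proof. by move=> x; apply/asboolP; rewrite mulVg. Qed.

Fact coset_rel_sym : symmetric coset_rel.
Proof.
by move=> x y; apply/asboolP/asboolP => /NV; rewrite invgM invgK.
Qed.

Fact coset_rel_trans : transitive coset_rel.
Proof.
move=> y x z /asboolP xy /asboolP yz; apply/asboolP.
by have := NM xy yz; rewrite mulgA mulgK.
Qed.

Canonical coset_equiv :=
  EquivRel coset_rel coset_rel_refl coset_rel_sym coset_rel_trans.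

Definition quotient_nc : Type := {eq_quot coset_equiv}.
HB.instance Definition _ := Choice.on quotient_nc.
HB.instance Definition _ := EqQuotient.on quotient_nc.

Definition pi_nc (x : G) : quotient_nc := \pi_quotient_nc x.

Let pi_ncP x y : reflect (N (x^-1 * y)) (pi_nc x == pi_nc y).
Proof. by rewrite /pi_nc eqmodE; apply: asboolP. Qed.

Let repr_pi x : pi_nc (repr (pi_nc x)) = pi_nc x.
Proof. exact: reprK. Qed.

Definition mul_nc (a b : quotient_nc) : quotient_nc := pi_nc (repr a * repr b).
Definition inv_nc (a : quotient_nc) : quotient_nc := pi_nc (repr a)^-1.

Let pi_mul x y : mul_nc (pi_nc x) (pi_nc y) = pi_nc (x * y).
Proof.
have /eqP/pi_ncP hx := repr_pi x; have /eqP/pi_ncP hy := repr_pi y.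
apply/eqP/pi_ncP; set x' := repr _ in hx *; set y' := repr _ in hy *.
have -> : (x' * y')^-1 * (x * y) = y'^-1 * (x'^-1 * x) * y'^-1^-1 * (y'^-1 * y).
  by rewrite invgM invgK !mulgA mulgK.
exact: NM (NJ _ hx) hy.
Qed.

Let pi_inv x : inv_nc (pi_nc x) = pi_nc x^-1.
Proof.
have /eqP/pi_ncP hx := repr_pi x; apply/eqP/pi_ncP; set x' := repr _ in hx *.
have -> : x'^-1^-1 * x^-1 = x' * (x'^-1 * x)^-1 * x'^-1.
  by rewrite invgM !invgK !mulgA mulgK.
exact: NJ (NV hx).
Qed.

Let pi_surj (a : quotient_nc) : {x | a = pi_nc x}.
Proof. by exists (repr a); rewrite /pi_nc reprK. Qed.

Fact mul_ncA : associative mul_nc.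
Proof.
move=> a b c; have [[[x ->] [y ->]] [z ->]] := (pi_surj a, pi_surj b, pi_surj c).
by rewrite !pi_mul mulgA.
Qed.
Fact mul_1nc : left_id (pi_nc 1) mul_nc.
Proof. by move=> a; have [x ->] := pi_surj a; rewrite pi_mul mul1g. Qed.
Fact mul_nc1 : right_id (pi_nc 1) mul_nc.
Proof. by move=> a; have [x ->] := pi_surj a; rewrite pi_mul mulg1. Qed.
Fact mul_Vnc : left_inverse (pi_nc 1) inv_nc mul_nc.
Proof. by move=> a; have [x ->] := pi_surj a; rewrite pi_inv pi_mul mulVg. Qed.
Fact mul_ncV : right_inverse (pi_nc 1) inv_nc mul_nc.
Proof. by move=> a; have [x ->] := pi_surj a; rewrite pi_inv pi_mul mulgV. Qed.

HB.instance Definition _ :=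
  isGroup.Build quotient_nc mul_ncA mul_1nc mul_nc1 mul_Vnc mul_ncV.

Fact pi_nc_mul : {morph pi_nc : x y / x * y}.
Proof. by move=> x y; rewrite -pi_mul. Qed.
HB.instance Definition _ := isMultiplicative.Build G quotient_nc pi_nc pi_nc_mul.

Lemma pi_nc_eqP x y : reflect (N (x^-1 * y)) (pi_nc x == pi_nc y).
Proof. exact: pi_ncP. Qed.

End QuotientByNormalClosure.

(* The free product: words in the disjoint union of the two groups, modulo the
   least congruence for concatenation that evaluates products and erases
   identities inside each factor. *)
Section FreeProduct.
Variables G K : groupType.
Local Notation word := (seq (G + K)).

Inductive fp_cong : word -> word -> Prop :=
| fp_refl u : fp_cong u u
| fp_sym u v : fp_cong u v -> fp_cong v u
| fp_trans v u w : fp_cong u v -> fp_cong v w -> fp_cong u w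
| fp_cat u u' v v' :
    fp_cong u u' -> fp_cong v v' -> fp_cong (u ++ v) (u' ++ v')
| fp_mull (x y : G) : fp_cong [:: inl x; inl y] [:: inl (x * y)]
| fp_mulr (x y : K) : fp_cong [:: inr x; inr y] [:: inr (x * y)]
| fp_onel : fp_cong [:: inl 1] [::]
| fp_oner : fp_cong [:: inr 1] [::].

Definition fp_rel (u v : word) : bool := `[< fp_cong u v >].

Fact fp_rel_refl : reflexive fp_rel.
Proof. by move=> u; apply/asboolP; apply: fp_refl. Qed.
Fact fp_rel_sym : symmetric fp_rel.
Proof. by move=> u v; apply/asboolP/asboolP; apply: fp_sym. Qed.
Fact fp_rel_trans : transitive fp_rel.
Proof.
by move=> v u w /asboolP uv /asboolP vw; apply/asboolP; apply: fp_trans uv vw.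
Qed.

Canonical fp_equiv := EquivRel fp_rel fp_rel_refl fp_rel_sym fp_rel_trans.

Definition free_prod : Type := {eq_quot fp_equiv}.
HB.instance Definition _ := Choice.on free_prod.
HB.instance Definition _ := EqQuotient.on free_prod.

Definition fp_class (u : word) : free_prod := \pi_free_prod u.

Lemma fp_classP u v : reflect (fp_cong u v) (fp_class u == fp_class v).
Proof. by rewrite /fp_class eqmodE; apply: asboolP. Qed.

Definition letter_inv (l : G + K) : G + K :=
  match l with inl x => inl x^-1 | inr y => inr y^-1 end.
Definition word_inv (u : word) : word := rev (map letter_inv u).

Definition fp_one : free_prod := fp_class [::].
Definition fp_mul (a b : free_prod) : free_prod := fp_class (repr a ++ repr b).
Definition fp_inv (a : free_prod) : free_prod := fp_class (word_inv (repr a)).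

Let repr_class u : fp_cong (repr (fp_class u)) u.
Proof. by apply/fp_classP; rewrite /fp_class reprK. Qed.

Let mul_class u v : fp_mul (fp_class u) (fp_class v) = fp_class (u ++ v).
Proof. by apply/eqP/fp_classP; apply: fp_cat; apply: repr_class. Qed.

Let class_surj (a : free_prod) : {u | a = fp_class u}.
Proof. by exists (repr a); rewrite /fp_class reprK. Qed.

Let word_inv_cat u v : word_inv (u ++ v) = word_inv v ++ word_inv u.
Proof. by rewrite /word_inv map_cat rev_cat. Qed.

Let word_inv_cong u v : fp_cong u v -> fp_cong (word_inv u) (word_inv v).
Proof.
elim=> {u v}.
- by move=> u; apply: fp_refl.
- by move=> u v _; apply: fp_sym.
- by move=> v u w _ uv _ vw; apply: fp_trans uv vw.
- by move=> u u' v v' _ uu' _ vv'; rewrite !word_inv_cat; apply: fp_cat.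
- by move=> x y; rewrite /word_inv /= /rev /= invgM; apply: fp_mull.
- by move=> x y; rewrite /word_inv /= /rev /= invgM; apply: fp_mulr.
- by rewrite /word_inv /= /rev /= invg1; apply: fp_onel.
- by rewrite /word_inv /= /rev /= invg1; apply: fp_oner.
Qed.

Let inv_class u : fp_inv (fp_class u) = fp_class (word_inv u).
Proof. by apply/eqP/fp_classP; apply/word_inv_cong/repr_class. Qed.

Let word_invK : involutive word_inv.
Proof.
move=> u; rewrite /word_inv map_rev revK -map_comp -[RHS]map_id.
by apply: eq_map => -[x|x] /=; rewrite invgK.
Qed.

Let word_mulV u : fp_cong (u ++ word_inv u) [::].
Proof.
elim/last_ind: u => [|u l IH]; first exact: fp_refl.
rewrite -cats1 word_inv_cat catA -(catA u); apply: fp_trans IH.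
rewrite -[X in fp_cong _ (X ++ _)]cats0.
apply: fp_cat (fp_refl _); apply: fp_cat (fp_refl _) _.
case: l => x; rewrite /word_inv /= /rev /=.
  by apply: fp_trans (fp_mull _ _) _; rewrite mulgV; apply: fp_onel.
by apply: fp_trans (fp_mulr _ _) _; rewrite mulgV; apply: fp_oner.
Qed.

Fact fp_mulA : associative fp_mul.
Proof.
move=> a b c.
have [[[u ->] [v ->]] [w ->]] := (class_surj a, class_surj b, class_surj c).
by rewrite !mul_class catA.
Qed.
Fact fp_mul1 : left_id fp_one fp_mul.
Proof. by move=> a; have [u ->] := class_surj a; rewrite mul_class. Qed.
Fact fp_mul_1 : right_id fp_one fp_mul.
Proof. by move=> a; have [u ->] := class_surj a; rewrite mul_class cats0. Qed.
Fact fp_mulV : right_inverse fp_one fp_inv fp_mul.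
Proof.
move=> a; have [u ->] := class_surj a; rewrite inv_class mul_class.
by apply/eqP/fp_classP.
Qed.
Fact fp_mul_V : left_inverse fp_one fp_inv fp_mul.
Proof.
move=> a; have [u ->] := class_surj a; rewrite inv_class mul_class.
by apply/eqP/fp_classP; rewrite -{2}(word_invK u).
Qed.

HB.instance Definition _ :=
  isGroup.Build free_prod fp_mulA fp_mul1 fp_mul_1 fp_mul_V fp_mulV.

Definition fp_inl (x : G) : free_prod := fp_class [:: inl x].
Definition fp_inr (y : K) : free_prod := fp_class [:: inr y].

Fact fp_inl_mul : {morph fp_inl : x y / x * y}.
Proof.
by move=> x y; rewrite [RHS]mul_class; apply/esym/eqP/fp_classP/fp_mull.
Qed.
Fact fp_inr_mul : {morph fp_inr : x y / x * y}.
Proof.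
by move=> x y; rewrite [RHS]mul_class; apply/esym/eqP/fp_classP/fp_mulr.
Qed.
HB.instance Definition _ := isMultiplicative.Build G free_prod fp_inl fp_inl_mul.
HB.instance Definition _ := isMultiplicative.Build K free_prod fp_inr fp_inr_mul.

End FreeProduct.

(* [Algebra.to_multiplicative int] is the infinite cyclic group Z, written
   multiplicatively, and its generator t is the integer 1. *)
Section HNN.
Variables (G H : groupType) (i1 i2 : H -> G).
Local Notation Z := (Algebra.to_multiplicative int).

Definition stable_letter : free_prod G Z := @fp_inr G Z (1%R : int).
Local Notation t := stable_letter.
Local Notation inG := (@fp_inl G Z).

Definition hnn_relators : set (free_prod G Z) :=
  range (fun h : H => (inG (i1 h))^-1 * t * inG (i2 h) * t^-1).

Definition hnn : groupType := quotient_nc hnn_relators.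

End HNN.

Section UnitaryGroup.
Variables (R : realType) (n : nat).
Local Notation C := R[i].
Local Open Scope ring_scope.
Local Open Scope sesquilinear_scope.

Record unitary : Type :=
  Unitary { umx :> 'M[C]_n; _ : umx \is unitarymx }.
HB.instance Definition _ := [isSub for umx].
HB.instance Definition _ := [Choice of unitary by <:].

Fact unitary1_proof : (1%:M : 'M[C]_n) \is unitarymx.
Proof. by apply/unitarymxP; rewrite trmx1 map_mx1 mulmx1. Qed.
Fact unitaryM_proof (A B : unitary) : umx A *m umx B \is unitarymx.
Proof. by apply: mul_unitarymx; apply: valP. Qed.
Fact unitaryV_proof (A : unitary) : (umx A)^t* \is unitarymx.
Proof. by rewrite trmxC_unitary; apply: valP. Qed.

Definition unitary1 := Unitary unitary1_proof.
Definition unitaryM (A B : unitary) := Unitary (unitaryM_proof A B).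
Definition unitaryV (A : unitary) := Unitary (unitaryV_proof A).

Fact unitaryA : associative unitaryM.
Proof. by move=> A B D; apply/val_inj; rewrite /= mulmxA. Qed.
Fact unitary_mul1 : left_id unitary1 unitaryM.
Proof. by move=> A; apply/val_inj; rewrite /= mul1mx. Qed.
Fact unitary_mul_1 : right_id unitary1 unitaryM.
Proof. by move=> A; apply/val_inj; rewrite /= mulmx1. Qed.
Fact unitary_mulV : right_inverse unitary1 unitaryV unitaryM.
Proof. by move=> A; apply/val_inj/unitarymxP; apply: (valP A). Qed.
Fact unitary_mul_V : left_inverse unitary1 unitaryV unitaryM.
Proof. by move=> A; apply/val_inj; apply: mulmx1C; apply/unitarymxP/(valP A). Qed.

HB.instance Definition _ :=
  isGroup.Build unitary unitaryA unitary_mul1 unitary_mul_1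
    unitary_mul_V unitary_mulV.

(* [\tr (A^t* *m A)] is a nonnegative real, so taking its real part only moves
   it from [R[i]] to [R]. *)
Definition hs_norm (A : 'M[C]_n) : R :=
  Num.sqrt (complex.Re (n%:R^-1 * \tr (A^t* *m A))).

Definition hs_dist (A B : unitary) : R := hs_norm (umx A - umx B).

End UnitaryGroup.

Definition hamming_dist (R : realType) (X : finType) (s t : {perm X}) : R :=
  (#|X|%:R^-1 * #|[pred x | s x != t x]|%:R)%R.

Record group_class (R : realType) : Type := GroupClass {
  obj : Type;
  AutG : obj -> groupType;
  distG : forall X : obj, AutG X -> AutG X -> R
}.
Arguments distG {R _ X}.

(* A finite-dimensional Hilbert space is represented by its dimension n, as the
   coordinate space R[i]^n with the standard inner product.  In dimension 0 the
   group is trivial and [hs_dist] is 0, since [0^-1 = 0]. *)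
Definition C_HS (R : realType) : group_class R :=
  @GroupClass R nat (fun n => unitary R n) (@hs_dist R).

(* The product in [{perm X}] is [(s * t) x = t (s x)]; inversion is an isometric
   isomorphism onto the group with the composition order reversed.  For empty X
   the group is trivial and [hamming_dist] is 0. *)
Definition C_P (R : realType) : group_class R :=
  @GroupClass R finType (fun X => {perm X}) (@hamming_dist R).

Definition asymptotic_hom (R : realType) (C : group_class R) (G : groupType)
    (X : nat -> obj C) (phi : forall n, G -> AutG (X n)) : Prop :=
  forall g h : G,
    distG (phi n g * phi n h) (phi n (g * h)) @[n --> \oo] --> (0%R : R).

Definition stable (R : realType) (C : group_class R) (G : groupType) : Prop :=
  forall (X : nat -> obj C) (phi : forall n, G -> AutG (X n)),
    asymptotic_hom phi ->
    exists psi : forall n, {multiplicative G -> AutG (X n)},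
      forall g : G, distG (phi n g) (psi n g) @[n --> \oo] --> (0%R : R).

(* Main.v *)
(* Correcting an asymptotic homomorphism on G by stability leaves exact
   homomorphisms psi of G and elements t that almost intertwine psi o i2 with
   psi o i1; it remains to move psi and t slightly so that t intertwines exactly.

   By normality, each restriction psi o i_k splits into pieces indexed by
   G-invariant types of H-actions: G-classes of point stabilizers for
   permutations, and joint eigenvalues of the averages of G-conjugates of h for
   unitaries.  Since the type is preserved by G, psi itself is a block sum of
   pure pieces, one for each pair of types, and the H-actions psi o i1 and
   psi o i2 are isomorphic as soon as the sizes of these pieces satisfy finitely
   many rational linear equations.  An almost intertwining t says that the sizes
   satisfy these equations up to a small error.  Along a sequence of
   counterexamples the relative sizes cluster at an exact solution x, and the
   equations have a rational solution slightly below x.  Each pure piece is shrunk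
   to the prescribed size: truncate it a little, correct the truncation by
   stability of G, keep the part of the right type, and fill up with copies of
   fixed pure actions (a numerical semigroup argument handles divisibility) and a
   trivial action.  Now psi o i1 and psi o i2 are exactly isomorphic, and a
   near-intertwiner between isomorphic actions of a finite group is near to an
   exact one. *)

Require Import Defs.
From HB Require Import structures.
From mathcomp Require Import all_boot all_order all_algebra fingroup perm.
From mathcomp Require Import generic_quotient complex.
From mathcomp Require Import all_classical all_reals all_analysis.
From mathcomp Require Import ring lra zify.

Set Implicit Arguments.
Unset Strict Implicit.
Unset Printing Implicit Defensive.
Import Order.TTheory GRing.Theory Num.Theory.
Import numFieldNormedType.Exports.

Local Open Scope ring_scope.

(** * Arithmetic *)

(** Two demands compete: the multiplicities of the two [H]-actions must agree exactly, yet every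
    change must leave a homomorphism of all of [G]. The obstacle is that a pure piece may be
    irreducible under [G], so it need not contain a subaction of a prescribed smaller size. It is
    therefore compressed to a corner that it does not preserve. This spoils multiplicativity by an
    amount bounded uniformly over all pairs in [G], and stability of [G] is used a second time, in a
    uniform epsilon-delta form. The size of the pure part obtained in this way is known only up to a
    small error, so it is kept strictly below the prescribed size and the difference is filled up.
    Pieces are shrunk and never enlarged because the total size is fixed; the freed room goes to a
    trivial action, on which both copies of [H] act alike. Bounded sizes need no such surgery:
    multiplicities are integers, so a gap below 1 is already zero. *)

Lemma numerical_semigroup (S : set nat) (w : nat) :
    (0 < w)%N -> S w -> S 0%N -> (forall a b, S a -> S b -> S (a + b)%N) ->
  exists B : nat, forall m k, S m -> (w %| k)%N -> (m + B <= k)%N -> S (k - m)%N.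
Proof.
move=> w0 Sw S0 SD.
have SM a c : S a -> S (c * a)%N.
  by move=> Sa; elim: c => [|c IH]; rewrite ?mul0n // mulSn; apply: SD.
(* One element of [S] for each residue class mod [w] that [S] meets. Only these finitely many
   choices enter the bound, which is therefore uniform in [m]. *)
have [s hs] : {s : 'I_w -> nat |
    forall r, S (s r) /\ forall m, S m -> m = r %[mod w] -> s r = r %[mod w]}.
  suff h (r : 'I_w) : exists s,
      S s /\ forall m, S m -> m = r %[mod w] -> s = r %[mod w].
    by exists (fun r => sval (cid (h r))) => r; apply: (svalP (cid (h r))).
  case: (pselect (exists m, S m /\ m = r %[mod w])) => [[m [Sm mr]]|nm].
    by exists m.
  by exists 0%N; split => // m Sm mr; case: nm; exists m.
(* [w.-1 * s r] is congruent to [- m] mod [w], so [k - m] exceeds it by a multiple of [w]. *)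
exists (w.-1 * \max_r s r)%N => m k Sm wk le_mBk.
pose r := Ordinal (ltn_pmod m w0); have [Sr Er] := hs r.
have {}Er : s r = m %[mod w] by rewrite (Er m Sm) /= modn_mod.
have le1 : (w.-1 * s r <= w.-1 * \max_r s r)%N by rewrite leq_mul2l leq_bigmax orbT.
have le2 : (m + w.-1 * s r <= k)%N by apply: leq_trans le_mBk; rewrite leq_add2l.
have wd : (w %| k - (m + w.-1 * s r))%N.
  apply: dvdn_sub => //; rewrite /dvdn -modnDml -Er modnDml.
  by rewrite -{1}[s r]mul1n -mulnDl add1n prednK // modnMr.
have := SM _ w.-1 Sr; move: wd le2; set A := (w.-1 * s r)%N => /dvdnP[c wd] le2 SA.
have -> : (k - m = A + (k - (m + A)))%N by lia.
by apply: SD => //; rewrite wd; apply: SM.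
Qed.

(** A cluster point, from compactness of the cube, does the work of a convergent subsequence. *)
Lemma cluster_point (R : realType) (T : finType) (f : nat -> T -> R) :
    (forall k t, 0 <= f k t <= 1) ->
  exists2 x : T -> R, (forall t, 0 <= x t) &
    forall e N, 0 < e -> exists2 k, (N <= k)%N & forall t, `|f k t - x t| < e.
Proof.
move=> f01; pose F k : 'rV[R]_(#|T|) := \row_i f k (enum_val i).
have cK := @rV_compact R _ (fun _ : 'I_(#|T|) => `[0%R, 1%R]%classic)
  (fun _ => @segment_compact R 0 1).
have PF : ProperFilter (F @ \oo)%classic by apply: fmap_proper_filter.
have [|v [/= v01 clv]] := cK _ PF.
  by exists 0%N => // k _ i /=; rewrite mxE in_itv /=; apply: f01.
exists (fun t => v ord0 (enum_rank t)) => [t|e N e0].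
  by have := v01 (enum_rank t); rewrite /= in_itv /= => /andP[].
have hA : (F @ \oo)%classic (F @` [set k | (N <= k)%N])%classic.
  by exists N => // k /= Nk; exists k.
have [w [[k Nk <-] kv]] := clv _ _ hA (nbhsx_ballx v e e0).
exists k => // t; have := kv.
rewrite /ball /= /mx_ball => -[_ /(_ ord0 (enum_rank t))].
by rewrite /ball /= mxE enum_rankK distrC.
Qed.

(** A rational basis of the kernel of a rational matrix still spans the kernel over [R], so rounding
    the coefficients of a real kernel vector gives a nearby rational one. The vector rounded is
    [(1 - eta / 2) * x], the middle of the allowed interval. *)
Lemma rat_kernel_dense (R : realType) (T J : finType) (v : T -> J -> rat)
    (x : T -> R) (eta : R) :
    0 < eta < 1 -> (forall t, 0 <= x t) ->
    (forall j, \sum_t x t * ratr (v t j) = 0) ->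
  exists (q : T -> nat) (d : nat), [/\ (0 < d)%N,
    forall j, \sum_t (q t)%:R * v t j = 0,
    forall t, x t = 0 -> q t = 0%N &
    forall t, 0 < x t -> (1 - eta) * x t * d%:R < (q t)%:R < x t * d%:R].
Proof.
move=> /andP[eta0 eta1] x0 xv.
pose V : 'M[rat]_(#|T|, #|J|) := \matrix_(i, j) v (enum_val i) (enum_val j).
(* These extra columns force a kernel vector to vanish wherever [x] does; an error bound alone would
   not give exactly 0. *)
pose Z : 'M[rat]_#|T| := diag_mx (\row_i (x (enum_val i) == 0)%:R).
pose M := row_mx V Z; pose K := kermx M.
pose X : 'rV[R]_#|T| := \row_i ((1 - eta / 2) * x (enum_val i)).
have XM : X *m map_mx ratr M = 0.
  rewrite map_row_mx mul_mx_row; apply/eqP; rewrite -row_mx0; apply/eqP.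
  congr row_mx; apply/rowP => j; rewrite !mxE.
    rewrite (reindex (@enum_rank T)) /=; last by apply: onW_bij; apply: enum_rank_bij.
    under eq_bigr do rewrite !mxE enum_rankK -mulrA.
    by rewrite -mulr_sumr xv mulr0.
  apply: big1 => i _; rewrite !mxE; case: (eqVneq i j) => [->|_]; last first.
    by rewrite mulr0n rmorph0 mulr0.
  case: (eqVneq (x (enum_val j)) 0) => [->|_]; first by rewrite mulr0 mul0r.
  by rewrite mulr1n rmorph0 mulr0.
have /submxP[A XA] : (X <= map_mx ratr K)%MS by rewrite map_kermx; apply/sub_kermxP.
pose s := 1 + \sum_i \sum_j `|ratr (K i j) : R|.
have s0 : 0 < s.
  by rewrite ltr_pwDl ?ltr01 //; apply: sumr_ge0 => i _; apply: sumr_ge0.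
(* Rounding each coefficient by less than [g] moves every coordinate by less than [g * s], which is
   at most half the width of each interval with [x t] positive. *)
pose g := \big[Num.min/1]_(t | 0 < x t) (x t * (eta / 2)) / s.
have g0 : 0 < g.
  rewrite divr_gt0 //; elim/big_ind: _ => // [a b a0 b0|t xt].
    by rewrite lt_min a0.
  by rewrite mulr_gt0 // divr_gt0.
have gx t : 0 < x t -> g * s <= x t * (eta / 2).
  by move=> xt; rewrite divfK ?gt_eqF //; apply: bigmin_le_cond.
have /(_ _)/cid-/all_sig[a ha] : forall i, exists a : rat, `|A ord0 i - ratr a| < g.
  move=> i; have [|a] := @rat_in_itvoo R (A ord0 i - g) (A ord0 i + g); first by lra.
  by rewrite in_itv /= => /andP[a1 a2]; exists a; rewrite ltr_norml; lra.
pose Y : 'rV[rat]_#|T| := (\row_i a i) *m K.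
have XY i : `|X ord0 i - ratr (Y ord0 i)| < g * s.
  rewrite XA !mxE rmorph_sum /= -sumrB.
  apply: (@le_lt_trans _ _ (\sum_j g * `|ratr (K j i)|)).
    apply: le_trans (ler_norm_sum _ _ _) _; apply: ler_sum => j _.
    rewrite !mxE rmorphM /= -mulrBl normrM; apply: ler_wpM2r => //.
    exact/ltW/ha.
  rewrite -mulr_sumr ltr_pM2l // /s.
  apply: (@le_lt_trans _ _ (\sum_i \sum_j `|ratr (K i j) : R|)); last by rewrite ltrDr.
  apply: ler_sum => j _; rewrite (bigD1 i) //= lerDl; exact: sumr_ge0.
have YM : Y *m M = 0 by rewrite -mulmxA mulmx_ker mulmx0.
have YV j : \sum_t Y ord0 (enum_rank t) * v t j = 0.
  have := congr1 (fun B : 'M[rat]_(1, #|J| + #|T|) => B ord0 (lshift _ (enum_rank j))) YM.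
  rewrite [RHS]mxE mxE => YMj; rewrite -[RHS]YMj.
  rewrite [RHS](reindex (@enum_rank T)) /=; last by apply: onW_bij; apply: enum_rank_bij.
  by apply: eq_bigr => t _; rewrite row_mxEl [V _ _]mxE !enum_rankK.
have YZ t : x t = 0 -> Y ord0 (enum_rank t) = 0.
  move=> xt.
  have := congr1 (fun B : 'M[rat]_(1, #|J| + #|T|) => B ord0 (rshift _ (enum_rank t))) YM.
  rewrite /M mul_mx_row row_mxEr /Z mul_mx_diag [RHS]mxE mxE [X in _ * X]mxE.
  by rewrite enum_rankK xt eqxx mulr1.
have Yx t : 0 < x t -> (1 - eta) * x t < ratr (Y ord0 (enum_rank t)) < x t.
  move=> xt; have := lt_le_trans (XY (enum_rank t)) (gx t xt).
  by rewrite mxE enum_rankK ltr_norml; nra.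
have Y0 t : 0 <= Y ord0 (enum_rank t).
  have := x0 t; rewrite le_eqVlt => /orP[/eqP/esym/YZ -> //|xt].
  rewrite -(ler0q R); have /andP[/ltW + _] := Yx t xt.
  by apply: le_trans; rewrite mulr_ge0 // subr_ge0 ltW.
pose d := (\prod_t `|denq (Y ord0 (enum_rank t))|)%N.
have d0 : (0 < d)%N.
  by apply: prodn_gt0 => t; rewrite absz_gt0 denq_eq0.
have /(_ _)/cid-/all_sig[q hq] :
    forall t, exists q : nat, q%:R = Y ord0 (enum_rank t) * d%:R.
  move=> t; rewrite /d (bigD1 t) //= natrM mulrA.
  exists (`|numq (Y ord0 (enum_rank t))| * \prod_(i | i != t) `|denq (Y ord0 (enum_rank i))|)%N.
  rewrite natrM; congr (_ * _).
  have E z : 0 <= z -> (`|z|%N)%:R = z%:~R :> rat by move=> z0; rewrite -{2}(gez0_abs z0).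
  by rewrite !E ?denq_ge0 ?numq_ge0 // numqE.
exists q, d; split=> // [j|t xt|t xt].
- under eq_bigr do rewrite hq mulrAC.
  by rewrite -mulr_suml YV mul0r.
- by apply/eqP; rewrite -(eqr_nat rat) hq YZ // mul0r.
- have -> : (q t)%:R = ratr (Y ord0 (enum_rank t)) * d%:R :> R.
    by rewrite -[LHS]ratr_nat hq rmorphM /= ratr_nat.
  by rewrite !ltr_pM2r ?ltr0n //; apply: Yx.
Qed.

(** * Block systems *)

Definition is_hom (G K : groupType) (f : G -> K) := {morph f : x y / (x * y)%g}.

(* The common features of the symmetric groups S_n and the unitary groups U(n):
   [bD] is the number of moved points, resp. the squared Hilbert-Schmidt norm of
   the difference, both unnormalized so as to be additive over the block sums
   [bsum], and [bnu] counts the multiplicities that classify the homomorphisms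
   from a finite group up to conjugacy. *)
Lemma is_homV (K L : groupType) (f : K -> L) : is_hom f -> forall x, f x^-1%g = (f x)^-1%g.
Proof.
move=> hf x; have f1 : f 1%g = 1%g by apply: (@mulgI _ (f 1%g)); rewrite -hf !mulg1.
by apply: (@mulgI _ (f x)); rewrite -hf !mulgV.
Qed.

(** The factor 2 in [bD_tri] accommodates a squared norm, and the constants 4 and 8 are large enough
    for both instances. [bcut] stands in for restriction to a part that [a] need not preserve. In
    [bnu_lip] and [bnu_conjugacy] the tolerance depends on [H] and [e] but not on [n]. *)
Record block_system (R : realType) := BlockSystem {
  bgrp :> nat -> groupType;
  bD : forall n, bgrp n -> bgrp n -> R;
  bsum : forall m l n, (m + l = n)%N -> bgrp m -> bgrp l -> bgrp n;
  bD_eq0 : forall n (a b : bgrp n), bD a b = 0 <-> a = b;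
  bD_ge0 : forall n (a b : bgrp n), 0 <= bD a b;
  bD_sym : forall n (a b : bgrp n), bD a b = bD b a;
  bD_tri : forall n (b a c : bgrp n), bD a c <= 2 * (bD a b + bD b c);
  bD_le : forall n (a b : bgrp n), bD a b <= 4 * n%:R;
  bD_mull : forall n (c a b : bgrp n), bD (c * a)%g (c * b)%g = bD a b;
  bD_mulr : forall n (c a b : bgrp n), bD (a * c)%g (b * c)%g = bD a b;
  bsumM : forall m l n (e : (m + l = n)%N) a a' b b',
    bsum e (a * a')%g (b * b')%g = (bsum e a b * bsum e a' b')%g;
  bD_bsum : forall m l n (e : (m + l = n)%N) a a' b b',
    bD (bsum e a b) (bsum e a' b') = bD a a' + bD b b';
  bcut : forall m l n (e : (m + l = n)%N) a,
    exists b, bD a (bsum e b 1%g) <= 8 * l%:R;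
  bidx : finGroupType -> finType;
  bnu : forall (H : finGroupType) n, (H -> bgrp n) -> bidx H -> nat;
  bnu_le : forall (H : finGroupType) n (a : H -> bgrp n) j,
    is_hom a -> (bnu a j <= n)%N;
  bnu_conj : forall (H : finGroupType) n (a : H -> bgrp n) u j,
    is_hom a -> bnu (fun h => u * a h * u^-1)%g j = bnu a j;
  bnu_bsum : forall (H : finGroupType) m l n (e : (m + l = n)%N)
      (a : H -> bgrp m) (b : H -> bgrp l) j, is_hom a -> is_hom b ->
    bnu (fun h => bsum e (a h) (b h)) j = (bnu a j + bnu b j)%N;
  bnu_lip : forall (H : finGroupType) e, 0 < e -> exists2 d, 0 < d &
    forall n (a b : H -> bgrp n), is_hom a -> is_hom b ->
    (forall h, bD (a h) (b h) <= d * n%:R) ->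
    forall j, (bnu a j)%:R <= (bnu b j)%:R + e * n%:R :> R;
  bnu_conjugacy : forall (H : finGroupType) e, 0 < e -> exists2 d, 0 < d &
    forall n (a b : H -> bgrp n) t, is_hom a -> is_hom b -> bnu a =1 bnu b ->
    (forall h, bD (t * b h)%g (a h * t)%g <= d * n%:R) ->
    exists2 t', (forall h, t' * b h = a h * t')%g & bD t t' <= e * n%:R
}.
Arguments bD {R _ n}.
Arguments bsum {R _ m l n}.
Arguments bnu {R _ H n}.

(* [nt psi tau] is the size of the part of type [tau] of the action [psi]. *)
Record type_theory (R : realType) (S : block_system R) (G : groupType)
    (H : finGroupType) (i : bool -> H -> G) := TypeTheory {
  gtype : finType;
  nt : forall n, (G -> S n) -> gtype -> nat;
  nt_sum : forall n (psi : G -> S n), is_hom psi -> (\sum_tau nt psi tau = n)%N;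
  nt_conj : forall n (psi : G -> S n) u tau,
    is_hom psi -> nt (fun g => u * psi g * u^-1)%g tau = nt psi tau;
  nt_bsum : forall m l n (e : (m + l = n)%N) (psi : G -> S m) (psi' : G -> S l) tau,
    is_hom psi -> is_hom psi' ->
    nt (fun g => bsum e (psi g) (psi' g)) tau = (nt psi tau + nt psi' tau)%N;
  nt_lip : forall e, 0 < e -> exists2 d, 0 < d &
    forall n (psi psi' : G -> S n), is_hom psi -> is_hom psi' ->
    (forall k h, bD (psi (i k h)) (psi' (i k h)) <= d * n%:R) ->
    forall tau, (nt psi tau)%:R <= (nt psi' tau)%:R + e * n%:R :> R;
  nt_split : forall n (psi : G -> S n) tau, is_hom psi ->
    exists l (e : (nt psi tau + l = n)%N) u (psi1 : G -> S (nt psi tau)) (psi2 : G -> S l),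
    [/\ is_hom psi1, is_hom psi2, nt psi1 tau = nt psi tau &
        psi = fun g => (u * bsum e (psi1 g) (psi2 g) * u^-1)%g];
  nt_prop : forall n n' (psi : G -> S n) (psi' : G -> S n') tau k j,
    is_hom psi -> is_hom psi' -> nt psi tau = n -> nt psi' tau = n' ->
    (bnu (psi \o i k) j * n' = bnu (psi' \o i k) j * n)%N
}.
Arguments nt {R S G H i _ n}.

Section BlockTheory.
Variables (R : realType) (S : block_system R).

Lemma bD_refl n (a : S n) : bD a a = 0. Proof. exact/bD_eq0. Qed.

Lemma is_hom1 (G K : groupType) : is_hom (fun _ : G => 1%g : K).
Proof. by move=> x y; rewrite mulg1. Qed.

Lemma is_hom_conj (G K : groupType) (f : G -> K) u :
  is_hom f -> is_hom (fun g => u * f g * u^-1)%g.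
Proof. by move=> hf x y; rewrite hf !mulgA mulgKV. Qed.

Lemma is_hom_comp (G K L : groupType) (f : K -> L) (g : G -> K) :
  is_hom f -> is_hom g -> is_hom (f \o g).
Proof. by move=> hf hg x y; rewrite /= hg hf. Qed.

Lemma is_hom_bsum (G : groupType) m l n (e : (m + l = n)%N) (f : G -> S m) (f' : G -> S l) :
  is_hom f -> is_hom f' -> is_hom (fun g => bsum e (f g) (f' g)).
Proof. by move=> hf hf' x y; rewrite hf hf' bsumM. Qed.

Lemma bsum_inj m l n (e : (m + l = n)%N) (a a' : S m) (b b' : S l) :
  bsum e a b = bsum e a' b' -> a = a' /\ b = b'.
Proof.
move=> /bD_eq0; rewrite bD_bsum => E.
by have := bD_ge0 a a'; have := bD_ge0 b b'; split; apply/bD_eq0; lra.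
Qed.

Lemma bsum11 m l n (e : (m + l = n)%N) : bsum e (1%g : S m) (1%g : S l) = 1%g.
Proof.
have : (bsum e 1 1 * bsum e (1 : S m) (1 : S l) = bsum e 1 1 * 1)%g.
  by rewrite -bsumM !mulg1.
exact: mulgI.
Qed.

Lemma is_hom_split (G : groupType) m l n (e : (m + l = n)%N) u (f : G -> S m) (f' : G -> S l) :
  is_hom (fun g => u * bsum e (f g) (f' g) * u^-1)%g -> is_hom f /\ is_hom f'.
Proof.
move=> hh; suff E x y : f (x * y)%g = (f x * f y)%g /\ f' (x * y)%g = (f' x * f' y)%g.
  by split=> x y; case: (E x y).
apply: (@bsum_inj _ _ _ e); rewrite bsumM; apply: (@mulgI _ u); apply: (@mulIg _ u^-1%g).
by rewrite [LHS]hh !mulgA mulgKV.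
Qed.

Lemma bD_conj n (u a b : S n) : bD (u * a * u^-1)%g (u * b * u^-1)%g = bD a b.
Proof. by rewrite bD_mulr bD_mull. Qed.

End BlockTheory.

(** * From almost intertwiners to exact ones *)

Section Exactification.
Variables (R : realType) (S : block_system R) (G : groupType) (H : finGroupType).
Variables (i : bool -> H -> G) (TT : type_theory S i).
Hypothesis hom_i : forall k, is_hom (i k).
Local Notation T := (gtype TT).
Local Notation nt := (@nt _ _ _ _ _ TT _).
Local Notation triv n := (fun _ : G => 1%g : S n).

Hypothesis ustable : forall (F : seq G) (e : R), 0 < e -> exists2 d, 0 < d &
  forall m (phi : G -> S m),
  (forall g h, bD (phi g * phi h)%g (phi (g * h)%g) <= d * m%:R) ->
  exists2 psi, is_hom psi & forall g, g \in F -> bD (phi g) (psi g) <= e * m%:R.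

Definition pure tau n (psi : G -> S n) := is_hom psi /\ nt psi tau = n.

(** A submonoid of the naturals; its gaps are the obstruction to prescribing the size of a pure
    action. *)
Definition sizes tau : set nat := [set n | exists psi : G -> S n, pure tau psi].

Lemma nt_le n (psi : G -> S n) tau : is_hom psi -> (nt psi tau <= n)%N.
Proof. by move=> hp; rewrite -{2}(nt_sum TT hp) (bigD1 tau) //= leq_addr. Qed.

Lemma pure_bsum tau m l n (e : (m + l = n)%N) (psi : G -> S m) (psi' : G -> S l) :
  pure tau psi -> pure tau psi' -> pure tau (fun g => bsum e (psi g) (psi' g)).
Proof.
by move=> [h1 h2] [h1' h2']; split; [apply: is_hom_bsum|rewrite nt_bsum // h2 h2'].
Qed.

Lemma sizes0 tau : sizes tau 0%N.
Proof.
exists (triv 0); split; first exact: is_hom1.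
by apply/eqP; rewrite -leqn0; apply/nt_le/is_hom1.
Qed.

Lemma sizesD tau a b : sizes tau a -> sizes tau b -> sizes tau (a + b)%N.
Proof. by move=> [psi p1] [psi' p2]; eexists; apply: pure_bsum p1 p2. Qed.

Lemma sizesM tau a c : sizes tau a -> sizes tau (c * a)%N.
Proof.
move=> sa; elim: c => [|c IH]; first by rewrite mul0n; apply: sizes0.
by rewrite mulSn; apply: sizesD.
Qed.

Lemma nt_sizes n (psi : G -> S n) tau : is_hom psi -> sizes tau (nt psi tau).
Proof. by case/(nt_split tau) => l [e [u [p1 [p2 [h1 h2 h3 _]]]]]; exists p1. Qed.

(** By [nt_prop] the multiplicity per unit of size can be read off any nonempty pure action. *)
Lemma rate_exists k tau j : exists r : rat, forall n (psi : G -> S n),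
  pure tau psi -> (bnu (psi \o i k) j)%:R = n%:R * r.
Proof.
case: (pselect (exists n (psi : G -> S n), (0 < n)%N /\ pure tau psi)); last first.
  move=> nex; exists 0 => n psi pp; case: (posnP n) => n0; last by case: nex; exists n, psi.
  rewrite mulr0; apply/eqP; rewrite pnatr_eq0 -leqn0 -n0.
  by apply/bnu_le/is_hom_comp => //; case: pp.
move=> [w [ref [w0 [r1 r2]]]]; exists ((bnu (ref \o i k) j)%:R / w%:R) => n psi [p1 p2].
have w0' : w%:R != 0 :> rat by rewrite pnatr_eq0 -lt0n.
apply: (mulIf w0'); rewrite -mulrA divfK // -!natrM.
by rewrite (nt_prop k j p1 r1 p2 r2) mulnC.
Qed.

Definition rate k tau j : rat := sval (cid (rate_exists k tau j)).

Lemma pure_nu k tau j n (psi : G -> S n) :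
  pure tau psi -> (bnu (psi \o i k) j)%:R = n%:R * rate k tau j.
Proof. exact: (svalP (cid (rate_exists k tau j))). Qed.

Definition defect tau j : rat := rate false tau j - rate true tau j.
(** Its vanishing for all [j] is what [bnu_conjugacy] asks of the two restrictions. *)
Definition gap n (psi : G -> S n) j : rat :=
  (bnu (psi \o i false) j)%:R - (bnu (psi \o i true) j)%:R.

Lemma gap_pure tau n (psi : G -> S n) j :
  pure tau psi -> gap psi j = n%:R * defect tau j.
Proof. by move=> pp; rewrite /gap !(pure_nu _ _ pp) mulrBr. Qed.

Lemma gap_bsum m l n (e : (m + l = n)%N) (psi : G -> S m) (psi' : G -> S l) j :
  is_hom psi -> is_hom psi' ->
  gap (fun g => bsum e (psi g) (psi' g)) j = gap psi j + gap psi' j.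
Proof.
move=> h1 h2; have E k : bnu ((fun g => bsum e (psi g) (psi' g)) \o i k) j =
    (bnu (psi \o i k) j + bnu (psi' \o i k) j)%N.
  by rewrite -(bnu_bsum e) //; apply: is_hom_comp.
by rewrite /gap !E !natrD; ring.
Qed.

Lemma gap_conj n (psi : G -> S n) u j :
  is_hom psi -> gap (fun g => u * psi g * u^-1)%g j = gap psi j.
Proof.
move=> h1; have E k : bnu ((fun g => u * psi g * u^-1)%g \o i k) j = bnu (psi \o i k) j.
  exact: (bnu_conj u j (is_hom_comp h1 (hom_i k))).
by rewrite /gap !E.
Qed.

Lemma gap1 n j : gap (triv n) j = 0.
Proof. by rewrite /gap subrr. Qed.

(* Types carried by a trivial action contribute nothing to the gap; all other
   types are unaffected by padding with a trivial action. *)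
Lemma trivial_type tau n j : (0 < nt (triv n) tau)%N -> defect tau j = 0.
Proof.
have [l [e [u [p1 [p2 [h1 h2 h3 E]]]]]] := nt_split tau (@is_hom1 G (S n)).
have p1E : p1 = triv (nt (triv n) tau).
  apply/funext => g; have := congr1 (fun f => u^-1 * f g * u)%g E.
  rewrite mulg1 mulVg !mulgA mulVg mul1g mulgKV => /esym pE.
  by have [] := bsum_inj (etrans pE (esym (bsum11 S e))).
have pp : pure tau p1 by [].
move=> n0; have := gap_pure j pp; rewrite p1E gap1 => /esym/eqP.
by rewrite mulf_eq0 pnatr_eq0 (gtn_eqF n0) => /eqP.
Qed.

(** Pieces are peeled off one type at a time and replaced in place, so errors and gaps add up. The
    induction is on the list of types that may still occur. *)
Lemma assemble (F : seq G) (N : T -> nat) (E : T -> R) (c : T -> rat) (ts : seq T) :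
    uniq ts ->
    (forall tau, tau \in ts -> forall psi : G -> S (N tau), pure tau psi ->
       exists psi' : G -> S (N tau), [/\ is_hom psi',
         forall s, s \in F -> bD (psi s) (psi' s) <= E tau &
         forall j, gap psi' j = c tau * defect tau j]) ->
  forall n (psi : G -> S n), is_hom psi ->
    (forall tau, nt psi tau = if tau \in ts then N tau else 0%N) ->
  exists psi' : G -> S n, [/\ is_hom psi',
    forall s, s \in F -> bD (psi s) (psi' s) <= \sum_(tau <- ts) E tau &
    forall j, gap psi' j = \sum_(tau <- ts) c tau * defect tau j].
Proof.
elim: ts => [|tau ts IH] /=.
  move=> _ _ n psi hp N0; have n0 : n = 0%N.
    by rewrite -(nt_sum TT hp) big1.
  exists psi; split => // [s _|j]; first by rewrite bD_refl big_nil.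
  rewrite big_nil; have E0 k : bnu (psi \o i k) j = 0%N.
    by apply/eqP; rewrite -leqn0 -n0; apply/bnu_le/is_hom_comp.
  by rewrite /gap !E0 subrr.
move=> /andP[tauts uts] rep n psi hp ntE.
have [l [e [u [p1 [p2 [h1 h2 h3 defpsi]]]]]] := nt_split tau hp.
have Nt : nt psi tau = N tau by rewrite ntE mem_head.
have ntD tau' : nt psi tau' = (nt p1 tau' + nt p2 tau')%N.
  by rewrite {1}defpsi nt_conj ?nt_bsum //; apply: is_hom_bsum.
have nt1 tau' : tau' != tau -> nt p1 tau' = 0%N.
  move=> ne; have := nt_sum TT h1; rewrite (bigD1 tau) //= (bigD1 tau') //= h3; lia.
have [p1' [h1' D1 g1]] : exists psi' : G -> S (nt psi tau), [/\ is_hom psi',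
         forall s, s \in F -> bD (p1 s) (psi' s) <= E tau &
         forall j, gap psi' j = c tau * defect tau j].
  have pp : pure tau p1 by [].
  move: pp; clear -rep Nt; move: p1; rewrite Nt => p1; apply: rep.
  exact: mem_head.
have [p2' [h2' D2 g2]] : exists psi' : G -> S l, [/\ is_hom psi',
    forall s, s \in F -> bD (p2 s) (psi' s) <= \sum_(tau <- ts) E tau &
    forall j, gap psi' j = \sum_(tau <- ts) c tau * defect tau j].
  apply: IH => // [tau' ht|tau']; first by apply: rep; rewrite inE ht orbT.
  have [->|ne] := eqVneq tau' tau.
    rewrite (negbTE tauts); have := ntD tau; rewrite h3; lia.
  by have := ntD tau'; rewrite nt1 // ntE inE (negbTE ne) /= add0n => ->.
exists (fun g => u * bsum e (p1' g) (p2' g) * u^-1)%g; split.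
- exact/is_hom_conj/is_hom_bsum.
- move=> s sF; rewrite {1}defpsi bD_conj bD_bsum big_cons.
  by apply: lerD; [apply: D1|apply: D2].
- by move=> j; rewrite gap_conj ?gap_bsum ?big_cons ?g1 ?g2 //; apply: is_hom_bsum.
Qed.

(** Runs [assemble] with every piece replaced by itself. The result agrees with [psi] on the images
    of [H], and the gap depends on nothing else. *)
Lemma gapE n (psi : G -> S n) j : is_hom psi ->
  gap psi j = \sum_tau (nt psi tau)%:R * defect tau j.
Proof.
move=> hp; pose F := [seq i p.1 p.2 | p <- enum [set: bool * H]].
have [||psi' [hp' Dp gE]] := @assemble F (nt psi) (fun=> 0)
    (fun tau => (nt psi tau)%:R) (index_enum T) (index_enum_uniq _) _ n psi hp _.
- move=> tau _ p pp; exists p; split=> [|s _|j']; [by case: pp|by rewrite bD_refl|].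
  exact: gap_pure pp.
- by move=> tau; rewrite mem_index_enum.
suff E k : psi \o i k = psi' \o i k by rewrite -gE /gap !E.
apply/funext => h /=; apply/bD_eq0/le_anti; rewrite bD_ge0 andbT.
have := Dp (i k h); rewrite big1 //; apply.
by apply/mapP; exists (k, h); rewrite // mem_enum inE.
Qed.

(** Truncating to size [k - B] keeps the pure part of the corrected truncation, of size [m'], at
    most [k - B]; hence [k - m'] is the size of some pure action. The outcome is a pure part of size
    [k] beside a trivial action, whence the gap. *)
Lemma fill_pure (tau : T) (F : seq G) (e : R) :
    (forall n, nt (triv n) tau = 0%N) -> 0 < e ->
  exists2 eta : R, 0 < eta < 1 & forall B k n (psi : G -> S n),
    (forall m, sizes tau m -> (m + B <= k)%N -> sizes tau (k - m)%N) ->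
    (k <= n)%N -> (1 - eta) * n%:R + B%:R <= k%:R -> pure tau psi ->
  exists psi' : G -> S n, [/\ is_hom psi',
    forall s, s \in F -> bD (psi s) (psi' s) <= e * n%:R &
    forall j, gap psi' j = k%:R * defect tau j].
Proof.
move=> triv0 e0; pose F' := F ++ [seq i p.1 p.2 | p <- enum [set: bool * H]].
have [d2 d20 lip] := @nt_lip _ _ _ _ _ TT (e / 16) ltac:(lra).
pose b := Num.min d2 (e / 8).
have b0 : 0 < b by rewrite lt_min d20 /=; lra.
have bd2 : b <= d2 by rewrite ge_min lexx.
have be : b <= e / 8 by rewrite ge_min lexx orbT.
have [d d0 stab] := ustable F' (e := b / 4) ltac:(lra).
(* Truncation costs [8 * l] with [l <= eta * n]. The truncated map is multiplicative up to [80 * l],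
   which [d / 160] puts below [d * m] because [m] is at least half of [n]; [b / 32] keeps the
   corrected action within [b * n] of [psi]. *)
pose eta := Num.min (1 / 2) (Num.min (d / 160) (Num.min (b / 32) (e / 64))).
have eta0 : 0 < eta by rewrite !lt_min; apply/and4P; split; lra.
have eta1 : eta <= 1 / 2 by rewrite ge_min lexx.
have etad : eta <= d / 160 by rewrite !ge_min lexx !orbT.
have etab : eta <= b / 32 by rewrite !ge_min lexx !orbT.
clearbody eta b.
exists eta; first lra.
move=> B k n psi sz kn ple [hp np].
have kB : (B <= k)%N.
  rewrite -(ler_nat R); apply: le_trans ple; rewrite lerDr mulr_ge0 ?ler0n //; lra.
pose m := (k - B)%N; pose l := (n - m)%N.
have eml : (m + l = n)%N by apply/subnKC/(leq_trans (leq_subr _ _)).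
have lE : l%:R = n%:R - m%:R :> R by rewrite -[in RHS]eml natrD addrC addKr.
have mE : m%:R = k%:R - B%:R :> R by rewrite natrB.
have n0 : 0 <= n%:R :> R by [].
have l0 : 0 <= l%:R :> R by [].
have m0 : 0 <= m%:R :> R by [].
have le_l : l%:R <= eta * n%:R by lra.
have mB : (m + B = k)%N by rewrite subnK.
clearbody l m.
have mul_n (a a' : R) : a <= a' -> a * n%:R <= a' * n%:R by apply: ler_wpM2r.
have en1 := mul_n _ _ eta1; have en2 := mul_n _ _ etad.
have en3 := mul_n _ _ etab; have en4 := mul_n _ _ be.
have dm : d * (1 / 2 * n%:R) <= d * m%:R by apply: ler_wpM2l; [exact: ltW|lra].
have bm : b * m%:R <= b * n%:R by apply: ler_wpM2l; [exact: ltW|lra].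
have n01 : 0 <= e * n%:R by apply: mulr_ge0 => //; exact: ltW.
have /(_ _)/cid-/all_sig[phi hphi] := fun g => bcut eml (psi g).
have [|psi' hp' near'] := stab m phi.
  move=> g h; have tri := bD_tri.
  have E1 : bD (phi g * phi h)%g (phi (g * h)%g) =
      bD (bsum eml (phi g) 1 * bsum eml (phi h) 1)%g (bsum eml (phi (g * h)%g) 1%g).
    by rewrite -bsumM mulg1 bD_bsum bD_refl addr0.
  have h1 := tri _ _ _ (psi (g * h)%g) (bsum eml (phi g) 1 * bsum eml (phi h) 1)%g
    (bsum eml (phi (g * h)%g) 1%g).
  have h2 := tri _ _ _ (psi g * bsum eml (phi h) 1)%g
    (bsum eml (phi g) 1 * bsum eml (phi h) 1)%g (psi (g * h)%g).
  rewrite bD_mulr hp bD_mull ![bD (bsum _ _ _) (psi _)]bD_sym -hp in h2.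
  have := hphi g; have := hphi h; have := hphi (g * h)%g.
  rewrite E1; clear -h1 h2 dm en2 le_l; lra.
have nearF s : s \in F' -> bD (psi s) (bsum eml (psi' s) 1%g) <= b * n%:R.
  move=> sF; have := bD_tri (bsum eml (phi s) 1%g) (psi s) (bsum eml (psi' s) 1%g).
  rewrite bD_bsum bD_refl addr0; have := near' s sF; have := hphi s.
  by clear -bm en3 le_l; lra.
pose chi g := bsum eml (psi' g) (1%g : S l).
have hchi : is_hom chi by apply: is_hom_bsum => //; apply: is_hom1.
(* The hypothesis on trivial actions enters here: the padding must not add to the part of type
   [tau], whose size is thus at most [m]. *)
have ntchi : nt chi tau = nt psi' tau.
  by rewrite nt_bsum ?triv0 ?addn0 //; apply: is_hom1.
have lb : n%:R <= (nt chi tau)%:R + e / 16 * n%:R :> R.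
  rewrite -{1}np; apply: lip => // k' h.
  apply: (le_trans (nearF _ _)); last by rewrite ler_wpM2r.
  by rewrite mem_cat; apply/orP; right; apply/mapP; exists (k', h); rewrite // mem_enum inE.
have [l2 [e2 [u [rho [sig [hrho hsig rhoE chiE]]]]]] := nt_split tau hchi.
set m' := nt chi tau in rho hrho rhoE e2 lb chiE.
have m'm : (m' + B <= k)%N.
  by rewrite -mB leq_add2r /m' ntchi; apply: nt_le.
have [fil pfil] := sz m' (nt_sizes tau hchi) m'm.
have e3 : (k - m' + (n - k) = l2)%N by clear -kn m'm e2; lia.
have hfil : is_hom (fun g => bsum e3 (fil g) (1%g : S (n - k)%N)).
  by apply: is_hom_bsum; [case: pfil|apply: is_hom1].
exists (fun g => u * bsum e2 (rho g) (bsum e3 (fil g) 1%g) * u^-1)%g; split.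
- exact/is_hom_conj/is_hom_bsum.
- move=> s sF; have := bD_tri (chi s) (psi s)
    (u * bsum e2 (rho s) (bsum e3 (fil s) 1%g) * u^-1)%g.
  rewrite {2}chiE bD_conj bD_bsum bD_refl add0r.
  have := nearF s; rewrite mem_cat sF => /(_ isT).
  have := bD_le (sig s) (bsum e3 (fil s) 1%g).
  have -> : l2%:R = n%:R - m'%:R :> R by rewrite -e2 natrD addrC addKr.
  by rewrite -/(chi s); clear -lb en4 n01; lra.
- move=> j; rewrite gap_conj ?gap_bsum //; first last.
  + exact: is_hom_bsum.
  + exact: is_hom1.
  + by case: pfil.
  rewrite (@gap_pure tau) // (gap_pure j pfil) gap1 addr0 -mulrDl -natrD.
  by congr (_%:R * _); clear -m'm; lia.
Qed.

Lemma bigmin_gt0 (I : finType) (f : I -> R) (a : R) :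
  0 < a -> (forall k, 0 < f k) -> 0 < \big[Num.min/a]_k f k.
Proof. by move=> a0 f0; elim/big_ind: _ => // u v u0 v0; rewrite lt_min u0. Qed.

Definition almost_intertwines (d : R) n (psi : G -> S n) (t : S n) :=
  forall h, bD (t * psi (i true h))%g (psi (i false h) * t)%g <= d * n%:R.

(** Conjugating [psi \o i true] by [t] preserves its multiplicities and brings it close to
    [psi \o i false]. *)
Lemma gap_small e : 0 < e -> exists2 d, 0 < d &
  forall n (psi : G -> S n) t, is_hom psi -> almost_intertwines d psi t ->
  forall j, `|ratr (gap psi j)| <= e * n%:R :> R.
Proof.
move=> e0; have [d d0 lip] := bnu_lip S H e0; exists d => // n psi t hp near j.
have h1 k : is_hom (psi \o i k) by apply: is_hom_comp.
have h2 := is_hom_conj t (h1 true).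
have D h : bD ((psi \o i false) h) (t * (psi \o i true) h * t^-1)%g <= d * n%:R.
  by rewrite /= -(bD_mulr t) mulgKV bD_sym; apply: near.
have l1 := lip _ _ _ (h1 false) h2 D j.
have l2 := lip _ _ _ h2 (h1 false) (fun h => ltac:(rewrite bD_sym; exact: D)) j.
rewrite bnu_conj // in l1 l2.
rewrite /gap rmorphB /= !ratr_nat ler_norml; clear -l1 l2; apply/andP; split; lra.
Qed.

Lemma exact_of_gap0 e : 0 < e -> exists2 d, 0 < d &
  forall n (psi : G -> S n) t, is_hom psi -> gap psi =1 (fun=> 0) ->
  almost_intertwines d psi t ->
  exists2 t', (forall h, t' * psi (i true h) = psi (i false h) * t')%g &
    bD t t' <= e * n%:R.
Proof.
move=> e0; have [d d0 conj] := bnu_conjugacy S H e0; exists d => // n psi t hp g0 near.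
apply: (conj _ (psi \o i false) (psi \o i true)) => //; try exact: is_hom_comp.
by move=> j; apply/eqP; rewrite -(eqr_nat rat) -subr_eq0; apply/eqP/g0.
Qed.

(* The types [tau] with [x tau = 0] are replaced by trivial actions, and the
   others are shrunk to the sizes prescribed by a rational point of the kernel
   lying slightly below [x]. *)
Lemma close_gap (x : T -> R) (F : seq G) (e : R) :
    0 < e -> (forall tau, 0 <= x tau) ->
    (forall j, \sum_tau x tau * ratr (defect tau j) = 0) ->
    (forall tau, 0 < x tau -> exists2 w, (0 < w)%N & sizes tau w) ->
  exists2 eps, 0 < eps & exists N : nat, forall n (psi : G -> S n), (N <= n)%N ->
    is_hom psi -> (forall tau, `|(nt psi tau)%:R - x tau * n%:R| <= eps * n%:R) ->
    exists psi' : G -> S n, [/\ is_hom psi',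
      forall s, s \in F -> bD (psi s) (psi' s) <= e * n%:R & gap psi' =1 (fun=> 0)].
Proof.
move=> e0 x0 xdef xsize.
have /(_ _)/cid2-/all_sig2[eta_ eta01 fill] : forall tau, exists2 eta : R, 0 < eta < 1 &
    (forall n, nt (triv n) tau = 0%N) -> forall B k n (psi : G -> S n),
    (forall m, sizes tau m -> (m + B <= k)%N -> sizes tau (k - m)%N) ->
    (k <= n)%N -> (1 - eta) * n%:R + B%:R <= k%:R -> pure tau psi ->
  exists psi' : G -> S n, [/\ is_hom psi',
    forall s, s \in F -> bD (psi s) (psi' s) <= e / 2 * n%:R &
    forall j, gap psi' j = k%:R * defect tau j].
  move=> tau; case: (pselect (forall n, nt (triv n) tau = 0%N)) => [t0|nt0].
    by have [|eta eta01 P] := @fill_pure tau F (e / 2) t0; [lra|exists eta].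
  by exists (1 / 2); [lra|move=> /nt0].
pose eta := \big[Num.min/(1 / 2)]_tau eta_ tau.
have eta0 : 0 < eta.
  apply: bigmin_gt0 => [|tau]; [lra|by case/andP: (eta01 tau)].
have eta1 : eta <= 1 / 2 by apply: bigmin_le_id.
have etaL tau : eta <= eta_ tau by apply: bigmin_le_cond.
have [|q [d [d0 qdef qx0 qx]]] := @rat_kernel_dense R T _ defect x (eta / 2) _ x0 xdef.
  by clear -eta0 eta1; lra.
have [w w0 ws] : exists2 w, (0 < w)%N & forall tau, 0 < x tau -> sizes tau w.
  have /(_ _)/cid2-/all_sig2[w_ w_0 w_s] : forall tau, exists2 w, (0 < w)%N &
      0 < x tau -> sizes tau w.
    move=> tau; case: (ltP 0 (x tau)) => [/xsize[w w0 ws]|_]; first by exists w.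
    by exists 1%N.
  exists (\prod_tau w_ tau)%N; first exact: prodn_gt0.
  move=> tau xt; rewrite (bigD1 tau) //= mulnC; exact/sizesM/w_s.
have /(_ _)/cid-/all_sig[B_ HB] : forall tau, exists B : nat, 0 < x tau ->
    forall m k, sizes tau m -> (w %| k)%N -> (m + B <= k)%N -> sizes tau (k - m)%N.
  move=> tau; case: (ltP 0 (x tau)) => [xt|_]; last by exists 0%N.
  have [B HB] := numerical_semigroup w0 (ws tau xt) (sizes0 tau) (@sizesD tau).
  by exists B.
have d0' : 0 < d%:R :> R by rewrite ltr0n.
(* The first bound keeps the prescribed size below the actual one; the second keeps the loss within
   what [fill] tolerates. *)
pose g tau := if 0 < x tau then Num.min (x tau - (q tau)%:R / d%:R) (eta * x tau / 4) else 1.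
have g0 tau : 0 < g tau.
  rewrite /g; case: ifP => // xt; rewrite lt_min subr_gt0 ltr_pdivrMr //.
  have /andP[_ ->] := qx tau xt; rewrite /=; have := mulr_gt0 eta0 xt; lra.
pose cT : R := #|T|%:R + 1.
have cT0 : 0 < cT by rewrite ltr_wpDl.
pose eps := Num.min (e / (8 * cT)) (\big[Num.min/1]_tau g tau).
have eps0 : 0 < eps.
  rewrite lt_min; apply/andP; split; first by rewrite divr_gt0 // mulr_gt0.
  exact: bigmin_gt0.
have epsT : eps * cT <= e / 8.
  have : eps <= e / (8 * cT) by rewrite ge_min lexx.
  move=> /(ler_wpM2r (ltW cT0)) /le_trans; apply.
  by rewrite invfM mulrA divfK // gt_eqF.
have epsg tau : eps <= g tau.
  by rewrite ge_min; apply/orP; right; apply: bigmin_le_cond.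
exists eps => //.
(* From this size on, the filling constant [B_ tau] and the rounding error [w * q tau] together are
   at most [eta * x tau / 4 * n]. *)
pose M tau := Num.bound (((B_ tau)%:R + (w * q tau)%:R) / (eta * x tau / 4)).
exists (\sum_tau M tau)%N => n psi nN hp ntx.
have n0 : 0 <= n%:R :> R by [].
pose c := (n %/ (w * d))%N.
have c1 : (c * (w * d))%:R <= n%:R :> R by rewrite ler_nat leq_trunc_div.
have c2 : n%:R <= (c * (w * d))%:R + (w * d)%:R :> R.
  rewrite -natrD ler_nat addnC -mulSn; apply/ltnW/ltn_ceil.
  by rewrite muln_gt0 w0.
rewrite natrM in c1 c2; rewrite natrM in c1 c2.
(* Proportional to [q], so that the gaps of the resized pieces cancel exactly, and divisible by [w],
   as the filling requires. *)
pose k tau := (w * q tau * c)%N.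
have kE tau : (k tau)%:R = (q tau)%:R / d%:R * (c%:R * (w%:R * d%:R)) :> R.
  by rewrite /k !natrM; field; rewrite gt_eqF.
have kle tau : 0 < x tau -> (k tau <= nt psi tau)%N.
  move=> xt; have := ntx tau; rewrite ler_norml => /andP[+ _].
  have : eps <= x tau - (q tau)%:R / d%:R.
    by apply: le_trans (epsg tau) _; rewrite /g xt ge_min lexx.
  move=> /(ler_wpM2r n0); rewrite -(ler_nat R) kE.
  have : (q tau)%:R / d%:R * (c%:R * (w%:R * d%:R)) <= (q tau)%:R / d%:R * n%:R :> R.
    by apply: ler_wpM2l => //; rewrite divr_ge0.
  by clear; set u := (q tau)%:R / d%:R * _; lra.
have kge tau : 0 < x tau -> (1 - eta_ tau) * (nt psi tau)%:R + (B_ tau)%:R <= (k tau)%:R :> R.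
  move=> xt; have := ntx tau; rewrite ler_norml => /andP[_ h1].
  have h2 : eps <= eta * x tau / 4.
    by apply: le_trans (epsg tau) _; rewrite /g xt ge_min lexx orbT.
  have /andP[h3 _] := qx tau xt.
  have ex4 : 0 < eta * x tau / 4 by rewrite divr_gt0 // mulr_gt0.
  have h4 : (B_ tau)%:R + (w * q tau)%:R <= eta * x tau / 4 * n%:R :> R.
    rewrite mulrC -ler_pdivrMr //; apply: le_trans (_ : (M tau)%:R <= _).
      by apply/ltW/archi_boundP; rewrite divr_ge0 // ltW.
    by rewrite ler_nat; apply: leq_trans nN; rewrite (bigD1 tau) //= leq_addr.
  have h5 : (q tau)%:R / d%:R * n%:R <= (k tau)%:R + (w * q tau)%:R :> R.
    rewrite kE natrM.
    have : (q tau)%:R / d%:R * n%:R <= (q tau)%:R / d%:R * (c%:R * (w%:R * d%:R) + w%:R * d%:R) :> R.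
      by apply: ler_wpM2l => //; rewrite divr_ge0.
    move=> /le_trans; apply; rewrite mulrDr lerD2l le_eqVlt; apply/orP; left; apply/eqP.
    by field; rewrite gt_eqF.
  have h6 : (1 - eta / 2) * x tau * n%:R <= (q tau)%:R / d%:R * n%:R.
    by apply: ler_wpM2r => //; rewrite ler_pdivlMr // ltW.
  have h7 : (1 - eta_ tau) * (nt psi tau)%:R <= (1 - eta) * (nt psi tau)%:R.
    by apply: ler_wpM2r => //; rewrite lerD2l lerN2.
  have h8 : (1 - eta) * (nt psi tau)%:R <= (1 - eta) * (x tau * n%:R + eps * n%:R).
    by apply: ler_wpM2l; [clear -eta1; lra|clear -h1; lra].
  have h9 : (1 - eta) * (eps * n%:R) <= 1 * (eps * n%:R).
    by apply: ler_wpM2r; [apply: mulr_ge0 => //; exact: ltW|clear -eta0; lra].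
  have h10 := ler_wpM2r n0 h2.
  clear -h4 h5 h6 h7 h8 h9 h10; set u := _ / _ * _ in h5 h6; lra.
have [||psi' [hp' near g']] := @assemble F (nt psi)
    (fun tau => e / 2 * (nt psi tau)%:R + 4 * (eps * n%:R)) (fun tau => (k tau)%:R)
    (index_enum T) (index_enum_uniq _) _ n psi hp _.
- move=> tau _ p pp.
  have E0 : 0 <= e / 2 * (nt psi tau)%:R by rewrite mulr_ge0 // ltW // divr_gt0.
  have E1 : 0 <= 4 * (eps * n%:R) by rewrite !mulr_ge0 // ltW.
  case: (ltP 0 (x tau)) => [xt|xt]; last first.
    have x00 : x tau = 0 by apply/le_anti; rewrite xt x0.
    exists (fun=> 1%g); split; first exact: is_hom1.
      move=> s _; apply: le_trans (bD_le _ _) _.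
      have := ntx tau; rewrite x00 mul0r subr0 ger0_norm //; clear -E0; lra.
    by move=> j; rewrite gap1 /k qx0 // muln0 mul0n mul0r.
  (* A type that occurs in a trivial action has defect 0, so its piece can be kept at its present
     size. *)
  case: (pselect (forall n, nt (triv n) tau = 0%N)) => [t0|nt0].
    have [|p' [hp' Dp gp]] := fill tau t0 (B_ tau) (k tau) _ p _ (kle tau xt) (kge tau xt) pp.
      by move=> m sm; apply: HB => //; rewrite /k -mulnA dvdn_mulr.
    exists p'; split=> // s sF; apply: le_trans (Dp s sF) _; rewrite lerDl //.
  have dz j : defect tau j = 0.
    apply/eqP/negPn/negP => dn; apply: nt0 => m; apply/eqP.
    by rewrite -leqn0 leqNgt; apply: contra dn => /trivial_type ->.
  exists p; split=> [|s _|j]; first by case: pp.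
    by rewrite bD_refl addr_ge0.
  by rewrite (gap_pure _ pp) dz !mulr0.
- by move=> tau; rewrite mem_index_enum.
exists psi'; split=> // [s sF|j].
  apply: le_trans (near s sF) _; rewrite big_split /= -mulr_sumr -natr_sum nt_sum //.
  rewrite sumr_const cardT -cardE -mulr_natr.
  have := ler_wpM2r n0 epsT; rewrite /cT; clear -n0 e0 eps0.
  have : 0 <= eps * n%:R by rewrite mulr_ge0 // ltW.
  have : 0 <= e * n%:R by rewrite mulr_ge0 // ltW.
  by rewrite mulrDr mulrDl; lra.
rewrite g'; transitivity ((w * c)%:R * \sum_tau (q tau)%:R * defect tau j).
  by rewrite mulr_sumr; apply: eq_bigr => tau _; rewrite /k !natrM; ring.
by rewrite qdef mulr0.
Qed.

Lemma natr_dist_lt1 (a b : nat) : `|a%:R - b%:R| < 1 :> R -> a = b.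
Proof.
case: (ltngtP a b) => // lt; [rewrite distrC|];
  by rewrite -natrB ?(ltnW lt) // normr_nat ltrn1 => /eqP; move: lt; clear; lia.
Qed.

(** The tolerance of [close_gap] depends on the limit proportions [x]. Arguing by contradiction
    along a sequence fixes [x] before the tolerance is chosen. *)
Theorem near_exact (F : seq G) (e : R) : 0 < e -> exists2 d, 0 < d &
  forall n (psi : G -> S n) t, is_hom psi -> almost_intertwines d psi t ->
  exists (psi' : G -> S n) t', [/\ is_hom psi',
    (forall h, t' * psi' (i true h) = psi' (i false h) * t')%g,
    forall s, s \in F -> bD (psi s) (psi' s) <= e * n%:R &
    bD t t' <= e * n%:R].
Proof.
move=> e0; apply: contrapT => nex.
have [d1 d10 exact_t] := exact_of_gap0 e0.
pose good n (psi : G -> S n) t := exists (psi' : G -> S n) t', [/\ is_hom psi',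
    (forall h, t' * psi' (i true h) = psi' (i false h) * t')%g,
    forall s, s \in F -> bD (psi s) (psi' s) <= e * n%:R &
    bD t t' <= e * n%:R].
have /(_ _)/cid-/all_sig[X HX] : forall k : nat, exists X : {n & ((G -> S n) * S n)%type},
    [/\ is_hom (projT2 X).1, almost_intertwines k.+1%:R^-1 (projT2 X).1 (projT2 X).2 &
        ~ good _ (projT2 X).1 (projT2 X).2].
  move=> k; apply: contrapT => nX; apply: nex.
  exists (k.+1%:R^-1) => [|n psi t hp near]; first by rewrite invr_gt0 ltr0n.
  by apply: contrapT => ngood; apply: nX; exists (existT _ n (psi, t)).
pose n_ k := projT1 (X k); pose p_ k : G -> S (n_ k) := (projT2 (X k)).1.
pose t_ k : S (n_ k) := (projT2 (X k)).2.
have hp_ k : is_hom (p_ k) by case: (HX k).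
have ngood k : ~ good _ (p_ k) (t_ k) by case: (HX k).
have near_ d : 0 < d -> exists K : nat, forall k, (K <= k)%N ->
    almost_intertwines d (p_ k) (t_ k).
  move=> d0; exists (Num.bound d^-1) => k Kk h.
  have [_ near _] := HX k; apply: le_trans (near h) _; apply: ler_wpM2r => //.
  rewrite -[d]invrK lef_pV2 ?posrE ?invr_gt0 ?ltr0n //.
  apply: le_trans (_ : (Num.bound d^-1)%:R <= _).
    by apply/ltW/archi_boundP; rewrite invr_ge0 ltW.
  by rewrite ler_nat leqW.
(* In bounded size a small relative gap is an integer below 1 in absolute value, hence 0; then
   correcting [t] alone contradicts [ngood]. *)
have grow N : exists K : nat, forall k, (K <= k)%N -> (N <= n_ k)%N.
  have [d d0 small] := @gap_small (N.+1%:R^-1) ltac:(by rewrite invr_gt0 ltr0n).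
  have [K1 H1] := near_ d d0; have [K2 H2] := near_ d1 d10.
  exists (K1 + K2)%N => k Kk; rewrite leqNgt; apply/negP => nN.
  have gz : gap (p_ k) =1 fun=> 0.
    move=> j; have := small _ _ _ (hp_ k) (H1 k (leq_trans (leq_addr _ _) Kk)) j.
    have lt1 : N.+1%:R^-1 * (n_ k)%:R < 1 :> R.
      by rewrite mulrC ltr_pdivrMr ?ltr0n // mul1r ltr_nat ltnW.
    move=> hle; have := le_lt_trans hle lt1; rewrite /gap rmorphB /= !ratr_nat.
    by move=> /natr_dist_lt1 ->; rewrite subrr.
  have [t' ht' Dt] := exact_t _ _ _ (hp_ k) gz (H2 k (leq_trans (leq_addl _ _) Kk)).
  case: (ngood k); exists (p_ k), t'; split => // s _.
  by rewrite bD_refl mulr_ge0 // ltW.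
have n_0 k : 0 <= (n_ k)%:R :> R by [].
have [|x x0 clx] := @cluster_point R T (fun k tau => (nt (p_ k) tau)%:R / (n_ k)%:R).
  move=> k tau; rewrite divr_ge0 //=; case: (posnP (n_ k)) => [n0|n0].
    by have -> : (n_ k)%:R = 0 :> R; rewrite ?n0 // invr0 mulr0.
  by rewrite ler_pdivrMr ?ltr0n // mul1r ler_nat nt_le.
have close eps K : 0 < eps -> exists2 k, (K <= k)%N & (0 < n_ k)%N /\
    forall tau, `|(nt (p_ k) tau)%:R - x tau * (n_ k)%:R| <= eps * (n_ k)%:R.
  move=> eps0; have [K1 H1] := grow 1%N; have [k Kk Hk] := clx eps (K1 + K)%N eps0.
  exists k; first exact: leq_trans (leq_addl _ _) Kk.
  have n0 : (0 < n_ k)%N by apply: H1; apply: leq_trans (leq_addr _ _) Kk.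
  split=> // tau; have n0' : 0 < (n_ k)%:R :> R by rewrite ltr0n.
  rewrite -[X in X - _](divfK (lt0r_neq0 n0')) -mulrBl normrM [X in _ * X]ger0_norm //.
  by apply: ler_wpM2r => //; exact/ltW/Hk.
(* By [gapE] this sum is approximated by gaps per unit of size, which tend to 0 along the
   sequence. *)
have xdef j : \sum_tau x tau * ratr (defect tau j) = 0.
  apply/eqP; rewrite -normr_le0; apply/ler_addgt0Pl => eps eps0; rewrite addr0.
  pose s := 1 + \sum_tau `|ratr (defect tau j)| : R.
  have s0 : 0 < s by rewrite ltr_pwDl ?ltr01 ?sumr_ge0.
  have [d d0 small] := @gap_small (eps / 2) ltac:(lra).
  have [K HK] := near_ d d0.
  have [|k Kk [n0 Hk]] := close (eps / 2 / s) K; first by rewrite !divr_gt0.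
  have n0' : 0 < (n_ k)%:R :> R by rewrite ltr0n.
  rewrite -(ler_pM2r n0') -[X in _ * X <= _](ger0_norm (n_0 k)) -normrM.
  have := small _ _ _ (hp_ k) (HK k Kk) j; rewrite gapE // rmorph_sum /= => h1.
  have h2 : `|\sum_tau ratr ((nt (p_ k) tau)%:R * defect tau j) -
      (\sum_tau x tau * ratr (defect tau j)) * (n_ k)%:R| <= eps / 2 * (n_ k)%:R :> R.
    rewrite mulr_suml -sumrB; apply: le_trans (ler_norm_sum _ _ _) _.
    apply: (@le_trans _ _ (\sum_tau (eps / 2 / s * (n_ k)%:R) * `|ratr (defect tau j)|)).
      apply: ler_sum => tau _; rewrite rmorphM /= ratr_nat mulrAC -mulrBl normrM.
      exact: ler_wpM2r.
    rewrite -mulr_sumr mulrAC; apply: ler_wpM2r => //.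
    rewrite -(mulrA (eps / 2)) -[leRHS]mulr1; apply: ler_wpM2l; first by rewrite divr_ge0 // ltW.
    by rewrite ler_pdivrMl // mulr1 lerDr.
  set a := \sum_tau _ in h1 h2; set b := _ * (n_ k)%:R in h2 *; have -> : b = a - (a - b) by ring.
  by apply: le_trans (ler_normB _ _) _; clear -h1 h2; lra.
have xsize tau : 0 < x tau -> exists2 w, (0 < w)%N & sizes tau w.
  move=> xt; have [|k _ [n0 Hk]] := close (x tau / 2) 0%N; first lra.
  exists (nt (p_ k) tau); last exact: nt_sizes.
  rewrite lt0n; apply/eqP => E; have := Hk tau; rewrite E sub0r normrN normrM !ger0_norm //.
  have : 0 < x tau * (n_ k)%:R by rewrite mulr_gt0 ?ltr0n.
  by clear; lra.
pose F' := F ++ [seq i p.1 p.2 | p <- enum [set: bool * H]].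
(* Two applications of [bD_tri] cost [(2 + 4 + 4) * (d1 / 16)], which is within the tolerance [d1]
   of [exact_t]. *)
pose e' := Num.min e (d1 / 16).
have e'0 : 0 < e' by rewrite lt_min e0 /=; lra.
have e'e : e' <= e by rewrite ge_min lexx.
have e'd : e' <= d1 / 16 by rewrite ge_min lexx orbT.
have [eps eps0 [N fix_gap]] := close_gap F' e'0 x0 xdef xsize.
have [K1 H1] := grow N; have [|K2 H2] := near_ (d1 / 16); first lra.
have [k Kk [n0 Hk]] := close eps (K1 + K2)%N eps0.
have [psi' [hp' near' g']] := fix_gap _ _ (H1 k (leq_trans (leq_addr _ _) Kk)) (hp_ k) Hk.
have nearH b h : bD (p_ k (i b h)) (psi' (i b h)) <= e' * (n_ k)%:R.
  apply: near'; rewrite mem_cat; apply/orP; right.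
  by apply/mapP; exists (b, h); rewrite // mem_enum inE.
have [|t' ht' Dt] := exact_t _ _ (t_ k) hp' g'.
  move=> h; have near := H2 k (leq_trans (leq_addl _ _) Kk) h.
  have h1 := bD_tri (t_ k * p_ k (i true h))%g (t_ k * psi' (i true h))%g (psi' (i false h) * t_ k)%g.
  have h2 := bD_tri (p_ k (i false h) * t_ k)%g (t_ k * p_ k (i true h))%g (psi' (i false h) * t_ k)%g.
  rewrite bD_mull [bD (psi' _) _]bD_sym in h1; rewrite bD_mulr in h2.
  have h3 := nearH true h; have h4 := nearH false h.
  have h5 := ler_wpM2r (n_0 k) e'd.
  have h6 : 0 <= d1 * (n_ k)%:R by rewrite mulr_ge0 // ltW.
  by clear -h1 h2 h3 h4 h5 h6 near; lra.
case: (ngood k); exists psi', t'; split=> // s sF.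
apply: le_trans (ler_wpM2r (n_0 k) e'e); apply: near'.
by rewrite mem_cat sF.
Qed.

End Exactification.

(** * Unitary groups *)

Local Open Scope sesquilinear_scope.

(** * Hilbert-Schmidt norms and orthogonal projections *)

Section HilbertSchmidt.
Variable C : numClosedFieldType.
Implicit Types m n p : nat.

Lemma adjM m n p (A : 'M[C]_(m, n)) (B : 'M[C]_(n, p)) :
  (A *m B)^t* = B^t* *m A^t*.
Proof. by rewrite trmx_mul map_mxM. Qed.

Lemma adjD m n (A B : 'M[C]_(m, n)) : (A + B)^t* = A^t* + B^t*.
Proof. by rewrite linearD /= map_mxD. Qed.

Lemma adjN m n (A : 'M[C]_(m, n)) : (- A)^t* = - A^t*.
Proof. by rewrite linearN /= map_mxN. Qed.

Lemma adjB m n (A B : 'M[C]_(m, n)) : (A - B)^t* = A^t* - B^t*.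
Proof. by rewrite adjD adjN. Qed.

Lemma adjZ m n c (A : 'M[C]_(m, n)) : (c *: A)^t* = c^* *: A^t*.
Proof. by rewrite linearZ /= map_mxZ. Qed.

Lemma adj1 n : (1%:M : 'M[C]_n)^t* = 1%:M.
Proof. by rewrite trmx1 map_mx1. Qed.

Lemma adj0 m n : (0 : 'M[C]_(m, n))^t* = 0.
Proof. by rewrite trmx0 map_mx0. Qed.

Lemma mxtrace_adj n (A : 'M[C]_n) : \tr (A^t*) = (\tr A)^*.
Proof. by rewrite /mxtrace rmorph_sum; apply: eq_bigr => i _; rewrite !mxE. Qed.

Definition hsn m n (M : 'M[C]_(m, n)) : C := \tr (M^t* *m M).

Lemma hsnE m n (M : 'M[C]_(m, n)) : hsn M = \sum_j \sum_i `|M i j| ^+ 2.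
Proof.
rewrite /hsn /mxtrace; apply: eq_bigr => j _; rewrite mxE; apply: eq_bigr => i _.
by rewrite !mxE mulrC normCK.
Qed.

Lemma hsn_ge0 m n (M : 'M[C]_(m, n)) : 0 <= hsn M.
Proof. by rewrite hsnE; do 2!apply: sumr_ge0 => ? _; rewrite exprn_ge0. Qed.

Lemma hsn_eq0 m n (M : 'M[C]_(m, n)) : (hsn M == 0) = (M == 0).
Proof.
apply/eqP/eqP => [|->]; last by rewrite /hsn mulmx0 mxtrace0.
rewrite hsnE => /eqP; rewrite psumr_eq0 => [|j _]; last first.
  by apply: sumr_ge0 => i _; rewrite exprn_ge0.
move=> /allP h; apply/matrixP => i j; rewrite mxE.
have := h j (mem_index_enum _); rewrite /= psumr_eq0 => [/allP|i' _]; last by rewrite exprn_ge0.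
by move=> /(_ i (mem_index_enum _)); rewrite /= expf_eq0 normr_eq0 => /eqP.
Qed.

Lemma hsn_adj m n (M : 'M[C]_(m, n)) : hsn (M^t*) = hsn M.
Proof. by rewrite /hsn trmxCK mxtrace_mulC. Qed.

Lemma hsnN m n (M : 'M[C]_(m, n)) : hsn (- M) = hsn M.
Proof. by rewrite /hsn adjN mulNmx mulmxN opprK. Qed.

Lemma hsn_sym m n (A B : 'M[C]_(m, n)) : hsn (A - B) = hsn (B - A).
Proof. by rewrite -hsnN opprB. Qed.

Lemma hsn_isol m n p (U : 'M[C]_(p, m)) (M : 'M[C]_(m, n)) :
  U^t* *m U = 1%:M -> hsn (U *m M) = hsn M.
Proof. by move=> hU; rewrite /hsn adjM mulmxA -(mulmxA _ _ U) hU mulmx1. Qed.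

Lemma hsn_isor m n p (U : 'M[C]_(n, p)) (M : 'M[C]_(m, n)) :
  U *m U^t* = 1%:M -> hsn (M *m U) = hsn M.
Proof. by move=> hU; rewrite -hsn_adj adjM hsn_isol ?hsn_adj // trmxCK. Qed.

Lemma hsn_parallelogram m n (A B : 'M[C]_(m, n)) :
  hsn (A + B) + hsn (A - B) = 2 * (hsn A + hsn B).
Proof.
rewrite /hsn adjB adjD !(mulmxDl, mulmxDr, mulmxN, mulNmx) !linearD /= !linearN /= opprK.
ring.
Qed.

Lemma hsnD_le m n (A B : 'M[C]_(m, n)) : hsn (A + B) <= 2 * (hsn A + hsn B).
Proof. by rewrite -hsn_parallelogram lerDl hsn_ge0. Qed.

Lemma hsn_tri m n (B A D : 'M[C]_(m, n)) :
  hsn (A - D) <= 2 * (hsn (A - B) + hsn (B - D)).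
Proof. by have := hsnD_le (A - B) (B - D); rewrite addrA subrK. Qed.

(** The exponential constant is harmless: the sums will run over a fixed finite group. *)
Lemma hsn_sum_le (I : Type) (r : seq I) m n (F : I -> 'M[C]_(m, n)) :
  hsn (\sum_(k <- r) F k) <= 2 ^+ size r * \sum_(k <- r) hsn (F k).
Proof.
elim: r => [|k r IH]; first by rewrite !big_nil mulr0 /hsn mulmx0 mxtrace0.
rewrite !big_cons; apply: le_trans (hsnD_le _ _) _.
rewrite exprS -mulrA ler_pM2l ?ltr0n // mulrDr; apply: lerD => //.
by rewrite -[leLHS]mul1r; apply: ler_wpM2r; [apply: hsn_ge0|apply: exprn_ege1; rewrite ler1n].
Qed.

Lemma hsnZ m n c (M : 'M[C]_(m, n)) : hsn (c *: M) = `|c| ^+ 2 * hsn M.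
Proof. by rewrite /hsn adjZ -scalemxAl -scalemxAr scalerA linearZ /= mulrC normCK mulrC (mulrC c). Qed.

Lemma hsn1 n : hsn (1%:M : 'M[C]_n) = n%:R.
Proof. by rewrite /hsn adj1 mulmx1 mxtrace1. Qed.

Lemma hsn_unitary n (U : 'M[C]_n) : U *m U^t* = 1%:M -> hsn U = n%:R.
Proof. by move=> hU; rewrite -(mul1mx U) hsn_isor // hsn1. Qed.

Lemma hsn_block m1 m2 n1 n2 (A : 'M[C]_(m1, n1)) B D (E : 'M[C]_(m2, n2)) :
  hsn (block_mx A B D E) = hsn A + hsn B + hsn D + hsn E.
Proof.
rewrite /hsn tr_block_mx map_block_mx mulmx_block mxtrace_block !linearD /=.
by rewrite !addrA; congr (_ + _); rewrite addrAC.
Qed.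

(* Weighted AM-GM replaces Cauchy-Schwarz, so that no square root is needed. *)
Lemma mxtrace_le n (s : C) (M : 'M[C]_n) : 0 < s ->
  2 * `|\tr M| <= s * n%:R + hsn M / s.
Proof.
move=> s0; apply: (@le_trans _ _ (\sum_j (s + `|M j j| ^+ 2 / s))).
  apply: le_trans (_ : 2 * \sum_j `|M j j| <= _).
    by apply: ler_wpM2l => //; apply: ler_norm_sum.
  rewrite mulr_sumr; apply: ler_sum => j _.
  rewrite -subr_ge0; have -> : s + `|M j j| ^+ 2 / s - 2 * `|M j j| = (s - `|M j j|) ^+ 2 / s.
    by field; rewrite gt_eqF.
  rewrite divr_ge0 ?(ltW s0) // real_exprn_even_ge0 // rpredB ?realE ?normr_ge0 ?(ltW s0) //.
rewrite big_split /= sumr_const card_ord mulr_natr lerD2l -mulr_suml.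
apply: ler_wpM2r; first by rewrite invr_ge0 ltW.
rewrite hsnE; apply: ler_sum => j _; rewrite (bigD1 j) //= lerDl.
by apply: sumr_ge0 => i _; rewrite exprn_ge0.
Qed.

Definition proj n (P : 'M[C]_n) := P^t* = P /\ P *m P = P.

Lemma proj1 n : proj (1%:M : 'M[C]_n).
Proof. by split; rewrite ?adj1 ?mulmx1. Qed.

Lemma projM n (P Q : 'M[C]_n) : proj P -> proj Q -> P *m Q = Q *m P -> proj (P *m Q).
Proof.
move=> [h1 h2] [h3 h4] PQ; split; first by rewrite adjM h1 h3.
by rewrite {2}PQ mulmxA -(mulmxA P) h4 -mulmxA -PQ mulmxA h2.
Qed.

Lemma projB n (P Q : 'M[C]_n) : proj P -> proj Q -> Q *m P = Q -> proj (P - Q).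
Proof.
move=> [h1 h2] [h3 h4] QP; have PQ : P *m Q = Q.
  by rewrite -h3 -[X in X *m _]h1 -adjM h3 QP.
split; first by rewrite adjB h1 h3.
by rewrite mulmxBl !mulmxBr h2 h4 QP PQ subrr subr0.
Qed.

Lemma hsn_proj n (P : 'M[C]_n) : proj P -> hsn P = \tr P.
Proof. by move=> [h1 h2]; rewrite /hsn h1 h2. Qed.

(** In a rank factorization [P = A *m B], idempotence cancels to [B *m A = 1]. *)
Lemma mxtrace_idem n (P : 'M[C]_n) : P *m P = P -> \tr P = (\rank P)%:R.
Proof.
move=> PP; have [A [B [fA fB AB]]] : exists (A : 'M[C]_(n, \rank P)) (B : 'M[C]_(\rank P, n)),
    [/\ row_full A, row_free B & A *m B = P].
  by exists (col_base P), (row_base P); rewrite col_base_full row_base_free mulmx_base.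
have E : B *m A = 1%:M.
  apply: (row_full_inj fA); apply: (row_free_inj fB) => /=.
  by rewrite mulmx1 !mulmxA AB -mulmxA AB PP.
by rewrite -{1}AB mxtrace_mulC E mxtrace1.
Qed.

Lemma proj_rank_eq0 n (P : 'M[C]_n) : proj P -> \tr P = 0 -> P = 0.
Proof. by move=> hP tP; apply/eqP; rewrite -hsn_eq0 hsn_proj // tP. Qed.

Lemma proj_full n (P : 'M[C]_n) : proj P -> \rank P = n -> P = 1%:M.
Proof.
move=> hP rP; apply/esym/eqP; rewrite -subr_eq0; apply/eqP.
apply: proj_rank_eq0; first by apply: projB; [exact: proj1|by []|rewrite mulmx1].
by case: hP => _ PP; rewrite linearB /= mxtrace1 mxtrace_idem // rP subrr.
Qed.

(** The rows of [U] are orthonormal bases of the row spaces of [P] and [1 - P]. The row count stays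
    in the form [\rank P + l], as block matrices require, and [e] records that it equals [n]. *)
Lemma proj_block n (P : 'M[C]_n) : proj P ->
  exists l (e : (\rank P + l = n)%N) (U : 'M[C]_(\rank P + l, n)),
    [/\ U *m U^t* = 1%:M, U^t* *m U = 1%:M & U *m P = block_mx 1%:M 0 0 0 *m U].
Proof.
move=> [h1 h2]; pose Q := 1%:M - P.
have hQ : proj Q by apply: projB; [exact: proj1|by []|rewrite mulmx1].
have e : (\rank P + \rank Q = n)%N.
  apply/eqP; rewrite -(eqr_nat C) natrD -!mxtrace_idem //; last by case: hQ.
  by rewrite linearB /= addrC subrK mxtrace1.
exists (\rank Q), e.
have onb (E : 'M[C]_n) : E *m E = E ->
    exists B : 'M[C]_(\rank E, n), B *m B^t* = 1%:M /\ B *m E = B.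
  move=> EE; exists (schmidt (row_base E)); split.
    by apply/unitarymxP/schmidt_unitarymx/rank_leq_row.
  have /submxP[D ->] : (schmidt (row_base E) <= E)%MS.
    by rewrite eqmx_schmidt_free ?row_base_free // eq_row_base.
  by rewrite -mulmxA EE.
have [B [B1 BP]] := onb P h2; have [B' [B'1 BQ]] := onb Q ltac:(by case: hQ).
have B'P : B' *m P = 0.
  by rewrite -BQ /Q -mulmxA mulmxBl mul1mx h2 subrr mulmx0.
have BB' : B *m B'^t* = 0.
  by rewrite -BP -mulmxA -[X in _ *m (X *m _)]h1 -adjM B'P adj0 mulmx0.
have B'B : B' *m B^t* = 0 by rewrite -[LHS]trmxCK adjM trmxCK BB' adj0.
have U1 : col_mx B B' *m (col_mx B B')^t* = 1%:M.
  rewrite tr_col_mx map_row_mx mul_col_row B1 B'1 BB' B'B.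
  by rewrite [RHS]scalar_mx_block.
exists (col_mx B B'); split => //; last first.
  by rewrite mul_col_mx BP B'P mul_block_col !mul0mx mul1mx !addr0.
move: U1; move: (col_mx B B'); move: (\rank P) (\rank Q) e; clear => a b e; case: n / e => U /mulmx1C; exact.
Qed.

End HilbertSchmidt.

(** * Polar decomposition and intertwiners *)

Section Intertwiners.
Variable C : numClosedFieldType.
Implicit Types m n p : nat.

Lemma gram_diag_ge0 m n (M : 'M[C]_(m, n)) i : 0 <= (M^t* *m M) i i.
Proof.
by rewrite mxE; apply: sumr_ge0 => k _; rewrite !mxE mulrC mul_conjC_ge0.
Qed.

Lemma normal_spectral n (A : 'M[C]_n) : A *m A^t* = A^t* *m A ->
  exists (V : 'M[C]_n) (d : 'rV[C]_n),
    [/\ V *m V^t* = 1%:M, V^t* *m V = 1%:M & A = V^t* *m diag_mx d *m V].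
Proof.
move=> /normalmxP/orthomx_spectralP E; exists (spectralmx A), (spectral_diag A).
have U := spectral_unitarymx A.
have h1 : spectralmx A *m (spectralmx A)^t* = 1%:M by apply/unitarymxP.
by split=> //; [apply: mulmx1C|rewrite -invmx_unitary].
Qed.

(** Polar decomposition of a possibly singular matrix: [B] is the square root of the Gram matrix and
    [S] a partial isometry. What commutes with the Gram matrix commutes with every function of it,
    so [S] inherits the intertwining relations of [X]. *)
Lemma polar n (X : 'M[C]_n) : exists (S V : 'M[C]_n) (s : 'rV[C]_n),
  let B := V^t* *m diag_mx s *m V in
  [/\ V *m V^t* = 1%:M /\ V^t* *m V = 1%:M, forall i, 0 <= s 0 i,
      B *m B = X^t* *m X, S^t* *m X = B /\ S *m B = X &
      S *m (S^t* *m S) = S /\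
      forall M M', M' *m X = X *m M -> M *m (X^t* *m X) = X^t* *m X *m M ->
        M' *m S = S *m M].
Proof.
have [|V [d [V1 V2 XX]]] := @normal_spectral n (X^t* *m X).
  by rewrite adjM trmxCK.
have cV m (Y : 'M[C]_(n, m)) : V *m (V^t* *m Y) = Y by rewrite mulmxA V1 mul1mx.
have d0 i : 0 <= d 0 i.
  have := gram_diag_ge0 (X *m V^t*) i.
  rewrite adjM trmxCK mulmxA -(mulmxA V) XX !mulmxA V1 mul1mx -mulmxA V1 mulmx1.
  by rewrite mxE eqxx mulr1n.
(* Since [0^-1 = 0], [r] is the spectrum of the pseudo-inverse [Bp] of [B]. *)
pose s : 'rV[C]_n := \row_i sqrtC (d 0 i); pose r : 'rV[C]_n := \row_i (s 0 i)^-1.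
pose B := V^t* *m diag_mx s *m V; pose Bp := V^t* *m diag_mx r *m V.
have mulV (a b : 'rV[C]_n) : (V^t* *m diag_mx a *m V) *m (V^t* *m diag_mx b *m V) =
    V^t* *m diag_mx (\row_i (a 0 i * b 0 i)) *m V.
  by rewrite -!mulmxA cV (mulmxA (diag_mx a)) mulmx_diag.
have BB : B *m B = X^t* *m X.
  rewrite mulV XX; congr (_ *m diag_mx _ *m _); apply/rowP => i.
  by rewrite !mxE -expr2 sqrtCK.
have adjV (a : 'rV[C]_n) : (forall i, 0 <= a 0 i) -> (V^t* *m diag_mx a *m V)^t* = V^t* *m diag_mx a *m V.
  move=> a0; rewrite !adjM trmxCK !mulmxA; congr (_ *m _ *m _).
  rewrite tr_diag_mx map_diag_mx; congr diag_mx; apply/rowP => i; rewrite !mxE.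
  by apply/CrealP; rewrite realE a0.
have s0 i : 0 <= s 0 i by rewrite mxE sqrtC_ge0.
have r0 i : 0 <= r 0 i by rewrite mxE invr_ge0.
have BpBp : Bp^t* = Bp by apply: adjV.
pose q : 'rV[C]_n := \row_i (s 0 i != 0)%:R.
pose Q := V^t* *m diag_mx q *m V.
have rs i : r 0 i * s 0 i = q 0 i.
  rewrite [r 0 i]mxE [q 0 i]mxE; case: (eqVneq (s 0 i) 0) => [->|si]; first by rewrite mulr0.
  by rewrite mulVf.
have BpB : Bp *m B = Q.
  by rewrite mulV; congr (_ *m diag_mx _ *m _); apply/rowP => i; rewrite mxE rs.
have BBp : B *m Bp = Q.
  by rewrite mulV; congr (_ *m diag_mx _ *m _); apply/rowP => i; rewrite mxE mulrC rs.
have qs i : q 0 i * s 0 i = s 0 i.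
  by rewrite [q 0 i]mxE; case: (eqVneq (s 0 i) 0) => [->|si]; rewrite ?mulr0 ?mul1r.
have QB : Q *m B = B.
  by rewrite mulV; congr (_ *m diag_mx _ *m _); apply/rowP => i; rewrite mxE qs.
have BQ : B *m Q = B.
  by rewrite mulV; congr (_ *m diag_mx _ *m _); apply/rowP => i; rewrite mxE mulrC qs.
have BpQ : Bp *m Q = Bp.
  rewrite mulV; congr (_ *m diag_mx _ *m _); apply/rowP => i; rewrite mxE.
  by rewrite [q 0 i]mxE [r 0 i]mxE; case: (eqVneq (s 0 i) 0) => [->|si]; rewrite ?invr0 ?mul0r ?mulr1.
have XQ : X *m Q = X.
  apply/eqP; rewrite -subr_eq0 -hsn_eq0 /hsn adjB adjM.
  have -> : Q^t* = Q by apply: adjV => i; rewrite mxE ler0n.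
  have QG : Q *m (X^t* *m X) = X^t* *m X by rewrite -BB mulmxA QB.
  have GQ : X^t* *m X *m Q = X^t* *m X by rewrite -BB -mulmxA BQ.
  rewrite mulmxBl !mulmxBr -!(mulmxA Q) (mulmxA (X^t*)) GQ.
  by rewrite !QG !subrr mxtrace0.
have BpG : Bp *m (X^t* *m X) = B by rewrite -BB mulmxA BpB QB.
exists (X *m Bp), V, s; rewrite /= -/B; split=> //.
- split; last by rewrite -mulmxA BpB.
  by rewrite adjM BpBp -mulmxA BpG.
- have -> : (X *m Bp)^t* *m (X *m Bp) = Q.
    by rewrite adjM BpBp mulmxA -(mulmxA Bp) BpG BBp.
  split; first by rewrite -mulmxA BpQ.
  move=> M M' MX MXX; rewrite mulmxA MX -!mulmxA; congr (_ *m _).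
  pose M1 := V *m M *m V^t*.
  have ME : M = V^t* *m M1 *m V by rewrite /M1 !mulmxA V2 mul1mx -mulmxA V2 mulmx1.
  have M1d : M1 *m diag_mx d = diag_mx d *m M1.
    have VV m (Y : 'M[C]_(n, m)) : V^t* *m (V *m Y) = Y by rewrite mulmxA V2 mul1mx.
    rewrite /M1; move: (X^t* *m X) XX MXX => G XX MXX.
    have -> : diag_mx d = V *m G *m V^t* by rewrite XX !mulmxA V1 mul1mx -mulmxA V1 mulmx1.
    by rewrite -!mulmxA !VV (mulmxA M) MXX -mulmxA.
  (* A nonzero entry [M1 i j] forces [d 0 i = d 0 j], hence equal values of any function of [d]. *)
  have M1r : M1 *m diag_mx r = diag_mx r *m M1.
    apply/matrixP => i j; have := congr1 (fun Z : 'M[C]_n => Z i j) M1d.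
    rewrite !mul_mx_diag !mul_diag_mx [LHS]mxE [RHS]mxE => E; rewrite [LHS]mxE [RHS]mxE.
    have [->|nz] := eqVneq (M1 i j) 0; first by rewrite mulr0 mul0r.
    rewrite mulrC; congr (_ * _); rewrite [LHS]mxE [RHS]mxE [s 0 _]mxE [s 0 i]mxE.
    by congr (sqrtC _)^-1; apply: (mulfI nz); rewrite E mulrC.
  clearbody M1; rewrite ME /Bp -!mulmxA !cV; congr (_ *m _).
  by rewrite mulmxA M1r mulmxA.
Qed.

Definition urep (H : groupType) n (a : H -> 'M[C]_n) :=
  {morph a : x y / (x * y)%g >-> x *m y} /\ forall x, a x *m (a x)^t* = 1%:M.

Lemma urep_adj (H : groupType) n (a : H -> 'M[C]_n) :
  urep a -> forall x, (a x)^t* *m a x = 1%:M.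
Proof. by move=> [_ h] x; apply/mulmx1C/h. Qed.

Lemma urep1 (H : groupType) n (a : H -> 'M[C]_n) : urep a -> a 1%g = 1%:M.
Proof.
move=> ua; have [aM a1] := ua.
by rewrite -[LHS]mulmx1 -(a1 1%g) mulmxA -aM mulg1.
Qed.

Lemma urepV (H : groupType) n (a : H -> 'M[C]_n) : urep a -> forall x, a x^-1%g = (a x)^t*.
Proof.
move=> ua x; have [aM a1] := ua.
by rewrite -[LHS]mulmx1 -(a1 x) mulmxA -aM mulVg (urep1 ua) mul1mx.
Qed.

(** For unitary [M] and [M'], the adjoint of [X] intertwines in the opposite direction; the Gram
    matrix composes the two. *)
Lemma commute_gram n (X M M' : 'M[C]_n) : M *m M^t* = 1%:M -> M' *m M'^t* = 1%:M ->
  M' *m X = X *m M -> M *m (X^t* *m X) = X^t* *m X *m M.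
Proof.
move=> M1 M'1 E; have E' : M *m X^t* = X^t* *m M'.
  rewrite -[X^t* *m M']mul1mx -M1 -mulmxA; congr (_ *m _).
  by rewrite mulmxA -adjM -E adjM -mulmxA (mulmx1C M'1) mulmx1.
by rewrite mulmxA E' -mulmxA E mulmxA.
Qed.

Lemma proj_pisom n (S : 'M[C]_n) : S *m (S^t* *m S) = S ->
  proj (S^t* *m S) /\ proj (S *m S^t*).
Proof.
move=> SS; split; split; rewrite ?adjM ?trmxCK //.
  by rewrite -mulmxA SS.
by rewrite !mulmxA -(mulmxA S) SS.
Qed.

(** Summed over all [i] and [j], these entries give the product of the traces of [A] and [D], as in
    the Schur orthogonality relations. *)
Lemma mul_delta_entry n (A D : 'M[C]_n) i j :
  (A *m delta_mx i j *m D) i j = A i i * D j j.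
Proof.
have Ad k : (A *m delta_mx i j) i k = A i i * (k == j)%:R.
  rewrite mxE (bigD1 i) //= big1 ?addr0 => [|l li]; first by rewrite !mxE eqxx.
  by rewrite !mxE (negbTE li) mulr0.
rewrite mxE (bigD1 j) //= Ad eqxx mulr1 big1 ?addr0 // => k kj.
by rewrite Ad (negbTE kj) mulr0 mul0r.
Qed.

Lemma pisom_proj n (S : 'M[C]_n) : proj (S^t* *m S) -> S *m (S^t* *m S) = S.
Proof.
move=> [h1 h2]; apply/eqP; rewrite -subr_eq0 -hsn_eq0 /hsn adjB adjM h1.
set G := S^t* *m S in h1 h2 *.
by rewrite mulmxBr !mulmxBl -!(mulmxA G) !(mulmxA (S^t*)) -/G !h2 !subrr mxtrace0.
Qed.

(* Orthogonal projections cutting out subrepresentations with equal characters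
   are exchanged by a partial isometry that intertwines the actions. *)
Lemma equal_character_intertwiner (H : finGroupType) n (a b : H -> 'M[C]_n) (E E' : 'M[C]_n) :
  urep a -> urep b -> proj E -> proj E' ->
  (forall h, E *m b h = b h *m E) -> (forall h, E' *m a h = a h *m E') ->
  (forall h, \tr (a h *m E') = \tr (b h *m E)) ->
  exists2 S : 'M[C]_n, S^t* *m S = E /\ S *m S^t* = E' &
    forall h, a h *m S = S *m b h.
Proof.
move=> ua ub; have [r] := ubnP (\rank E); elim: r E E' => // r IH E E' rE pE pE' bE aE' tE.
have tE1 : \tr E' = \tr E by have := tE 1%g; rewrite (urep1 ua) (urep1 ub) !mul1mx.
case: (eqVneq E 0) => [E0|En0].
  have E'0 : E' = 0 by apply: proj_rank_eq0 => //; rewrite tE1 E0 mxtrace0.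
  by exists 0; [rewrite E0 E'0 !adj0 mulmx0|move=> h; rewrite mulmx0 mul0mx].
pose avg Y := \sum_h a h *m (E' *m Y *m E) *m (b h)^t*.
have [Y XY] : exists Y, avg Y != 0.
  have [/existsP[i /existsP[j nz]]|nY] := boolP [exists i, [exists j, avg (delta_mx i j) != 0]].
    by exists (delta_mx i j).
  (* If all matrix units had average 0, then so would the sum over [h] of the squared moduli of
     [\tr (b h *m E)]; but its term at the identity is the squared rank of [E]. *)
  exfalso; have Y0 i j : avg (delta_mx i j) = 0.
    by apply/eqP; move: nY => /existsPn/(_ i)/existsPn/(_ j)/negPn.
  have : \sum_i \sum_j (avg (delta_mx i j)) i j = 0.
    by apply: big1 => i _; apply: big1 => j _; rewrite Y0 mxE.
  have -> : \sum_i \sum_j (avg (delta_mx i j)) i j = \sum_h `|\tr (b h *m E)| ^+ 2.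
    under eq_bigr do under eq_bigr do rewrite summxE.
    under eq_bigr do rewrite exchange_big /=.
    rewrite exchange_big /=; apply: eq_bigr => h _.
    have -> : `|\tr (b h *m E)| ^+ 2 = \tr (a h *m E') * \tr (E *m (b h)^t*).
      rewrite tE normCK; congr (_ * _); rewrite -mxtrace_adj adjM.
      by case: pE => ->.
    rewrite {1 2}/mxtrace mulr_suml; apply: eq_bigr => i _.
    rewrite mulr_sumr; apply: eq_bigr => j _.
    by rewrite -mul_delta_entry !mulmxA.
  move/eqP; rewrite psumr_eq0 => [/allP/(_ 1%g (mem_index_enum _))|h _]; last by rewrite exprn_ge0.
  rewrite /= (urep1 ub) mul1mx expf_eq0 normr_eq0 /= => /eqP t0.
  by move/eqP: En0; apply; apply: proj_rank_eq0.
set X := avg Y in XY.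
have aX h : a h *m X = X *m b h.
  rewrite /X /avg mulmx_sumr mulmx_suml (reindex_inj (mulgI h^-1%g)) /=.
  apply: eq_bigr => k _; have [aM _] := ua; have [bM _] := ub.
  rewrite !mulmxA -aM mulgA mulgV mul1g.
  by rewrite bM adjM (urepV ub) trmxCK !mulmxA.
have EX : E' *m X = X.
  rewrite mulmx_sumr; apply: eq_bigr => h _.
  by rewrite !mulmxA aE' -(mulmxA (a h)); case: pE' => _ ->.
have XE : X *m E = X.
  rewrite mulmx_suml; apply: eq_bigr => h _; rewrite -!mulmxA.
  have -> : (b h)^t* *m E = E *m (b h)^t*.
    by have [E1 _] := pE; rewrite -{1}E1 -adjM bE adjM E1.
  by rewrite (mulmxA E E); case: pE => _ ->.
(* The partial isometry [S] intertwines as well. Its initial and final projections have equal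
   characters, so the complements [E - Q] and [E' - Q'] still match, in smaller rank. *)
have [S [V [s [_ _ _ [SX SB] [SQ Scom]]]]] := polar X.
have aS h : a h *m S = S *m b h.
  apply: Scom => //; apply: commute_gram (aX h); first by case: ub.
  by case: ua.
have [pQ pQ'] := proj_pisom SQ; set Q := S^t* *m S in SQ pQ; set Q' := S *m S^t* in pQ'.
have SE : S *m E = S.
  rewrite -[RHS]mul1mx; apply/esym/Scom; first by rewrite mul1mx XE.
  have EX' : E *m X^t* = X^t* by have [E1 _] := pE; rewrite -[X in X *m _]E1 -adjM XE.
  by rewrite -mulmxA XE mulmxA EX'.
have E'S : E' *m S = S.
  by rewrite -[RHS]mulmx1; apply: Scom; rewrite ?mulmx1 ?mul1mx.
have QE : Q *m E = Q by rewrite /Q -mulmxA SE.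
have Q'E' : Q' *m E' = Q'.
  by have [E1 _] := pE'; rewrite /Q' -mulmxA -[X in _ *m (_ *m X)]E1 -adjM E'S.
have EQ : E *m Q = Q.
  by have [E1 _] := pE; have [Q1 _] := pQ; rewrite -[LHS]trmxCK adjM E1 Q1 QE Q1.
have Q0 : Q != 0.
  by apply: contraNneq XY => Q0; rewrite -SB -SQ Q0 mulmx0 mul0mx.
have pE1 : proj (E - Q) by apply: projB.
have pE1' : proj (E' - Q') by apply: projB.
have Qb h : Q *m b h = b h *m Q.
  apply/esym; rewrite /Q; apply: commute_gram (aS h); first by case: ub.
  by case: ua.
have S'a h : S^t* *m a h = b h *m S^t*.
  rewrite -[LHS]trmxCK adjM trmxCK -(urepV ua) aS adjM (urepV ub) trmxCK //.
have Q'a h : Q' *m a h = a h *m Q'.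
  by rewrite /Q' -mulmxA S'a !mulmxA aS.
have [|||h|R [R1 R2] aR] := IH (E - Q) (E' - Q') _ pE1 pE1'.
- move: rE; rewrite ltnS; apply: leq_trans; rewrite -(ltr_nat C).
  rewrite -!mxtrace_idem; [|by case: pE|by case: pE1].
  rewrite linearB /= ltrBlDr ltrDl lt_def -hsn_proj // hsn_ge0 hsn_eq0 //.
  by rewrite Q0.
- by move=> h; rewrite mulmxBl mulmxBr bE Qb.
- by move=> h; rewrite mulmxBl mulmxBr aE' Q'a.
- rewrite !mulmxBr !linearB /= tE; congr (_ - _).
  by rewrite /Q' mulmxA mxtrace_mulC mulmxA S'a -mulmxA.
have SR : S^t* *m R = 0.
  have -> : S^t* = S^t* *m Q' by rewrite -{1}SQ adjM; case: pQ => -> _; rewrite /Q -mulmxA.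
  have -> : R = (E' - Q') *m R.
    by rewrite -R2 -mulmxA pisom_proj // R1.
  rewrite mulmxA -(mulmxA _ Q') mulmxBr Q'E'.
  by case: pQ' => _ ->; rewrite subrr mulmx0 mul0mx.
have RS : R^t* *m S = 0 by rewrite -[LHS]trmxCK adjM trmxCK SR adj0.
have RS' : R *m S^t* = 0.
  have -> : S^t* = Q *m S^t* by have [Q1 _] := pQ; rewrite -[in RHS]Q1 -adjM SQ.
  have RE : R *m (E - Q) = R by rewrite -R1 pisom_proj // R1.
  rewrite -RE -(mulmxA R) (mulmxA (E - Q)) mulmxBl EQ.
  by case: pQ => _ ->; rewrite subrr mul0mx mulmx0.
have SR' : S *m R^t* = 0 by rewrite -[LHS]trmxCK adjM trmxCK RS' adj0.
exists (S + R); last by move=> h; rewrite mulmxDr mulmxDl aS aR.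
rewrite !adjD !mulmxDl !mulmxDr SR RS RS' SR' R1 R2 !addr0 !add0r.
by rewrite -/Q -/Q' addrC subrK addrC subrK.
Qed.

End Intertwiners.

(** * Correcting almost intertwiners and corners of unitaries *)

Section Correction.
Variable C : numClosedFieldType.
Implicit Types m n p : nat.

(** The partial isometry is completed to a unitary by an intertwiner between the complements of its
    supports. These have equal characters because the whole spaces and the supports do. *)
Lemma polar_unitary (H : finGroupType) n (a b : H -> 'M[C]_n) (X : 'M[C]_n) :
  urep a -> urep b -> (forall h, \tr (a h) = \tr (b h)) ->
  (forall h, a h *m X = X *m b h) ->
  exists (U V : 'M[C]_n) (s : 'rV[C]_n),
  let B := V^t* *m diag_mx s *m V in
  [/\ U *m U^t* = 1%:M, forall h, a h *m U = U *m b h,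
      V *m V^t* = 1%:M /\ V^t* *m V = 1%:M, forall i, 0 <= s 0 i &
      U^t* *m X = B /\ B *m B = X^t* *m X].
Proof.
move=> ua ub tab aX; have [S [V [s [hV s0 BB [SX SB] [SQ Scom]]]]] := polar X.
have [a1 b1] : (forall h, a h *m (a h)^t* = 1%:M) /\ (forall h, b h *m (b h)^t* = 1%:M).
  by case: ua; case: ub.
have aS h : a h *m S = S *m b h by apply: Scom => //; apply: commute_gram (aX h).
have [pQ pQ'] := proj_pisom SQ; set Q := S^t* *m S in SQ pQ; set Q' := S *m S^t* in pQ'.
have Qb h : Q *m b h = b h *m Q by apply/esym; rewrite /Q; apply: commute_gram (aS h).
have S'a h : S^t* *m a h = b h *m S^t*.
  by rewrite -[LHS]trmxCK adjM trmxCK -(urepV ua) aS adjM (urepV ub) trmxCK.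
have Q'a h : Q' *m a h = a h *m Q' by rewrite /Q' -mulmxA S'a !mulmxA aS.
have [||h|h|h|R [R1 R2] aR] := @equal_character_intertwiner C H n a b (1%:M - Q) (1%:M - Q') ua ub.
- by apply: projB => //; [exact: proj1|rewrite mulmx1].
- by apply: projB => //; [exact: proj1|rewrite mulmx1].
- by rewrite mulmxBl mulmxBr Qb mulmx1 mul1mx.
- by rewrite mulmxBl mulmxBr Q'a mulmx1 mul1mx.
- rewrite !mulmxBr !linearB /= !mulmx1 tab; congr (_ - _).
  by rewrite /Q' mulmxA mxtrace_mulC mulmxA S'a -mulmxA.
have pE : proj (1%:M - Q) by apply: projB => //; [exact: proj1|rewrite mulmx1].
have SR : S^t* *m R = 0.
  have -> : S^t* = S^t* *m Q' by rewrite -{1}SQ adjM; case: pQ => -> _; rewrite /Q -mulmxA.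
  have -> : R = (1%:M - Q') *m R by rewrite -R2 -mulmxA pisom_proj ?R1.
  rewrite mulmxA -(mulmxA _ Q') mulmxBr mulmx1.
  by case: pQ' => _ ->; rewrite subrr mulmx0 mul0mx.
have RS : R^t* *m S = 0 by rewrite -[LHS]trmxCK adjM trmxCK SR adj0.
exists (S + R), V, s; rewrite /=; split=> //.
- apply: mulmx1C; rewrite !adjD !mulmxDl !mulmxDr SR RS R1 !addr0 !add0r.
  by rewrite -/Q addrC subrK.
- by move=> h; rewrite mulmxDr mulmxDl aS aR.
- by split=> //; rewrite adjD mulmxDl SX -[X in _ + _ *m X]SB mulmxA RS mul0mx addr0.
Qed.

Lemma hsn_unitary_diag n (V : 'M[C]_n) (d : 'rV[C]_n) :
  V *m V^t* = 1%:M -> V^t* *m V = 1%:M ->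
  hsn (V^t* *m diag_mx d *m V) = \sum_i `|d 0 i| ^+ 2.
Proof.
move=> V1 V2; rewrite hsn_isor // hsn_isol ?trmxCK // hsnE; apply: eq_bigr => i _.
rewrite (bigD1 i) //= big1 ?addr0 => [|j ji]; first by rewrite mxE eqxx mulr1n.
by rewrite mxE (negbTE ji) mulr0n normr0 expr0n.
Qed.

Lemma unitary_diagB n (V : 'M[C]_n) (d : 'rV[C]_n) : V^t* *m V = 1%:M ->
  1%:M - V^t* *m diag_mx d *m V = V^t* *m diag_mx (\row_i (1 - d 0 i)) *m V.
Proof.
move=> V2; rewrite -[in LHS]V2 -{1}(mulmx1 (V^t*)) -mulmxBl -mulmxBr.
congr (_ *m _ *m _); apply/matrixP => i j; rewrite !mxE.
by case: eqP; rewrite ?mulr1n ?mulr0n ?subrr.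
Qed.

Lemma unitary_diagM n (V : 'M[C]_n) (a b : 'rV[C]_n) : V *m V^t* = 1%:M ->
  (V^t* *m diag_mx a *m V) *m (V^t* *m diag_mx b *m V) =
    V^t* *m diag_mx (\row_i (a 0 i * b 0 i)) *m V.
Proof.
move=> V1; rewrite -!mulmxA (mulmxA V) V1 mul1mx (mulmxA (diag_mx a)) mulmx_diag //.
Qed.

Lemma hsn_mul_avg (I : finType) n (M : 'M[C]_n) (u : I -> 'M[C]_n) :
  (forall i, u i *m (u i)^t* = 1%:M) ->
  hsn (M *m (#|I|%:R^-1 *: \sum_i u i)) <= 2 ^+ #|I| * hsn M.
Proof.
move=> u1; rewrite -scalemxAr hsnZ mulmx_sumr.
case: (posnP #|I|) => [I0|I0].
  by rewrite I0 invr0 normr0 expr0n mul0r expr0 mul1r hsn_ge0.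
have h := hsn_sum_le (index_enum I) (fun i => M *m u i).
apply: le_trans (ler_wpM2l _ h) _; first by rewrite exprn_ge0.
have -> : size (index_enum I) = #|I| by rewrite cardT enumT.
under eq_bigr do rewrite hsn_isor //.
have -> : \sum_(i : I) hsn M = hsn M * #|I|%:R by rewrite sumr_const mulr_natr.
rewrite ger0_norm ?invr_ge0 ?ler0n // mulrCA.
rewrite ler_wpM2l ?exprn_ge0 //.
have In0 : #|I|%:R != 0 :> C by rewrite pnatr_eq0 -lt0n.
have -> : #|I|%:R^-1 ^+ 2 * (hsn M * #|I|%:R) = #|I|%:R^-1 * hsn M :> C by field.
by rewrite ler_piMl ?hsn_ge0 // invf_le1 ?ltr0n // ler1n.
Qed.

(** Averaging [t] over [H] gives an exact intertwiner [T] near [t]; its unitary polar factor is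
    [U]. *)
Lemma near_intertwiner (H : finGroupType) n (a b : H -> 'M[C]_n) (t : 'M[C]_n) (d : C) :
  urep a -> urep b -> (forall h, \tr (a h) = \tr (b h)) ->
  t *m t^t* = 1%:M -> (forall h, hsn (t *m b h - a h *m t) <= d) ->
  let c := 2 ^+ #|H| in
  exists U : 'M[C]_n, [/\ U *m U^t* = 1%:M, forall h, a h *m U = U *m b h &
    hsn (t - U) <= 2 * (1 + 2 * (1 + c)) * c * d].
Proof.
move=> ua ub tab t1 near c.
have [a1 b1] : (forall h, a h *m (a h)^t* = 1%:M) /\ (forall h, b h *m (b h)^t* = 1%:M).
  by case: ua; case: ub.
have H0 : (0 < #|H|)%N by apply/card_gt0P; exists 1%g.
have Hn0 : #|H|%:R != 0 :> C by rewrite pnatr_eq0 -lt0n.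
pose u h := a h *m t *m (b h)^t*.
have u1 h : u h *m (u h)^t* = 1%:M.
  rewrite /u !adjM trmxCK !mulmxA -(mulmxA _ _ (b h)) urep_adj // mulmx1.
  by rewrite -(mulmxA _ t) t1 mulmx1 a1.
pose T := #|H|%:R^-1 *: \sum_h u h.
have aT h : a h *m T = T *m b h.
  rewrite /T -scalemxAr -scalemxAl mulmx_sumr mulmx_suml; congr (_ *: _).
  rewrite (reindex_inj (mulgI h^-1%g)) /=; apply: eq_bigr => k _.
  have [aM _] := ua; have [bM _] := ub.
  by rewrite /u !mulmxA -aM mulgA mulgV mul1g bM adjM (urepV ub) trmxCK !mulmxA.
have [U [V [s [U1 aU [V1 V2] s0 [UT BB]]]]] := polar_unitary ua ub tab aT.
exists U; split=> //.
have tT : hsn (t - T) <= c * d.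
  have -> : t - T = #|H|%:R^-1 *: \sum_h (t - u h).
    rewrite sumrB sumr_const scalerBr -[t *+ _]scaler_nat scalerA mulVf // scale1r //.
  rewrite hsnZ; apply: le_trans (ler_wpM2l _ (hsn_sum_le _ _)) _; first by rewrite exprn_ge0.
  have -> : size (index_enum H) = #|H| by rewrite cardT enumT.
  apply: le_trans (ler_wpM2l _ (ler_wpM2l _ (_ : _ <= #|H|%:R * d))) _; rewrite ?exprn_ge0 //.
    rewrite mulr_natl -sumr_const; apply: ler_sum => h _.
    apply: le_trans (near h).
    by rewrite -[leLHS](@hsn_isor _ _ _ _ (b h)) // mulmxBl -(mulmxA _ _ (b h)) urep_adj // mulmx1.
  rewrite mulrCA ler_wpM2l ?exprn_ge0 // ger0_norm ?invr_ge0 ?ler0n //.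
  have d0 : 0 <= d by apply: le_trans (hsn_ge0 _) (near 1%g).
  rewrite mulrA ler_piMl // expr2 -mulrA mulVf // mulr1.
  by rewrite invf_le1 ?ltr0n // ler1n.
have t2 : t^t* *m t = 1%:M by apply: mulmx1C.
(* The singular values satisfy [|1 - s| <= |1 - s ^ 2|], so the distance to [U] is bounded by the
   failure of [T] to be an isometry, and [T] is near the unitary [t]. *)
have TU : hsn (T - U) <= 2 * (1 + c) * hsn (t - T).
  have -> : hsn (T - U) = hsn (1%:M - V^t* *m diag_mx s *m V).
    rewrite -UT -(mulmx1C U1) -mulmxBr hsn_isol ?trmxCK // hsn_sym //.
  apply: le_trans (_ : hsn (1%:M - T^t* *m T) <= _).
    rewrite -BB unitary_diagM // !unitary_diagB // !hsn_unitary_diag //.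
    apply: ler_sum => i _; rewrite !mxE.
    have -> : 1 - s 0 i * s 0 i = (1 - s 0 i) * (1 + s 0 i) by ring.
    rewrite normrM exprMn ler_peMr ?exprn_ge0 // exprn_ege1 //.
    by rewrite ger0_norm ?addr_ge0 // lerDl.
  have -> : 1%:M - T^t* *m T = t^t* *m (t - T) + (t - T)^t* *m T.
    by rewrite adjB mulmxBr mulmxBl t2 addrA subrK.
  apply: le_trans (hsnD_le _ _) _; rewrite -mulrA ler_wpM2l // mulrDl mul1r.
  rewrite hsn_isol ?trmxCK // lerD2l; apply: le_trans (hsn_mul_avg _ u1) _.
  by rewrite hsn_adj.
apply: le_trans (hsn_tri T _ _) _.
have c0 : 0 <= c by rewrite exprn_ge0.
have h : hsn (T - U) <= 2 * (1 + c) * (c * d).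
  by apply: le_trans TU (ler_wpM2l _ tT); rewrite mulr_ge0 // addr_ge0.
apply: le_trans (ler_wpM2l _ (lerD tT h)) _ => //.
by rewrite le_eqVlt; apply/orP; left; apply/eqP; ring.
Qed.

(** [b] is the unitary polar factor of the corner [A], whose singular values lie between 0 and 1.
    There [(1 - s) ^ 2 <= 1 - s ^ 2], and the right-hand sides add up to the norm of the block [D]
    below [A], at most [l]. *)
Lemma corner_unitary m l (a : 'M[C]_(m + l)) : a *m a^t* = 1%:M ->
  exists2 b : 'M[C]_m, b *m b^t* = 1%:M & hsn (a - block_mx b 0 0 1%:M) <= 8 * l%:R.
Proof.
move=> a1; have a2 := mulmx1C a1.
pose A := ulsubmx a; pose B := ursubmx a; pose D := dlsubmx a; pose E := drsubmx a.
have aE : a = block_mx A B D E by rewrite submxK.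
(* Over the trivial group ['S_0] every matrix is an intertwiner, so [polar_unitary] applies to any
   [A]. *)
have u1 : urep (fun _ : 'S_0 => 1%:M : 'M[C]_m).
  by split=> [x y|x] /=; rewrite ?adj1 mulmx1.
have [|h|b [V [s [b1 _ [V1 V2] s0 [bA BB]]]]] := @polar_unitary 'S_0 m _ _ A u1 u1.
- by [].
- by rewrite mulmx1 mul1mx.
exists b => //.
move: a1 a2; rewrite aE tr_block_mx map_block_mx !mulmx_block !scalar_mx_block.
move=> /eq_block_mx[_ _ _ r2] /eq_block_mx[c1 _ _ c2].
have nR : hsn D + hsn E = l%:R.
  by rewrite -(hsn1 C l) -hsn_adj -(hsn_adj E) /hsn !trmxCK -linearD /= r2 adj1 mulmx1.
have nC : hsn B + hsn E = l%:R.
  by rewrite -(hsn1 C l) /hsn -linearD /= c2 adj1 mulmx1.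
have nA : hsn (A - b) <= hsn D.
  have -> : hsn (A - b) = hsn (1%:M - V^t* *m diag_mx s *m V).
    by rewrite -bA -(mulmx1C b1) -mulmxBr hsn_isol ?trmxCK // hsn_sym.
  rewrite unitary_diagB // hsn_unitary_diag //.
  have AA : A^t* *m A = V^t* *m diag_mx (\row_i (s 0 i * s 0 i)) *m V.
    by rewrite -BB unitary_diagM.
  have DD : D^t* *m D = V^t* *m diag_mx (\row_i (1 - s 0 i * s 0 i)) *m V.
    rewrite -(addKr (A^t* *m A) (D^t* *m D)) c1 addrC AA unitary_diagB //.
    by congr (_ *m diag_mx _ *m _); apply/rowP => i; rewrite !mxE.
  have s1 i : 0 <= 1 - s 0 i * s 0 i.
    have := gram_diag_ge0 (D *m V^t*) i.
    rewrite adjM trmxCK mulmxA -(mulmxA V) DD !mulmxA V1 mul1mx -mulmxA V1 mulmx1.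
    by rewrite !mxE eqxx mulr1n.
  rewrite {1}/hsn DD mxtrace_mulC mulmxA V1 mul1mx mxtrace_diag.
  apply: ler_sum => i _; rewrite !mxE.
  have s1' : 0 <= 1 - s 0 i.
    have : 0 <= (1 - s 0 i) * (1 + s 0 i) by have := s1 i; congr (0 <= _); ring.
    by rewrite pmulr_lge0 // ltr_pwDl.
  rewrite ger0_norm // -subr_ge0.
  have -> : 1 - s 0 i * s 0 i - (1 - s 0 i) ^+ 2 = 2 * (s 0 i * (1 - s 0 i)) by ring.
  by rewrite !mulr_ge0.
rewrite -[block_mx b _ _ _]opprK opp_block_mx opprK add_block_mx !subr0 ?oppr0 ?addr0 hsn_block.
have nE : hsn (E - 1%:M) <= 2 * (hsn E + l%:R).
  by have := hsnD_le E (- 1%:M); rewrite hsnN hsn1.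
have := hsn_ge0 D; have := hsn_ge0 B; have := hsn_ge0 E.
have El : hsn D <= l%:R by rewrite -nR lerDl hsn_ge0.
have : hsn E <= l%:R by rewrite -nR lerDr hsn_ge0.
have : hsn B <= l%:R by rewrite -nC lerDl hsn_ge0.
move=> hB hE _ _ _.
apply: le_trans (lerD (lerD (lerD nA hB) El) nE) _.
apply: le_trans (lerD (lerD (lerD El (lexx _)) (lexx _)) (ler_wpM2l _ (lerD hE (lexx _)))) _ => //.
rewrite -subr_ge0; have -> : 8 * l%:R - (l%:R + l%:R + l%:R + 2 * (l%:R + l%:R)) = l%:R :> C by ring.
by rewrite ler0n.
Qed.

End Correction.

(** * Spectral projections by interpolation *)

Section Lagrange.
Variables (C : numClosedFieldType) (n : nat).

Lemma prod_unitary_diag (I : Type) (r : seq I) (Q : pred I) (V : 'M[C]_n) (d : I -> 'rV[C]_n) :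
  V *m V^t* = 1%:M -> V^t* *m V = 1%:M ->
  \prod_(z <- r | Q z) (V^t* *m diag_mx (d z) *m V) =
    V^t* *m diag_mx (\row_i \prod_(z <- r | Q z) d z 0 i) *m V.
Proof.
move=> V1 V2; elim: r => [|z r IH].
  have -> : \row_i \prod_(z <- [::] | Q z) d z 0 i = const_mx 1.
    by apply/rowP => i; rewrite !mxE big_nil.
  by rewrite big_nil diag_const_mx mulmx1 V2.
rewrite big_cons; case: ifP => Qz; last first.
  by rewrite IH; congr (_ *m diag_mx _ *m _); apply/rowP => i; rewrite !mxE big_cons Qz.
rewrite IH -mulmxE unitary_diagM //; congr (_ *m diag_mx _ *m _); apply/rowP => i.
by rewrite !mxE big_cons Qz.
Qed.

Lemma unitary_diagBz (V : 'M[C]_n) (d : 'rV[C]_n) (c z : C) : V^t* *m V = 1%:M ->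
  c *: (V^t* *m diag_mx d *m V - z%:M) = V^t* *m diag_mx (\row_i (c * (d 0 i - z))) *m V.
Proof.
move=> V2; have -> : z%:M = V^t* *m z%:M *m V by rewrite -mulmxA mul_scalar_mx -scalemxAr V2 scalemx1.
rewrite -mulmxBl -mulmxBr scalemxAl scalemxAr; congr (_ *m _ *m _).
by apply/matrixP => i j; rewrite !mxE; case: eqP; rewrite ?mulr1n ?mulr0n ?subrr ?mulr0.
Qed.

(** The spectral projection as a polynomial in [K]: for [K] in the image of a group algebra it stays
    there. *)
Definition lagrange (L : seq C) (K : 'M[C]_n) (z : C) : 'M[C]_n :=
  \prod_(y <- L | y != z) ((z - y)^-1 *: (K - y%:M)).

Lemma lagrange_diag (L : seq C) (V : 'M[C]_n) (d : 'rV[C]_n) z :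
  V *m V^t* = 1%:M -> V^t* *m V = 1%:M -> (forall i, d 0 i \in L) ->
  lagrange L (V^t* *m diag_mx d *m V) z =
    V^t* *m diag_mx (\row_i (d 0 i == z)%:R) *m V.
Proof.
move=> V1 V2 dL; rewrite /lagrange; under eq_bigr do rewrite unitary_diagBz //.
rewrite prod_unitary_diag //; congr (_ *m diag_mx _ *m _); apply/rowP => i; rewrite !mxE.
under eq_bigr do rewrite mxE.
have [dz|dz] := eqVneq (d 0 i) z.
  rewrite big1 // => y yz; rewrite dz mulVf // subr_eq0 eq_sym //.
by rewrite (big_rem (d 0 i)) //= dz subrr mulr0 mul0r.
Qed.

Lemma lagrange_spec (L : seq C) (K : 'M[C]_n) : uniq L ->
  K *m K^t* = K^t* *m K -> \prod_(z <- L) (K - z%:M) = 0 ->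
  [/\ forall z, z \in L -> proj (lagrange L K z),
      forall z, z \in L -> K *m lagrange L K z = z *: lagrange L K z &
      \sum_(z <- L) lagrange L K z = 1%:M].
Proof.
move=> uL nK; have [V [d [V1 V2 ->]]] := normal_spectral nK.
under eq_bigr do rewrite -[_ - _]scale1r unitary_diagBz //.
rewrite prod_unitary_diag // => /(congr1 (fun M => V *m M *m V^t*)).
rewrite !mulmxA V1 mul1mx -mulmxA V1 mulmx1 mulmx0 mul0mx => /matrixP Z.
have dL i : d 0 i \in L.
  have := Z i i; rewrite !mxE eqxx mulr1n => /eqP.
  by rewrite prodf_seq_eq0 => /hasP[z zL]; rewrite mxE mul1r subr_eq0 => /eqP ->.
split=> [z zL|z zL|].
- rewrite lagrange_diag //; split.
    rewrite !adjM trmxCK tr_diag_mx map_diag_mx !mulmxA; congr (_ *m diag_mx _ *m _).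
    by apply/rowP => i; rewrite !mxE; case: (_ == _); rewrite ?rmorph1 ?rmorph0.
  rewrite unitary_diagM //; congr (_ *m diag_mx _ *m _); apply/rowP => i; rewrite !mxE.
  by case: (_ == _); rewrite ?mulr1 ?mulr0.
- rewrite lagrange_diag // unitary_diagM // scalemxAl scalemxAr; congr (_ *m _ *m _).
  apply/matrixP => i j; rewrite !mxE.
  by case: (eqVneq (d 0 i) z) => [->|_]; rewrite ?mulr1 ?mulr0 ?mul0rn ?mulr0 // mulrnAr mulr1.
- under eq_bigr do rewrite lagrange_diag //.
  rewrite -mulmx_suml -mulmx_sumr -[RHS]V2; congr (_ *m _); rewrite -[RHS]mulmx1; congr (_ *m _).
  apply/matrixP => i j; rewrite summxE !mxE.
  under eq_bigr do rewrite !mxE.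
  case: (eqVneq i j) => [->|_]; last by rewrite big1 // => z _; rewrite mulr0n.
  rewrite (bigD1_seq (d 0 j)) //= eqxx mulr1n big1 ?addr0 // => z zd.
  by rewrite eq_sym (negbTE zd) mul0rn.
Qed.

End Lagrange.

(** * Joint spectral projections in a group algebra *)

Section CentralProjections.
Variables (C : numClosedFieldType) (H : finGroupType) (O : H -> {set H}).
Hypothesis O_conj : forall h x k, x \in O h -> (x ^ k)%g \in O h.

(** [O] will be the conjugacy classes of [H], which yield multiplicities, or the classes under
    conjugation by [G], which yield types. *)
Definition orbit_avg n (a : H -> 'M[C]_n) h := #|O h|%:R^-1 *: \sum_(x in O h) a x.

Lemma O_conjE h x k : ((x ^ k)%g \in O h) = (x \in O h).
Proof. by apply/idP/idP => [/(O_conj (k^-1)%g)|/O_conj//]; rewrite conjgK. Qed.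

Lemma orbit_avg_central n (a : H -> 'M[C]_n) h k :
  urep a -> a k *m orbit_avg a h = orbit_avg a h *m a k.
Proof.
move=> [aM _]; rewrite -scalemxAr -scalemxAl mulmx_sumr mulmx_suml; congr (_ *: _).
rewrite (reindex_inj (conjg_inj k)); apply: eq_big => [x|x _]; first exact: O_conjE.
by rewrite -!aM conjgE mulKVg.
Qed.

Lemma orbit_avg_comm n (a : H -> 'M[C]_n) h (M : 'M[C]_n) :
  (forall k, M *m a k = a k *m M) -> M *m orbit_avg a h = orbit_avg a h *m M.
Proof.
move=> Ma; rewrite -scalemxAr -scalemxAl mulmx_sumr mulmx_suml; congr (_ *: _).
by apply: eq_bigr => x _.
Qed.

Lemma orbit_avg_normal n (a : H -> 'M[C]_n) h : urep a ->
  orbit_avg a h *m (orbit_avg a h)^t* = (orbit_avg a h)^t* *m orbit_avg a h.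
Proof.
move=> ua; apply/esym/orbit_avg_comm => k.
rewrite -[LHS]trmxCK adjM trmxCK -(urepV ua) orbit_avg_central //.
by rewrite adjM (urepV ua) trmxCK.
Qed.

Definition regular (h : H) : 'M[C]_#|H| :=
  \matrix_(i, j) (enum_val i * h == enum_val j)%g%:R.

Lemma sum_enum_eq (x : H) (f : H -> C) :
  \sum_(k < #|H|) (x == enum_val k)%:R * f (enum_val k) = f x.
Proof.
rewrite (bigD1 (enum_rank x)) //= enum_rankK eqxx mul1r big1 ?addr0 // => k kx.
case: eqP => [xk|_]; last by rewrite mul0r.
by move: kx; rewrite xk enum_valK eqxx.
Qed.

Lemma regular_urep : urep regular.
Proof.
split=> [x y|x]; apply/matrixP => i j; rewrite !mxE.
  under eq_bigr do rewrite !mxE.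
  rewrite (@sum_enum_eq (enum_val i * x)%g (fun z => (z * y == enum_val j)%g%:R)).
  by rewrite mulgA.
under eq_bigr do rewrite !mxE.
under eq_bigr do rewrite rmorph_nat.
rewrite (@sum_enum_eq (enum_val i * x)%g (fun z => (enum_val j * x == z)%g%:R)).
by rewrite (inj_eq (mulIg _)) (inj_eq enum_val_inj) eq_sym.
Qed.

Lemma regular_free (c : H -> C) : \sum_h c h *: regular h = 0 -> forall h, c h = 0.
Proof.
move=> /matrixP E h; have := E (enum_rank 1%g) (enum_rank h).
rewrite summxE mxE (bigD1 h) //= big1 ?addr0 => [|k kh].
  by rewrite !mxE !enum_rankK mul1g eqxx mulr1.
by rewrite !mxE !enum_rankK mul1g (negbTE kh) mulr0.
Qed.

(** The coefficients are shared by all representations. This makes later Lipschitz constants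
    independent of [n], and lets identities be checked on [regular]. *)
Definition in_algebra (F : forall n, (H -> 'M[C]_n) -> 'M[C]_n) :=
  exists c : H -> C, forall n a, urep a -> F n a = \sum_h c h *: a h.

Lemma in_algebra_scalar z : in_algebra (fun n _ => z%:M).
Proof.
exists (fun h => (h == 1%g)%:R * z) => n a ua.
rewrite (bigD1 1%g) //= big1 ?addr0 => [|h /negbTE->]; last by rewrite mul0r scale0r.
by rewrite eqxx mul1r (urep1 ua) scalemx1.
Qed.

Lemma in_algebraD F F' : in_algebra F -> in_algebra F' ->
  in_algebra (fun n a => F n a + F' n a).
Proof.
move=> [c E] [c' E']; exists (fun h => c h + c' h) => n a ua.
by rewrite E // E' // -big_split; apply: eq_bigr => h _; rewrite scalerDl.
Qed.

Lemma in_algebraZ z F : in_algebra F -> in_algebra (fun n a => z *: F n a).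
Proof.
move=> [c E]; exists (fun h => z * c h) => n a ua.
by rewrite E // scaler_sumr; apply: eq_bigr => h _; rewrite scalerA.
Qed.

Lemma in_algebraM F F' : in_algebra F -> in_algebra F' ->
  in_algebra (fun n a => F n a *m F' n a).
Proof.
move=> [c E] [c' E']; exists (fun h => \sum_k c k * c' (k^-1 * h)%g) => n a ua.
rewrite E // E' // mulmx_suml.
under [RHS]eq_bigr do rewrite scaler_suml.
rewrite [RHS]exchange_big /=; apply: eq_bigr => k _.
rewrite mulmx_sumr (reindex_inj (mulgI k^-1%g)) /=; apply: eq_bigr => h _.
have [aM _] := ua.
by rewrite -scalemxAl -scalemxAr scalerA -aM mulKVg.
Qed.

Lemma in_algebra_prod (I : Type) (r : seq I) (Q : pred I) F :
  (forall k, Q k -> in_algebra (F k)) ->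
  in_algebra (fun n a => \prod_(k <- r | Q k) F k n a).
Proof.
move=> hF; elim: r => [|k r [c E]].
  have [c E] := in_algebra_scalar 1; exists c => n a ua; rewrite big_nil -E //.
case Qk: (Q k); last by exists c => n a ua; rewrite big_cons Qk E.
have [c' E'] := in_algebraM (hF k Qk) (ex_intro _ c E).
by exists c' => n a ua; rewrite big_cons Qk -E' // mulmxE.
Qed.

Lemma in_algebra_avg h : in_algebra (fun n a => orbit_avg a h).
Proof.
exists (fun x => (x \in O h)%:R * #|O h|%:R^-1) => n a ua.
rewrite /orbit_avg scaler_sumr big_mkcond /=; apply: eq_bigr => x _.
by case: ifP; rewrite ?mul1r ?mul0r ?scale0r.
Qed.

Lemma in_algebra_sub_avg h y : in_algebra (fun n a => orbit_avg a h - y%:M).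
Proof.
have [c E] := in_algebraD (in_algebra_avg h) (in_algebra_scalar (- y)).
by exists c => n a ua; rewrite -E // -raddfN.
Qed.

(** Group elements are linearly independent in the regular representation, so a polynomial identity
    that holds there holds in every representation. The eigenvalues found there thus suffice
    everywhere. *)
Lemma spectrum : exists2 L : seq C, uniq L & forall h n (a : H -> 'M[C]_n),
  urep a -> \prod_(z <- L) (orbit_avg a h - z%:M) = 0.
Proof.
have ureg := regular_urep.
have /fin_all_exists[V /fin_all_exists[d Vd]] : forall h, exists (V : 'M[C]_#|H|) (d : 'rV[C]_#|H|),
    [/\ V *m V^t* = 1%:M, V^t* *m V = 1%:M & orbit_avg regular h = V^t* *m diag_mx d *m V].
  by move=> h; apply/normal_spectral/orbit_avg_normal.
pose L := undup [seq d p.1 0 p.2 | p <- enum {: H * 'I_#|H|}].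
exists L; first exact: undup_uniq.
move=> h n a ua.
have [c E] := @in_algebra_prod C L xpredT (fun z n a => orbit_avg a h - z%:M)
  (fun z _ => in_algebra_sub_avg h z).
rewrite E // big1 // => k _.
rewrite regular_free ?scale0r // -E //; have [V1 V2 ->] := Vd h.
under eq_bigr do rewrite -[_ - _]scale1r unitary_diagBz //.
rewrite prod_unitary_diag //; set D := diag_mx _; have -> : D = 0.
  apply/matrixP => i j; rewrite !mxE; case: eqP => // _; rewrite mulr1n.
  apply/eqP; rewrite prodf_seq_eq0; apply/hasP; exists (d h 0 i).
    by rewrite mem_undup; apply/mapP; exists (h, i); rewrite // mem_enum.
  by rewrite /= mxE subrr mulr0.
by rewrite mulmx0 mul0mx.
Qed.

(* Simultaneous spectral projections of the orbit averages, which are commuting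
   normal operators with uniformly finite spectrum. *)
Lemma central_projections : exists N (lam : 'I_N -> C) (c : {ffun H -> 'I_N} -> H -> C),
  forall n (a : H -> 'M[C]_n), urep a ->
  let P w := \sum_h c w h *: a h in
  [/\ forall w, proj (P w), \sum_w P w = 1%:M,
      forall w (M : 'M[C]_n), (forall h, M *m orbit_avg a h = orbit_avg a h *m M) ->
        M *m P w = P w *m M &
      forall w h, orbit_avg a h *m P w = lam (w h) *: P w].
Proof.
have [L uL Lspec] := spectrum.
pose lam (i : 'I_(size L)) := L`_i.
have lamL i : lam i \in L by apply: mem_nth.
pose P (w : {ffun H -> 'I_(size L)}) n (a : H -> 'M[C]_n) :=
  \prod_(h : H) lagrange L (orbit_avg a h) (lam (w h)).
have inP w : in_algebra (P w).
  apply: in_algebra_prod => h _; apply: in_algebra_prod => y _.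
  exact/in_algebraZ/in_algebra_sub_avg.
have /fin_all_exists[c Pc] := inP.
exists (size L), lam, c => n a ua /=.
have PcE w : \sum_h c w h *: a h = P w n a by rewrite Pc.
have avgC h k : orbit_avg a h *m orbit_avg a k = orbit_avg a k *m orbit_avg a h.
  by apply: orbit_avg_comm => x; rewrite orbit_avg_central.
have lagC h z (M : 'M[C]_n) : M *m orbit_avg a h = orbit_avg a h *m M ->
    M *m lagrange L (orbit_avg a h) z = lagrange L (orbit_avg a h) z *m M.
  move=> Mh; rewrite mulmxE; apply: commr_prod => y _; rewrite /GRing.comm -!mulmxE.
  by rewrite -scalemxAr -scalemxAl mulmxBr mulmxBl Mh scalar_mxC.
have spec h := lagrange_spec uL (orbit_avg_normal h ua) (Lspec h n a ua).
have lagP h i : proj (lagrange L (orbit_avg a h) (lam i)) by have [+ _ _] := spec h; apply.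
have subP (s : seq H) w : [/\ proj (\prod_(h <- s) lagrange L (orbit_avg a h) (lam (w h))),
    forall M : 'M[C]_n, (forall h, M *m orbit_avg a h = orbit_avg a h *m M) ->
      M *m (\prod_(h <- s) lagrange L (orbit_avg a h) (lam (w h))) =
      (\prod_(h <- s) lagrange L (orbit_avg a h) (lam (w h))) *m M &
    forall k, k \in s -> orbit_avg a k *m (\prod_(h <- s) lagrange L (orbit_avg a h) (lam (w h))) =
      lam (w k) *: (\prod_(h <- s) lagrange L (orbit_avg a h) (lam (w h)))].
  elim: s => [|h s [pr cm ev]].
    rewrite big_nil; split=> // [|M _]; first exact: proj1.
    by rewrite mulmx1 mul1mx.
  have cmM (M : 'M[C]_n) : (forall h, M *m orbit_avg a h = orbit_avg a h *m M) ->
      M *m (\prod_(h <- h :: s) lagrange L (orbit_avg a h) (lam (w h))) =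
      (\prod_(h <- h :: s) lagrange L (orbit_avg a h) (lam (w h))) *m M.
    by move=> hM; rewrite big_cons -mulmxE mulmxA lagC // -mulmxA cm // mulmxA.
  split=> // [|k].
    rewrite big_cons -mulmxE; apply: projM => //; apply: cm => k.
    by apply/esym/lagC/avgC.
  rewrite inE big_cons -mulmxE mulmxA => /orP[/eqP->|ks].
    by have [_ -> //] := spec h; rewrite -scalemxAl.
  by rewrite lagC // -mulmxA ev // scalemxAr.
split=> [w||w M hM|w h]; rewrite ?PcE.
- by case: (subP (index_enum H) w).
- under eq_bigr do rewrite PcE.
  rewrite /P -(bigA_distr_bigA (fun h i => lagrange L (orbit_avg a h) (lam i))) /=.
  apply: big1 => h _; have [_ _ E] := spec h; apply: etrans _ E.
  by rewrite (big_nth 0) big_mkord.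
- by have [_ cm _] := subP (index_enum H) w; apply: cm.
- by have [_ _ ev] := subP (index_enum H) w; apply: ev; rewrite mem_index_enum.
Qed.

End CentralProjections.

Section CentralData.
Variables (C : numClosedFieldType) (H : finGroupType) (O : H -> {set H}).

(** A record, so that [inhabited_witness] can fix one choice of the data for use in definitions. *)
Record central_data := CentralData {
  cdN : nat;
  cdlam : 'I_cdN -> C;
  cdc : {ffun H -> 'I_cdN} -> H -> C;
  cdP : forall n (a : H -> 'M[C]_n), urep a ->
    let P w := \sum_h cdc w h *: a h in
    [/\ forall w, proj (P w), \sum_w P w = 1%:M,
      forall w (M : 'M[C]_n), (forall h, M *m orbit_avg O a h = orbit_avg O a h *m M) ->
        M *m P w = P w *m M &
      forall w h, orbit_avg O a h *m P w = cdlam (w h) *: P w]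
}.

Lemma central_data_exists :
  (forall h x k, x \in O h -> (x ^ k)%g \in O h) -> inhabited central_data.
Proof.
by move=> h2; have [N [lam [c P]]] := central_projections C h2; exists; exists N lam c.
Qed.

End CentralData.

(** * Distance, block sums and trace polynomials of unitaries *)

Section UnitarySystem.
Variable R : realType.
Local Notation C := R[i].

Lemma ReK (z : C) : 0 <= z -> (complex.Re z)%:C%C = z.
Proof. by case: z => x y; rewrite lecE /= => /andP[/eqP-> _]. Qed.

Lemma le_Re (z w : C) : z <= w -> complex.Re z <= complex.Re w.
Proof. by rewrite lecE => /andP[]. Qed.

Lemma natrC (n : nat) : (n%:R : C) = (n%:R : R)%:C%C.
Proof. by rewrite rmorph_nat. Qed.

Lemma umxM n (a b : unitary R n) : umx (a * b)%g = umx a *m umx b. Proof. by []. Qed.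
Lemma umxV n (a : unitary R n) : umx (a^-1)%g = (umx a)^t*. Proof. by []. Qed.
Lemma umxU n (a : unitary R n) : umx a *m (umx a)^t* = 1%:M.
Proof. exact/unitarymxP/(valP a). Qed.
Lemma umxU' n (a : unitary R n) : (umx a)^t* *m umx a = 1%:M.
Proof. exact/mulmx1C/umxU. Qed.
Lemma umx_inj n : injective (@umx R n). Proof. exact: val_inj. Qed.

Lemma is_hom_urep (H : groupType) n (a : H -> unitary R n) : is_hom a -> urep (fun h => umx (a h)).
Proof. by move=> ha; split=> [x y|x]; rewrite ?ha ?umxU. Qed.

Definition udist n (a b : unitary R n) : R := complex.Re (hsn (umx a - umx b)).

Lemma udistE n (a b : unitary R n) : (udist a b)%:C%C = hsn (umx a - umx b).
Proof. by rewrite ReK // hsn_ge0. Qed.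

Lemma udist_eq0 n (a b : unitary R n) : udist a b = 0 <-> a = b.
Proof.
split=> [ab|->]; last by rewrite /udist subrr /hsn mulmx0 mxtrace0.
apply/umx_inj/eqP; rewrite -subr_eq0 -hsn_eq0 -udistE ab //.
Qed.

Lemma udist_ge0 n (a b : unitary R n) : 0 <= udist a b.
Proof. exact: (le_Re (hsn_ge0 _)). Qed.

Lemma udist_sym n (a b : unitary R n) : udist a b = udist b a.
Proof. by rewrite /udist hsn_sym. Qed.

Lemma udist_tri n (b a c : unitary R n) : udist a c <= 2 * (udist a b + udist b c).
Proof.
rewrite -lecR rmorphM [X in _ * X]rmorphD /= !udistE rmorph_nat; exact: hsn_tri.
Qed.

Lemma udist_le n (a b : unitary R n) : udist a b <= 4 * n%:R.
Proof.
rewrite -lecR rmorphM /= udistE !rmorph_nat.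
apply: le_trans (hsnD_le _ _) _; rewrite hsnN !hsn_unitary ?umxU //.
by rewrite le_eqVlt; apply/orP; left; apply/eqP; ring.
Qed.

Lemma udist_mull n (c a b : unitary R n) : udist (c * a)%g (c * b)%g = udist a b.
Proof. by rewrite /udist !umxM -mulmxBr hsn_isol // umxU'. Qed.

Lemma udist_mulr n (c a b : unitary R n) : udist (a * c)%g (b * c)%g = udist a b.
Proof. by rewrite /udist !umxM -mulmxBl hsn_isor // umxU. Qed.

Fact ublock_proof m l (a : unitary R m) (b : unitary R l) :
  block_mx (umx a) 0 0 (umx b) \is unitarymx.
Proof.
apply/unitarymxP; rewrite tr_block_mx map_block_mx !trmx0 !map_mx0 mulmx_block.
by rewrite !mulmx0 !mul0mx !addr0 add0r !umxU -scalar_mx_block.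
Qed.

Definition ublock m l (a : unitary R m) (b : unitary R l) := Unitary (ublock_proof a b).

Definition usum m l n (e : (m + l)%N = n) (a : unitary R m) (b : unitary R l) : unitary R n :=
  ecast k (unitary R k) e (ublock a b).

Lemma usumM m l n (e : (m + l)%N = n) a a' b b' :
  usum e (a * a')%g (b * b')%g = (usum e a b * usum e a' b')%g.
Proof.
case: n / e; apply: umx_inj; rewrite umxM /= mulmx_block.
by rewrite !mulmx0 !mul0mx !addr0 add0r.
Qed.

Lemma udist_usum m l n (e : (m + l)%N = n) a a' b b' :
  udist (usum e a b) (usum e a' b') = udist a a' + udist b b'.
Proof.
case: n / e; rewrite /udist /= opp_block_mx add_block_mx !subr0 hsn_block.
by rewrite /hsn !mulmx0 !mxtrace0 !addr0 raddfD.
Qed.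

Lemma ucut m l n (e : (m + l)%N = n) (a : unitary R n) :
  exists b, udist a (usum e b 1%g) <= 8 * l%:R.
Proof.
case: n / e a => a; have [b b1 le8] := corner_unitary (umxU a).
have ub : b \is unitarymx by apply/unitarymxP.
by exists (Unitary ub); rewrite -lecR udistE rmorphM /= !rmorph_nat.
Qed.

Section TracePolynomials.
Variables (G : groupType) (X : finType) (f : X -> G) (c : X -> C).

(** Linear in the matrices [psi (f x)], so its trace is additive and Lipschitz; when it is a
    projection, the trace is its rank. Multiplicities and sizes of types are both ranks of this
    kind. *)
Definition tpoly n (psi : G -> unitary R n) : 'M[C]_n := \sum_x c x *: umx (psi (f x)).

Lemma mxtrace_tpoly n (psi : G -> unitary R n) :
  \tr (tpoly psi) = \sum_x c x * \tr (umx (psi (f x))).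
Proof. by rewrite raddf_sum; apply: eq_bigr => x _; rewrite /= mxtraceZ. Qed.

Lemma tpoly_conj n (psi : G -> unitary R n) (u : unitary R n) :
  tpoly (fun g => u * psi g * u^-1)%g = umx u *m tpoly psi *m (umx u)^t*.
Proof.
rewrite /tpoly mulmx_sumr mulmx_suml; apply: eq_bigr => x _.
by rewrite -scalemxAr -scalemxAl.
Qed.

Lemma tpoly_block m l (psi : G -> unitary R m) (psi' : G -> unitary R l) :
  tpoly (fun g => ublock (psi g) (psi' g)) = block_mx (tpoly psi) 0 0 (tpoly psi').
Proof.
rewrite /tpoly; under eq_bigr => x _ do rewrite /= scale_block_mx !scaler0.
elim/big_rec3: _ => [|x A B D _ ->]; first by rewrite block_mx0.
by rewrite add_block_mx !addr0.
Qed.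

Lemma mxtrace_tpoly_conj n (psi : G -> unitary R n) (u : unitary R n) :
  \tr (tpoly (fun g => u * psi g * u^-1)%g) = \tr (tpoly psi).
Proof. by rewrite tpoly_conj mxtrace_mulC mulmxA umxU' mul1mx. Qed.

Lemma mxtrace_tpoly_usum m l n (e : (m + l)%N = n) (psi : G -> unitary R m) (psi' : G -> unitary R l) :
  \tr (tpoly (fun g => usum e (psi g) (psi' g))) = \tr (tpoly psi) + \tr (tpoly psi').
Proof. by case: n / e; rewrite /= tpoly_block mxtrace_block. Qed.

Lemma mxtrace_tpoly_lip (e : R) : 0 < e -> exists2 d, 0 < d &
  forall n (psi psi' : G -> unitary R n),
    (forall x, udist (psi (f x)) (psi' (f x)) <= d * n%:R) ->
    `|\tr (tpoly psi) - \tr (tpoly psi')| <= (e * n%:R)%:C%C.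
Proof.
move=> e0; pose K := 1 + \sum_x complex.Re `|c x|.
have c0 x : 0 <= complex.Re `|c x| by apply: (le_Re (normr_ge0 _)).
have K0 : 0 < K by rewrite ltr_pwDl ?ltr01 ?sumr_ge0.
pose s := e / K; have s0 : 0 < s by rewrite divr_gt0.
(* At squared distance [s ^+ 2 * n] the two terms of [mxtrace_le] with parameter [s] balance. *)
exists (s ^+ 2) => [|n psi psi' near]; first exact: exprn_gt0.
have trM x : `|\tr (umx (psi (f x)) - umx (psi' (f x)))| <= (s * n%:R)%:C%C.
  have s0' : (0 : C) < s%:C%C by rewrite ltcR.
  have := mxtrace_le (umx (psi (f x)) - umx (psi' (f x))) s0'.
  rewrite -udistE -fmorphV (natrC n) -!rmorphM -rmorphD => h.
  rewrite -(ler_pM2l (x := 2)) //; apply: le_trans h _.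
  rewrite (natrC 2) -rmorphM lecR.
  have : udist (psi (f x)) (psi' (f x)) / s <= s * n%:R.
    by rewrite ler_pdivrMr // mulrAC -expr2.
  by clear; lra.
rewrite !mxtrace_tpoly -sumrB; apply: le_trans (ler_norm_sum _ _ _) _.
apply: (@le_trans _ _ (\sum_x (complex.Re `|c x|)%:C%C * (s * n%:R)%:C%C)).
  apply: ler_sum => x _; rewrite -mulrBr normrM ReK //.
  by apply: ler_wpM2l => //; rewrite -linearB; apply: trM.
rewrite -mulr_suml -rmorph_sum -rmorphM lecR mulrA; apply: ler_wpM2r => //.
rewrite /s mulrCA ler_piMr ?(ltW e0) // ler_pdivrMr // mul1r /K.
by rewrite lerDr.
Qed.

Lemma rank_tpoly n (psi : G -> unitary R n) : proj (tpoly psi) ->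
  \tr (tpoly psi) = (\rank (tpoly psi))%:R.
Proof. by case=> _; apply: mxtrace_idem. Qed.

Lemma rank_tpoly_lip (e : R) : 0 < e -> exists2 d, 0 < d &
  forall n (psi psi' : G -> unitary R n), proj (tpoly psi) -> proj (tpoly psi') ->
    (forall x, udist (psi (f x)) (psi' (f x)) <= d * n%:R) ->
    (\rank (tpoly psi))%:R <= (\rank (tpoly psi'))%:R + e * n%:R :> R.
Proof.
move=> e0; have [d d0 lip] := mxtrace_tpoly_lip e0; exists d => // n psi psi' p p' near.
have := lip n psi psi' near; rewrite !rank_tpoly // !natrC -rmorphB /= normc_def /=.
by rewrite expr0n addr0 sqrtr_sqr lecR ler_norml => /andP[_]; clear; lra.
Qed.

End TracePolynomials.

End UnitarySystem.

(** * Multiplicities of unitary representations *)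

Section UnitaryInvariants.
Variable R : realType.
Local Notation C := R[i].

Definition conj_class (H : finGroupType) (h : H) : {set H} := class h [set: H].

Lemma conj_class_conj (H : finGroupType) (h x k : H) :
  x \in conj_class h -> (x ^ k)%g \in conj_class h.
Proof. by case/imsetP=> y _ ->; rewrite -conjgM; apply/imsetP; exists (y * k)%g. Qed.

Definition class_data (H : finGroupType) : central_data C (@conj_class H) :=
  inhabited_witness (central_data_exists C (@conj_class_conj H)).

(** The rank of an isotypic component: [w] encodes a central character by its values on class
    averages. Values that do not occur have rank 0. *)
Definition unu (H : finGroupType) n (a : H -> unitary R n) w : nat :=
  \rank (tpoly (@id H) (cdc (c := class_data H) w) a).

Lemma proj_unu (H : finGroupType) n (a : H -> unitary R n) w : is_hom a ->
  proj (tpoly (@id H) (cdc (c := class_data H) w) a).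
Proof. by move=> /is_hom_urep ua; have [+ _ _ _] := cdP (class_data H) ua; apply. Qed.

Lemma mxtrace_orbit_avg (H : finGroupType) (O : H -> {set H}) n (a : H -> 'M[C]_n) h :
  h \in O h -> (forall x, x \in O h -> \tr (a x) = \tr (a h)) ->
  \tr (orbit_avg O a h) = \tr (a h).
Proof.
move=> hO E; rewrite mxtraceZ raddf_sum /= (eq_bigr _ E) sumr_const -[X in _ * X]mulr_natl mulKf //.
by rewrite pnatr_eq0 -lt0n; apply/card_gt0P; exists h.
Qed.

(** The trace of [a h] is that of its class average, which is scalar on each joint eigenspace. Hence
    equal [unu] give equal characters, as [near_intertwiner] needs. *)
Lemma mxtrace_unu (H : finGroupType) n (a : H -> unitary R n) h : is_hom a ->
  \tr (umx (a h)) = \sum_(w : {ffun H -> 'I_(cdN (class_data H))}) cdlam (c := class_data H) (w h) * (unu a w)%:R.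
Proof.
move=> ha; have ua := is_hom_urep ha; have [_ sP _ ev] := cdP (class_data H) ua.
rewrite -(@mxtrace_orbit_avg H (@conj_class H) n (fun h => umx (a h))); first last.
- move=> _ /imsetP[k _ ->]; have [aM _] := ua.
  by rewrite conjgE !aM (urepV ua) mxtrace_mulC -mulmxA umxU mulmx1.
- exact: class_refl.
rewrite -[orbit_avg _ _ _]mulmx1 -sP mulmx_sumr raddf_sum; apply: eq_bigr => w _.
by rewrite ev /= mxtraceZ -rank_tpoly //; apply: proj_unu.
Qed.

Lemma unu_conj (H : finGroupType) n (a : H -> unitary R n) u j :
  is_hom a -> unu (fun h => u * a h * u^-1)%g j = unu a j.
Proof.
move=> ha; apply/eqP; rewrite -(eqr_nat C) -!rank_tpoly ?mxtrace_tpoly_conj //.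
  exact: proj_unu.
exact/proj_unu/is_hom_conj.
Qed.

Lemma unu_usum (H : finGroupType) m l n (e : (m + l)%N = n)
    (a : H -> unitary R m) (b : H -> unitary R l) j : is_hom a -> is_hom b ->
  unu (fun h => usum e (a h) (b h)) j = (unu a j + unu b j)%N.
Proof.
move=> ha hb; apply/eqP; rewrite -(eqr_nat C) natrD -!rank_tpoly ?mxtrace_tpoly_usum //.
- exact: proj_unu.
- exact: proj_unu.
- by apply: proj_unu => x y; rewrite ha hb usumM.
Qed.

Lemma unu_lip (H : finGroupType) (e : R) : 0 < e -> exists2 d, 0 < d &
  forall n (a b : H -> unitary R n), is_hom a -> is_hom b ->
  (forall h, udist (a h) (b h) <= d * n%:R) ->
  forall j, (unu a j)%:R <= (unu b j)%:R + e * n%:R :> R.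
Proof.
move=> e0.
have /fin_all_exists[d hd] : forall j, exists d, 0 < d /\
    forall n (a b : H -> unitary R n), is_hom a -> is_hom b ->
    (forall h, udist (a h) (b h) <= d * n%:R) ->
    (unu a j)%:R <= (unu b j)%:R + e * n%:R :> R.
  move=> j; have [d d0 lip] := rank_tpoly_lip (@id H) (cdc (c := class_data H) j) e0.
  by exists d; split=> // n a b ha hb near; apply: lip => //; apply: proj_unu.
exists (\big[Num.min/1]_j d j) => [|n a b ha hb near j].
  by apply: bigmin_gt0 => // j; have [] := hd j.
have [_] := hd j; apply=> // h; apply: le_trans (near h) _; apply: ler_wpM2r => //.
exact: bigmin_le_cond.
Qed.

Lemma unu_conjugacy (H : finGroupType) (e : R) : 0 < e -> exists2 d, 0 < d &
  forall n (a b : H -> unitary R n) t, is_hom a -> is_hom b -> unu a =1 unu b ->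
  (forall h, udist (t * b h)%g (a h * t)%g <= d * n%:R) ->
  exists2 t', (forall h, t' * b h = a h * t')%g & udist t t' <= e * n%:R.
Proof.
move=> e0; pose K : R := (2 * (1 + 2 * (1 + 2 ^ #|H|)) * 2 ^ #|H|)%N%:R.
have K0 : 0 < K by rewrite ltr0n !muln_gt0 expn_gt0 addn_gt0.
exists (e / K) => [|n a b t ha hb ab near]; first exact: divr_gt0.
have ua := is_hom_urep ha; have ub := is_hom_urep hb.
have [h|h|U [U1 aU tU]] := near_intertwiner (t := umx t) (d := (e / K * n%:R)%:C%C) ua ub _ (umxU t) _.
- by rewrite !mxtrace_unu //; apply: eq_bigr => w _; rewrite ab.
- by rewrite -!umxM -udistE lecR.
have uU : U \is unitarymx by apply/unitarymxP.
exists (Unitary uU) => [h|]; first by apply: umx_inj; rewrite !umxM /= aU.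
rewrite -lecR udistE; apply: le_trans tU _.
have -> : 2 * (1 + 2 * (1 + 2 ^+ #|H|)) * 2 ^+ #|H| = K%:C%C :> C.
  by rewrite -natrC !(natrM, natrD, natrX).
by rewrite -rmorphM mulrA mulrCA mulfV ?gt_eqF // mulr1.
Qed.

Definition unitary_system : block_system R := {|
  bgrp := fun n => unitary R n;
  bD := @udist R;
  bsum := @usum R;
  bD_eq0 := @udist_eq0 R;
  bD_ge0 := @udist_ge0 R;
  bD_sym := @udist_sym R;
  bD_tri := @udist_tri R;
  bD_le := @udist_le R;
  bD_mull := @udist_mull R;
  bD_mulr := @udist_mulr R;
  bsumM := @usumM R;
  bD_bsum := @udist_usum R;
  bcut := @ucut R;
  bidx := fun H => {ffun H -> 'I_(cdN (class_data H))} : finType;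
  bnu := unu;
  bnu_le := fun H n a j _ => rank_leq_row _;
  bnu_conj := unu_conj;
  bnu_bsum := unu_usum;
  bnu_lip := unu_lip;
  bnu_conjugacy := unu_conjugacy
|}.

End UnitaryInvariants.

(** * Splitting along an invariant projection *)

Section SplitMatrix.
Variables (R : realType) (G : groupType).
Local Notation C := R[i].

Lemma block_proj_commute m l (M : 'M[C]_(m + l)) :
  block_mx 1%:M 0 0 0 *m M = M *m block_mx 1%:M 0 0 0 ->
  M = block_mx (ulsubmx M) 0 0 (drsubmx M).
Proof.
rewrite -{1 2}(submxK M) !mulmx_block !mul0mx !mulmx0 !mul1mx !mulmx1 !addr0.
case/eq_block_mx => _ ur dl _.
by rewrite -[LHS]submxK ur -dl.
Qed.

(** The final clause, applied to the trace polynomial that defines [P], will show that the first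
    block is pure. *)
Lemma unitary_split m l n (e : (m + l)%N = n) (U : 'M[C]_(m + l, n)) (P : 'M[C]_n)
    (psi : G -> unitary R n) :
  U *m U^t* = 1%:M -> U^t* *m U = 1%:M -> U *m P = block_mx 1%:M 0 0 0 *m U ->
  (forall g, P *m umx (psi g) = umx (psi g) *m P) ->
  exists (u : unitary R n) (p1 : G -> unitary R m) (p2 : G -> unitary R l),
    psi = (fun g => u * usum e (p1 g) (p2 g) * u^-1)%g /\
    forall (X : finType) (f : X -> G) (c : X -> C), tpoly f c psi = P -> tpoly f c p1 = 1%:M.
Proof.
case: n / e U P psi => U P psi U1 U2 UP Ppsi.
have UPU : U *m P *m U^t* = block_mx 1%:M 0 0 0 by rewrite UP -mulmxA U1 mulmx1.
pose Q g := U *m umx (psi g) *m U^t*.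
have QE g : Q g = block_mx (ulsubmx (Q g)) 0 0 (drsubmx (Q g)).
  apply: block_proj_commute; rewrite /Q !mulmxA -UP -(mulmxA U) Ppsi.
  rewrite -UPU !mulmxA -(mulmxA _ (U^t*)) U2 mulmx1.
  by rewrite -!mulmxA.
have Q1 g : Q g *m (Q g)^t* = 1%:M.
  rewrite /Q !adjM trmxCK !mulmxA -(mulmxA _ (U^t*)) U2 mulmx1.
  by rewrite -(mulmxA U) umxU mulmx1 U1.
have [u1 u2] : (forall g, ulsubmx (Q g) \is unitarymx) /\ (forall g, drsubmx (Q g) \is unitarymx).
  suff E g : ulsubmx (Q g) *m (ulsubmx (Q g))^t* = 1%:M /\ drsubmx (Q g) *m (drsubmx (Q g))^t* = 1%:M.
    by split=> g; apply/unitarymxP; case: (E g).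
  have := Q1 g; rewrite QE tr_block_mx map_block_mx !trmx0 !map_mx0 mulmx_block.
  rewrite !mulmx0 !mul0mx !addr0 add0r scalar_mx_block => /eq_block_mx[h1 _ _ h2].
  by rewrite block_mxKul block_mxKdr.
have uU : U^t* \is unitarymx by apply/unitarymxP; rewrite trmxCK.
pose p1 g := Unitary (u1 g); pose p2 g := Unitary (u2 g).
exists (Unitary uU), p1, p2.
have psiE : psi = (fun g => Unitary uU * ublock (p1 g) (p2 g) * (Unitary uU)^-1)%g.
  apply/funext => g; apply: umx_inj; rewrite !umxM umxV /= -QE /Q trmxCK.
  by rewrite !mulmxA U2 mul1mx -mulmxA U2 mulmx1.
split=> // X f c; rewrite psiE tpoly_conj tpoly_block /= trmxCK => E.
move: UPU; rewrite -E !mulmxA U1 mul1mx -mulmxA U1 mulmx1.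
by case/eq_block_mx.
Qed.

End SplitMatrix.

(** * Types of unitary representations *)

Section UnitaryTypes.
Variables (R : realType) (G : groupType) (H : finGroupType) (i : bool -> H -> G).
Hypothesis hom_i : forall k, is_hom (i k).
Hypothesis inj_i : forall k, injective (i k).
Hypothesis normal_i : forall k g h, exists h', i k h' = (g * i k h * g^-1)%g.
Local Notation C := R[i].
Local Notation S := (unitary_system R).

Definition gclass k (h : H) : {set H} :=
  [set x | `[< exists g, i k x = (g * i k h * g^-1)%g >]].

Lemma gclass_conj k h x y : x \in gclass k h -> (x ^ y)%g \in gclass k h.
Proof.
rewrite !inE => -[g E]; exists ((i k y)^-1 * g)%g.
by rewrite conjgE !hom_i (is_homV (hom_i k)) E invgM invgK !mulgA.
Qed.

Lemma gclass_refl k h : h \in gclass k h.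
Proof. by rewrite !inE; exists 1%g; rewrite mul1g invg1 mulg1. Qed.

Definition gdata k : central_data C (gclass k) :=
  inhabited_witness (central_data_exists C (@gclass_conj k)).

(** By normality, conjugation by [g] permutes the image of [H] and preserves each [G]-class, so it
    only reorders the sum. *)
Lemma gclass_avg_comm k h n (psi : G -> unitary R n) g : is_hom psi ->
  umx (psi g) *m orbit_avg (gclass k) (fun h => umx (psi (i k h))) h =
  orbit_avg (gclass k) (fun h => umx (psi (i k h))) h *m umx (psi g).
Proof.
move=> hp; have [s sE] : exists s : H -> H, forall x, i k (s x) = (g * i k x * g^-1)%g.
  by have /fin_all_exists[s sE] := fun x => normal_i k g x; exists s.
have s_inj : injective s.
  move=> x y sxy; apply: (inj_i (k := k)); apply: (@mulgI _ g); apply: (@mulIg _ g^-1%g).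
  by rewrite -!sE sxy.
rewrite -scalemxAr -scalemxAl mulmx_sumr mulmx_suml; congr (_ *: _).
rewrite [RHS](reindex_inj s_inj); apply: eq_big => [x|x _].
  apply/idP/idP; rewrite !inE => -[g' E].
    by exists (g * g')%g; rewrite sE E invgM !mulgA.
  exists (g^-1 * g')%g; have -> : i k x = (g^-1 * i k (s x) * g)%g.
    by rewrite sE !mulgA mulVg mul1g mulgKV.
  by rewrite E invgM invgK !mulgA.
by rewrite -!umxM -!hp sE mulgKV.
Qed.

Definition gproj k w n (psi : G -> unitary R n) : 'M[C]_n :=
  tpoly (i k) (cdc (c := gdata k) w) psi.
Arguments gproj k w {n} psi.

Lemma gproj_spec k n (psi : G -> unitary R n) : is_hom psi ->
  [/\ forall w, proj (gproj k w psi), \sum_w gproj k w psi = 1%:M,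
    forall w g, umx (psi g) *m gproj k w psi = gproj k w psi *m umx (psi g) &
    forall w h, orbit_avg (gclass k) (fun h => umx (psi (i k h))) h *m gproj k w psi =
      cdlam (c := gdata k) (w h) *: gproj k w psi].
Proof.
move=> hp; have ua : urep (fun h => umx (psi (i k h))).
  by apply: (@is_hom_urep _ _ _ (psi \o i k)); apply: is_hom_comp.
have [p1 p2 p3 p4] := cdP (gdata k) ua; split=> // w g.
by apply: p3 => h; apply: gclass_avg_comm.
Qed.

Definition utype : finType :=
  ({ffun H -> 'I_(cdN (gdata false))} * {ffun H -> 'I_(cdN (gdata true))})%type.

Definition utype_word (x : H * H) : G := (i false x.1 * i true x.2)%g.
Definition utype_coef (tau : utype) (x : H * H) : C :=
  cdc (c := gdata false) tau.1 x.1 * cdc (c := gdata true) tau.2 x.2.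

(** The product of a projection for [i false] and one for [i true], expanded over words so that the
    results on [tpoly] apply. *)
Definition uproj tau n (psi : G -> unitary R n) : 'M[C]_n :=
  tpoly utype_word (utype_coef tau) psi.

Lemma uprojE tau n (psi : G -> unitary R n) : is_hom psi ->
  uproj tau psi = gproj false tau.1 psi *m gproj true tau.2 psi.
Proof.
move=> hp; rewrite /uproj /gproj /tpoly mulmx_suml.
under [RHS]eq_bigr do rewrite mulmx_sumr.
rewrite pair_big /=; apply: eq_bigr => x _.
by rewrite -scalemxAl -scalemxAr scalerA -umxM -hp.
Qed.

(** One factor is a combination of operators [psi g]; the other commutes with all of these. *)
Lemma gproj_comm k k' w w' n (psi : G -> unitary R n) : is_hom psi ->
  gproj k w psi *m gproj k' w' psi = gproj k' w' psi *m gproj k w psi.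
Proof.
move=> hp; rewrite {1}/gproj /tpoly mulmx_suml mulmx_sumr; apply: eq_bigr => x _.
by have [_ _ cm _] := gproj_spec k' hp; rewrite -scalemxAl -scalemxAr cm.
Qed.

Lemma proj_uproj tau n (psi : G -> unitary R n) : is_hom psi -> proj (uproj tau psi).
Proof.
move=> hp; rewrite uprojE //.
have [p1 _ _ _] := gproj_spec false hp; have [p2 _ _ _] := gproj_spec true hp.
by apply: projM => //; apply: gproj_comm.
Qed.

Lemma uproj_comm tau n (psi : G -> unitary R n) g : is_hom psi ->
  uproj tau psi *m umx (psi g) = umx (psi g) *m uproj tau psi.
Proof.
move=> hp; rewrite uprojE //.
have [_ _ c1 _] := gproj_spec false hp; have [_ _ c2 _] := gproj_spec true hp.
by rewrite -mulmxA -c2 mulmxA -c1 mulmxA.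
Qed.

Definition unt n (psi : G -> unitary R n) (tau : utype) : nat := \rank (uproj tau psi).

Lemma mxtrace_uproj n (psi : G -> unitary R n) tau : is_hom psi ->
  \tr (uproj tau psi) = (unt psi tau)%:R.
Proof. by move=> hp; apply/rank_tpoly/proj_uproj. Qed.

Lemma unt_sum n (psi : G -> unitary R n) : is_hom psi -> (\sum_tau unt psi tau = n)%N.
Proof.
move=> hp; apply/eqP; rewrite -(eqr_nat C) natr_sum.
under eq_bigr do rewrite -mxtrace_uproj //.
rewrite -raddf_sum -mxtrace1; apply/eqP; congr (\tr _).
under eq_bigr do rewrite uprojE //.
have [_ s1 _ _] := gproj_spec false hp; have [_ s2 _ _] := gproj_spec true hp.
rewrite -[RHS]mulmx1 -{1}s1 -s2 mulmx_suml.
under [RHS]eq_bigr do rewrite mulmx_sumr.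
by rewrite pair_big.
Qed.

Lemma unt_conj n (psi : G -> unitary R n) u tau :
  is_hom psi -> unt (fun g => u * psi g * u^-1)%g tau = unt psi tau.
Proof.
move=> hp; apply/eqP; rewrite -(eqr_nat C) -!mxtrace_uproj ?mxtrace_tpoly_conj //.
exact: is_hom_conj.
Qed.

Lemma unt_usum m l n (e : (m + l = n)%N) (psi : G -> unitary R m) (psi' : G -> unitary R l) tau :
  is_hom psi -> is_hom psi' ->
  unt (fun g => usum e (psi g) (psi' g)) tau = (unt psi tau + unt psi' tau)%N.
Proof.
move=> h1 h2; apply/eqP; rewrite -(eqr_nat C) natrD -!mxtrace_uproj ?mxtrace_tpoly_usum //.
by move=> x y; rewrite h1 h2 usumM.
Qed.

Lemma unt_lip (e : R) : 0 < e -> exists2 d, 0 < d &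
  forall n (psi psi' : G -> unitary R n), is_hom psi -> is_hom psi' ->
  (forall k h, udist (psi (i k h)) (psi' (i k h)) <= d * n%:R) ->
  forall tau, (unt psi tau)%:R <= (unt psi' tau)%:R + e * n%:R :> R.
Proof.
move=> e0.
have /fin_all_exists[d hd] : forall tau : utype, exists d, 0 < d /\
    forall n (psi psi' : G -> unitary R n), is_hom psi -> is_hom psi' ->
    (forall k h, udist (psi (i k h)) (psi' (i k h)) <= d * n%:R) ->
    (unt psi tau)%:R <= (unt psi' tau)%:R + e * n%:R :> R.
  move=> tau; have [d d0 lip] := rank_tpoly_lip utype_word (utype_coef tau) e0.
  (* Each of the two letters of a word deviates by [d / 4 * n], and [udist_tri] doubles their
     sum. *)
  exists (d / 4); split=> [|n psi psi' h1 h2 near]; first by rewrite divr_gt0.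
  apply: lip => [||x]; [exact: proj_uproj|exact: proj_uproj|].
  have := udist_tri (psi (i false x.1) * psi' (i true x.2))%g
    (psi (i false x.1) * psi (i true x.2))%g (psi' (i false x.1) * psi' (i true x.2))%g.
  rewrite udist_mull udist_mulr /utype_word h1 h2.
  by have := near false x.1; have := near true x.2; clear; lra.
exists (\big[Num.min/1]_tau d tau) => [|n psi psi' h1 h2 near tau].
  by apply: bigmin_gt0 => // tau; have [] := hd tau.
have [_] := hd tau; apply=> // k h; apply: le_trans (near k h) _; apply: ler_wpM2r => //.
exact: bigmin_le_cond.
Qed.

Lemma unt_split n (psi : G -> S n) tau : is_hom psi ->
  exists l (e : (unt psi tau + l = n)%N) u (psi1 : G -> S (unt psi tau)) (psi2 : G -> S l),
  [/\ is_hom psi1, is_hom psi2, unt psi1 tau = unt psi tau &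
      psi = fun g => (u * bsum e (psi1 g) (psi2 g) * u^-1)%g].
Proof.
move=> hp; have [l [e [U [U1 U2 UP]]]] := proj_block (proj_uproj tau hp).
have [u [p1 [p2 [psiE tp]]]] := unitary_split e U1 U2 UP (fun g => uproj_comm tau g hp).
have hh : is_hom (fun g => u * bsum (b0 := S) e (p1 g) (p2 g) * u^-1)%g by rewrite -psiE.
have [h1 h2] := @is_hom_split R S G _ _ _ e u p1 p2 hh.
by exists l, e, u, p1, p2; split=> //; rewrite {1}/unt /uproj tp // mxrank1.
Qed.

(** On a pure action the projection is the identity, so each orbit average is the scalar prescribed
    by [tau]. Characters, and with them multiplicities, are then proportional to [n]. *)
Lemma pure_mxtrace n (psi : G -> unitary R n) tau k h : is_hom psi -> unt psi tau = n ->
  \tr (umx (psi (i k h))) =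
    (if k as k0 return C then cdlam (c := gdata true) (tau.2 h) else cdlam (c := gdata false) (tau.1 h)) * n%:R.
Proof.
move=> hp pn; have P1 : uproj tau psi = 1%:M.
  by apply: proj_full => //; apply: proj_uproj.
rewrite uprojE // in P1.
have trE : \tr (umx (psi (i k h))) = \tr (orbit_avg (gclass k) (fun h => umx (psi (i k h))) h).
  rewrite mxtrace_orbit_avg ?gclass_refl // => x; rewrite !inE => -[g ->].
  have [hpM _] := is_hom_urep hp.
  by rewrite !hpM mxtrace_mulC mulmxA -hpM mulVg (urep1 (is_hom_urep hp)) mul1mx.
rewrite trE -mxtrace1 -mxtraceZ; congr (\tr _).
have [_ _ _ ev] := gproj_spec k hp; have gc := fun w w' => gproj_comm (k := k) (k' := ~~ k) w w' hp.
case: k trE ev gc => _ ev gc.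
  by rewrite -[LHS]mulmx1 -P1 -gc mulmxA ev -scalemxAl.
by rewrite -[LHS]mulmx1 -P1 mulmxA ev -scalemxAl.
Qed.

Lemma unt_prop n n' (psi : G -> unitary R n) (psi' : G -> unitary R n') tau k j :
  is_hom psi -> is_hom psi' -> unt psi tau = n -> unt psi' tau = n' ->
  (unu (psi \o i k) j * n' = unu (psi' \o i k) j * n)%N.
Proof.
move=> h1 h2 p1 p2; apply/eqP; rewrite -(eqr_nat C) !natrM -!rank_tpoly; first last.
- exact/proj_unu/is_hom_comp.
- exact/proj_unu/is_hom_comp.
rewrite !mxtrace_tpoly !mulr_suml; apply/eqP/eq_bigr => h _ /=.
by rewrite (pure_mxtrace k h h1 p1) (pure_mxtrace k h h2 p2); case: k; ring.
Qed.

Definition unitary_types : type_theory S i := {|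
  gtype := utype;
  nt := unt : forall n, (G -> S n) -> utype -> nat;
  nt_sum := unt_sum;
  nt_conj := unt_conj;
  nt_bsum := unt_usum;
  nt_lip := unt_lip;
  nt_split := unt_split;
  nt_prop := unt_prop
|}.

End UnitaryTypes.

(** * Symmetric groups *)

Section PermSum.
Implicit Types m n l : nat.

Definition pdist n (s t : {perm 'I_n}) : nat := (\sum_x (s x != t x))%N.

Lemma pdist_eq0 n (s t : {perm 'I_n}) : pdist s t = 0%N <-> s = t.
Proof.
split=> [/eqP|->]; last by apply: big1 => x _; rewrite eqxx.
by rewrite sum_nat_eq0 => /forallP h; apply/permP => x; have := h x; rewrite /= eqb0 negbK => /eqP.
Qed.

Lemma pdist_sym n (s t : {perm 'I_n}) : pdist s t = pdist t s.
Proof. by apply: eq_bigr => x _; rewrite eq_sym. Qed.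

Lemma pdist_tri n (t s u : {perm 'I_n}) : (pdist s u <= pdist s t + pdist t u)%N.
Proof.
rewrite -big_split; apply: leq_sum => x _ /=.
by case: (eqVneq (s x) (t x)) => [->|_] //; case: (s x != u x).
Qed.

Lemma pdist_le n (s t : {perm 'I_n}) : (pdist s t <= n)%N.
Proof.
apply: (@leq_trans (\sum_(x < n) 1)%N); last by rewrite sum1_card card_ord.
by apply: leq_sum => x _; apply: leq_b1.
Qed.

Lemma pdist_mull n (c s t : {perm 'I_n}) : pdist (c * s)%g (c * t)%g = pdist s t.
Proof.
rewrite /pdist [RHS](reindex_inj (@perm_inj _ c)).
by apply: eq_bigr => x _; rewrite !permM.
Qed.

Lemma pdist_mulr n (c s t : {perm 'I_n}) : pdist (s * c)%g (t * c)%g = pdist s t.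
Proof. by apply: eq_bigr => x _; rewrite !permM (inj_eq perm_inj). Qed.

Definition pblock_fun m l (a : {perm 'I_m}) (b : {perm 'I_l}) (x : 'I_(m + l)) : 'I_(m + l) :=
  match fintype.split x with inl y => lshift l (a y) | inr y => rshift m (b y) end.

Lemma pblock_funL m l (a : {perm 'I_m}) (b : {perm 'I_l}) y :
  pblock_fun a b (lshift l y) = lshift l (a y).
Proof. by rewrite /pblock_fun; have := unsplitK (inl y : 'I_m + 'I_l) => /= ->. Qed.

Lemma pblock_funR m l (a : {perm 'I_m}) (b : {perm 'I_l}) y :
  pblock_fun a b (rshift m y) = rshift m (b y).
Proof. by rewrite /pblock_fun; have := unsplitK (inr y : 'I_m + 'I_l) => /= ->. Qed.

Fact pblock_inj m l (a : {perm 'I_m}) (b : {perm 'I_l}) : injective (pblock_fun a b).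
Proof.
apply: (can_inj (g := pblock_fun a^-1%g b^-1%g)) => x.
by case: (split_ordP x) => y ->; rewrite !(pblock_funL, pblock_funR) permK.
Qed.

Definition pblock m l (a : {perm 'I_m}) (b : {perm 'I_l}) : {perm 'I_(m + l)} :=
  perm (@pblock_inj m l a b).

Lemma pblockL m l (a : {perm 'I_m}) (b : {perm 'I_l}) y :
  pblock a b (lshift l y) = lshift l (a y).
Proof. by rewrite permE pblock_funL. Qed.

Lemma pblockR m l (a : {perm 'I_m}) (b : {perm 'I_l}) y :
  pblock a b (rshift m y) = rshift m (b y).
Proof. by rewrite permE pblock_funR. Qed.

Definition psum m l n (e : (m + l)%N = n) (a : {perm 'I_m}) (b : {perm 'I_l}) : {perm 'I_n} :=
  ecast k {perm 'I_k} e (pblock a b).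

Lemma psumM m l n (e : (m + l)%N = n) a a' b b' :
  psum e (a * a')%g (b * b')%g = (psum e a b * psum e a' b')%g.
Proof.
case: n / e; apply/permP => x /=; rewrite permM.
by case: (split_ordP x) => y ->; rewrite !(pblockL, pblockR) permM.
Qed.

Lemma pdist_psum m l n (e : (m + l)%N = n) a a' b b' :
  pdist (psum e a b) (psum e a' b') = (pdist a a' + pdist b b')%N.
Proof.
case: n / e; rewrite /pdist big_split_ord /=; congr (_ + _)%N; apply: eq_bigr => x _.
  by rewrite !pblockL (inj_eq (@lshift_inj _ _)).
by rewrite !pblockR (inj_eq (@rshift_inj _ _)).
Qed.

Lemma pblock_split m l (c : {perm 'I_(m + l)}) :
  (forall x, (c x < m)%N = (x < m)%N) -> exists a b, c = pblock a b.
Proof.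
move=> cm.
have /fin_all_exists[f fE] : forall y : 'I_m, exists z : 'I_m, c (lshift l y) = lshift l z.
  move=> y; have := cm (lshift l y).
  by case: (split_ordP (c (lshift l y))) => z -> h; [exists z|move: h (ltn_ord y) => /=; lia].
have /fin_all_exists[g gE] : forall y : 'I_l, exists z : 'I_l, c (rshift m y) = rshift m z.
  move=> y; have := cm (rshift m y).
  by case: (split_ordP (c (rshift m y))) => z -> h; [move: h (ltn_ord z) => /=; lia|exists z].
have fI : injective f.
  by move=> y z yz; apply: (@lshift_inj m l); apply: (@perm_inj _ c); rewrite !fE yz.
have gI : injective g.
  by move=> y z yz; apply: (@rshift_inj m l); apply: (@perm_inj _ c); rewrite !gE yz.
exists (perm fI), (perm gI); apply/permP => x.
by case: (split_ordP x) => y ->; rewrite ?pblockL ?pblockR permE.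
Qed.

(** Composing with the transposition of [c z] and [z] fixes [z] and changes at most two values. *)
Lemma fix_points n (a : {perm 'I_n}) (s : seq 'I_n) :
  exists c : {perm 'I_n}, (forall z, z \in s -> c z = z) /\ (pdist a c <= 2 * size s)%N.
Proof.
elim: s => [|z s [c [cs ac]]].
  by exists a; split=> //; rewrite leqn0; apply/eqP/pdist_eq0.
have [zs|zs] := boolP (z \in s).
  exists c; split=> [y|]; last by apply: leq_trans ac _; rewrite leq_mul2l /= leqnSn.
  by rewrite inE => /orP[/eqP->|]; apply: cs.
exists (c * tperm (c z) z)%g; split=> [y|].
  rewrite inE permM => /orP[/eqP->|ys]; first by rewrite tpermL.
  rewrite (cs y ys) tpermD //; last by apply: contraNneq zs => ->.
  by apply: contraNneq zs => E; rewrite (_ : z = y) //; apply: (@perm_inj _ c); rewrite E cs.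
apply: leq_trans (pdist_tri c _ _) _; rewrite /= mulnS addnC; apply: leq_add ac.
rewrite -[X in pdist X _]mulg1 pdist_mull /pdist.
apply: (@leq_trans (\sum_(x < n) ((x == c z) + (x == z)))%N).
  apply: leq_sum => x _; rewrite perm1.
  case: (eqVneq x (c z)) => [_|x1]; first by apply: leq_trans (leq_b1 _) _.
  case: (eqVneq x z) => [_|x2]; first by apply: leq_trans (leq_b1 _) _.
  by rewrite tpermD ?eqxx // eq_sym.
have one (a0 : 'I_n) : (\sum_x (x == a0) = 1)%N.
  by rewrite (bigD1 a0) //= eqxx big1 // => x /negbTE->.
by rewrite big_split /= !one.
Qed.

End PermSum.

(** * Point stabilizers as invariants of permutation actions *)

Section PermInvariants.
Implicit Types (m n l : nat) (H : finGroupType).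

Definition stab H n (a : H -> {perm 'I_n}) (y : 'I_n) : {set H} := [set h | a h y == y].

(** Transitive actions are classified by the conjugacy class of a stabilizer, so these counts
    determine the number of orbits of each kind. *)
Definition pnu H n (a : H -> {perm 'I_n}) (A : {set H}) : nat := (\sum_y (stab a y == A))%N.

Lemma pnu_le H n (a : H -> {perm 'I_n}) A : (pnu a A <= n)%N.
Proof.
apply: (@leq_trans (\sum_(x < n) 1)%N); last by rewrite sum1_card card_ord.
by apply: leq_sum => x _; apply: leq_b1.
Qed.

Lemma stab_conj H n (a : H -> {perm 'I_n}) u y :
  stab (fun h => u * a h * u^-1)%g y = stab a (u y).
Proof. by apply/setP => h; rewrite !inE !permM -(inj_eq (@perm_inj _ u)) permKV. Qed.

Lemma pnu_conj H n (a : H -> {perm 'I_n}) u A : pnu (fun h => u * a h * u^-1)%g A = pnu a A.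
Proof.
rewrite /pnu [RHS](reindex_inj (@perm_inj _ u)); apply: eq_bigr => y _.
by rewrite stab_conj.
Qed.

Lemma stab_pblockL H m l (a : H -> {perm 'I_m}) (b : H -> {perm 'I_l}) y :
  stab (fun h => pblock (a h) (b h)) (lshift l y) = stab a y.
Proof. by apply/setP => h; rewrite !inE pblockL (inj_eq (@lshift_inj _ _)). Qed.

Lemma stab_pblockR H m l (a : H -> {perm 'I_m}) (b : H -> {perm 'I_l}) y :
  stab (fun h => pblock (a h) (b h)) (rshift m y) = stab b y.
Proof. by apply/setP => h; rewrite !inE pblockR (inj_eq (@rshift_inj _ _)). Qed.

Lemma pnu_psum H m l n (e : (m + l)%N = n) (a : H -> {perm 'I_m}) (b : H -> {perm 'I_l}) A :
  pnu (fun h => psum e (a h) (b h)) A = (pnu a A + pnu b A)%N.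
Proof.
case: n / e; rewrite /pnu big_split_ord /=; congr (_ + _)%N; apply: eq_bigr => y _.
  by rewrite stab_pblockL.
by rewrite stab_pblockR.
Qed.

Lemma stab_neq_le H n (a b : H -> {perm 'I_n}) y :
  (stab a y != stab b y <= \sum_h (a h y != b h y))%N.
Proof.
case: eqP => // ne; rewrite lt0n sum_nat_eq0; apply/negP => /forallP /= E.
apply: ne; apply/setP => h; rewrite !inE.
by have := E h; rewrite eqb0 negbK => /eqP ->.
Qed.

Lemma sum_stab_neq_le H n (a b : H -> {perm 'I_n}) :
  (\sum_y (stab a y != stab b y) <= \sum_h pdist (a h) (b h))%N.
Proof.
rewrite exchange_big /=; apply: leq_sum => y _; exact: stab_neq_le.
Qed.

(** Permutations compose from left to right, so [a] is a right action; this fixes the side of the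
    conjugation. *)
Lemma stab_move H n (a : H -> {perm 'I_n}) : is_hom a -> forall h k y,
  (k \in stab a (a h y)) = ((h * k * h^-1)%g \in stab a y).
Proof.
move=> ha h k y; rewrite !inE !ha (is_homV ha) !permM.
by rewrite -(inj_eq (@perm_inj _ (a h)^-1%g)) permK.
Qed.

Lemma is_hom_id H n (a : H -> {perm 'I_n}) : is_hom a -> forall y, a 1%g y = y.
Proof. by move=> ha y; rewrite (_ : a 1%g = 1%g) ?perm1 //; apply: (@mulgI _ (a 1%g)); rewrite -ha !mulg1. Qed.

(** Makes the map from [a h x] to [b h y] between two orbits well defined and, by symmetry,
    injective. *)
Lemma eq_stab_orbit H n (a b : H -> {perm 'I_n}) x y : is_hom a -> is_hom b ->
  stab a x = stab b y -> forall h k, a h x = a k x -> b h y = b k y.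
Proof.
move=> ha hb E h k hk.
have : (h * k^-1)%g \in stab a x by rewrite inE ha (is_homV ha) permM hk permK.
by rewrite E inE hb (is_homV hb) permM -(inj_eq (@perm_inj _ (b k))) permKV => /eqP.
Qed.

(* Two actions of a finite group with equally many points of each stabilizer
   are isomorphic; the isomorphism is built orbit by orbit. *)
Lemma equal_stab_bijection H n (a b : H -> {perm 'I_n}) (X Y : {set 'I_n}) :
  is_hom a -> is_hom b ->
  (forall h x, x \in X -> a h x \in X) -> (forall h y, y \in Y -> b h y \in Y) ->
  (forall A, \sum_(x in X) (stab a x == A) = \sum_(y in Y) (stab b y == A))%N ->
  exists f : 'I_n -> 'I_n, [/\ forall x, x \in X -> f x \in Y,
    {in X &, injective f} & forall h x, x \in X -> f (a h x) = b h (f x)].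
Proof.
move=> ha hb; have [r] := ubnP #|X|; elim: r X Y => // r IH X Y rX aX bY XY.
have [X0|[x xX]] := set_0Vmem X.
  by exists id; split=> [x|x y|h x]; rewrite X0 inE.
have [y yY xy] : exists2 y, y \in Y & stab b y = stab a x.
  have : (0 < \sum_(y in Y) (stab b y == stab a x))%N by rewrite -XY (bigD1 x) //= eqxx.
  rewrite lt0n sum_nat_eq0 => /forallPn[y]; rewrite negb_imply eqb0 negbK => /andP[yY /eqP].
  by exists y.
have [a1 b1] := (is_hom_id ha, is_hom_id hb).
pose Ox := [set a h x | h in [set: H]]; pose Oy := [set b h y | h in [set: H]].
have OxX : Ox \subset X by apply/fintype.subsetP => _ /imsetP[h _ ->]; apply: aX.
have OyY : Oy \subset Y by apply/fintype.subsetP => _ /imsetP[h _ ->]; apply: bY.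
have [s sE] : exists s : 'I_n -> H, forall z, z \in Ox -> a (s z) x = z.
  have /fin_all_exists[s sE] : forall z, exists h, z \in Ox -> a h x = z.
    move=> z; have [/imsetP[h _ ->]|nz] := boolP (z \in Ox); first by exists h.
    by exists 1%g.
  by exists s.
have memOx h : a h x \in Ox by apply/imsetP; exists h.
have memOy h : b h y \in Oy by apply/imsetP; exists h.
pose g z := b (s z) y.
have gE h : g (a h x) = b h y.
  by apply: (eq_stab_orbit ha hb (esym xy)); rewrite sE.
have g_inj : {in Ox &, injective g}.
  move=> _ _ /imsetP[h _ ->] /imsetP[k _ ->]; rewrite !gE => E.
  exact: (eq_stab_orbit hb ha xy E).
have gO : g @: Ox = Oy.
  apply/setP => z; apply/imsetP/imsetP => [[_ /imsetP[h _ ->] ->]|[h _ ->]].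
    by exists h; rewrite ?gE.
  by exists (a h x); rewrite ?gE.
have stab_g z : z \in Ox -> stab b (g z) = stab a z.
  case/imsetP=> h _ ->; rewrite gE; apply/setP => k.
  by rewrite !stab_move // xy.
have [|||A|f [fY fI fE]] := IH (X :\: Ox) (Y :\: Oy).
- rewrite ltnS in rX; apply: leq_trans rX; apply: proper_card.
  rewrite properE subsetDl /=; apply/subsetPn; exists x => //.
  by rewrite !inE xX andbT negbK -{1}(a1 x).
- move=> h z; rewrite !inE => /andP[zO zX]; rewrite aX // andbT.
  apply: contra zO => /imsetP[k _ E]; apply/imsetP; exists (k * h^-1)%g => //.
  by rewrite ha (is_homV ha) permM -E permK.
- move=> h z; rewrite !inE => /andP[zO zY]; rewrite bY // andbT.
  apply: contra zO => /imsetP[k _ E]; apply/imsetP; exists (k * h^-1)%g => //.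
  by rewrite hb (is_homV hb) permM -E permK.
- have := XY A; rewrite (big_setID Ox) [RHS](big_setID Oy) /= (finset.setIidPr OxX) (finset.setIidPr OyY).
  have -> : (\sum_(z in Oy) (stab b z == A) = \sum_(z in Ox) (stab a z == A))%N.
    by rewrite -gO big_imset //=; apply: eq_bigr => z zO; rewrite stab_g.
  by move=> /eqP; rewrite eqn_add2l => /eqP.
exists (fun z => if z \in Ox then g z else f z); split.
- move=> z zX; case: ifP => zO; last by have := fY z; rewrite !inE zO zX => /(_ isT)/andP[].
  by apply: (fintype.subsetP OyY); rewrite -gO; apply/imsetP; exists z.
- move=> z w zX wX; case: ifP => zO; case: ifP => wO.
  + exact: g_inj.
  + move=> E; have := fY w; rewrite !inE wO wX -E => /(_ isT)/andP[/negP[]].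
    by rewrite -gO; apply/imsetP; exists z.
  + move=> E; have := fY z; rewrite !inE zO zX E => /(_ isT)/andP[/negP[]].
    by rewrite -gO; apply/imsetP; exists w.
  + by apply: fI; rewrite !inE ?zO ?wO.
- move=> h z zX; have -> : (a h z \in Ox) = (z \in Ox).
    apply/imsetP/imsetP => [[k _ E]|[k _ ->]].
      by exists (k * h^-1)%g => //; rewrite ha (is_homV ha) permM -E permK.
    by exists (k * h)%g => //; rewrite ha permM.
  case: ifP => zO; last by apply: fE; rewrite !inE zO.
  by case/imsetP: zO => k _ ->; rewrite gE -permM -ha gE hb permM.
Qed.

(** [t] is kept on the invariant set [X] where it intertwines exactly. It matches stabilizers there,
    so equal counts remain on the complements, where any isomorphism will do. *)
Lemma pnu_conjugacy H n (a b : H -> {perm 'I_n}) (t : {perm 'I_n}) :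
  is_hom a -> is_hom b -> pnu a =1 pnu b ->
  exists2 t', (forall h, t' * b h = a h * t')%g &
    (pdist t t' <= \sum_h pdist (t * b h)%g (a h * t)%g)%N.
Proof.
move=> ha hb ab; pose X := [set x | [forall h, t (a h x) == b h (t x)]].
have XP x : reflect (forall h, t (a h x) = b h (t x)) (x \in X).
  by rewrite inE; apply: (iffP forallP) => h k; apply/eqP/h.
have aX h x : x \in X -> a h x \in X.
  by move=> /XP xX; apply/XP => k; rewrite -permM -ha xX hb permM xX.
pose Y := t @: X.
have bY h y : y \in Y -> b h y \in Y.
  case/imsetP=> x xX ->; rewrite -(XP _ xX h); apply/imsetP; exists (a h x) => //; exact: aX.
have [|||f [fY fI fE]] := @equal_stab_bijection H n a b (~: X) (~: Y) ha hb.
- move=> h x; rewrite !inE; apply: contra => ahx.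
  have := aX h^-1%g (a h x); rewrite inE (is_homV ha) permK inE; exact.
- move=> h y; rewrite !finset.in_setC; apply: contra => /(bY h^-1%g).
  by rewrite (is_homV hb) permK.
- move=> A; have := ab A; rewrite /pnu (bigID (mem X)) [RHS](bigID (mem Y)) /=.
  rewrite (_ : \sum_(i | i \in Y) _ = \sum_(i in X) (stab a i == A))%N.
    move=> /eqP; rewrite eqn_add2l => /eqP E.
    by rewrite (eq_bigl (fun x => x \notin X)) ?E => [|x]; [apply: eq_bigl => x|]; rewrite finset.in_setC.
  rewrite big_imset /=; last by move=> x y _ _; apply: perm_inj.
  apply: eq_bigr => x /XP xX; congr (nat_of_bool (_ == _)); apply/setP => h.
  by rewrite !inE -xX (inj_eq perm_inj).
pose g x := if x \in X then t x else f x.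
have g_inj : injective g.
  move=> x y; rewrite /g; case: ifP => xX; case: ifP => yX.
  + exact: perm_inj.
  + move=> E; have := fY y; rewrite !finset.in_setC yX -E => /(_ isT)/negP[].
    by apply/imsetP; exists x.
  + move=> E; have := fY x; rewrite !finset.in_setC xX E => /(_ isT)/negP[].
    by apply/imsetP; exists y.
  + by apply: fI; rewrite finset.in_setC ?xX ?yX.
exists (perm g_inj) => [h|].
  apply/permP => x; rewrite !permM !permE /g.
  have -> : (a h x \in X) = (x \in X).
    by apply/idP/idP => [/(aX h^-1%g)|/aX //]; rewrite (is_homV ha) permK.
  case: ifP => xX; first by rewrite (XP _ xX).
  by rewrite fE // finset.in_setC xX.
rewrite exchange_big /=; apply: leq_sum => x _; rewrite permE /g.
case: (boolP (x \in X)) => [_|nx]; first by rewrite eqxx.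
apply: leq_trans (leq_b1 _) _; rewrite lt0n sum_nat_eq0; apply: contra nx => /forallP E.
by apply/XP => h; have := E h; rewrite /= eqb0 negbK !permM => /eqP.
Qed.

End PermInvariants.

(** * The symmetric groups as a block system *)

Section PermSystem.
Variable R : realType.

Definition permD n (s t : {perm 'I_n}) : R := (pdist s t)%:R.

Lemma permD_eq0 n (s t : {perm 'I_n}) : permD s t = 0 <-> s = t.
Proof.
split=> [/eqP|/pdist_eq0]; last by rewrite /permD => ->.
by rewrite pnatr_eq0 => /eqP/pdist_eq0.
Qed.

Lemma permD_ge0 n (s t : {perm 'I_n}) : 0 <= permD s t. Proof. exact: ler0n. Qed.

Lemma permD_sym n (s t : {perm 'I_n}) : permD s t = permD t s.
Proof. by rewrite /permD pdist_sym. Qed.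

Lemma permD_tri n (t s u : {perm 'I_n}) : permD s u <= 2 * (permD s t + permD t u).
Proof.
rewrite -natrD -natrM ler_nat mul2n -addnn; apply: leq_trans (pdist_tri t s u) _.
exact: leq_addr.
Qed.

Lemma permD_le n (s t : {perm 'I_n}) : permD s t <= 4 * n%:R.
Proof. by rewrite -natrM ler_nat; apply: leq_trans (pdist_le _ _) _; rewrite leq_pmull. Qed.

Lemma permD_mull n (c s t : {perm 'I_n}) : permD (c * s)%g (c * t)%g = permD s t.
Proof. by rewrite /permD pdist_mull. Qed.

Lemma permD_mulr n (c s t : {perm 'I_n}) : permD (s * c)%g (t * c)%g = permD s t.
Proof. by rewrite /permD pdist_mulr. Qed.

Lemma permD_psum m l n (e : (m + l)%N = n) a a' b b' :
  permD (psum e a b) (psum e a' b') = permD a a' + permD b b'.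
Proof. by rewrite /permD pdist_psum natrD. Qed.

(** Make the last [l] points fixed, at a cost of two per point, and restrict to the others. *)
Lemma perm_cut m l n (e : (m + l)%N = n) (a : {perm 'I_n}) :
  exists b, permD a (psum e b 1%g) <= 8 * l%:R.
Proof.
case: n / e a => a; have [c [cf ac]] := fix_points a [seq rshift m y | y <- enum 'I_l].
have {}cf y : c (rshift m y) = rshift m y by apply: cf; rewrite map_f // mem_enum.
have [x|b [b' cE]] := @pblock_split m l c.
  case: (split_ordP x) => y ->; last first.
    by rewrite cf; apply/negbTE; rewrite -leqNgt leq_addr.
  case: (split_ordP (c (lshift l y))) => // z E.
  have : lshift l y = rshift m z by apply: (@perm_inj _ c); rewrite cf.
  by move/eqP; rewrite eq_lrshift.
have b'1 : b' = 1%g.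
  apply/permP => y; apply: (@rshift_inj m l); rewrite -[LHS](pblockR b b') -cE cf perm1 //.
exists b; rewrite /= -b'1 -cE -natrM ler_nat; apply: leq_trans ac _.
by rewrite size_map -cardE card_ord leq_mul2r orbT.
Qed.

(** The stabilizer of a point changes only if some element of [H] moves it differently. *)
Lemma pnu_lip (H : finGroupType) (e : R) : 0 < e -> exists2 d, 0 < d &
  forall n (a b : H -> {perm 'I_n}), is_hom a -> is_hom b ->
  (forall h, permD (a h) (b h) <= d * n%:R) ->
  forall j, (pnu a j)%:R <= (pnu b j)%:R + e * n%:R :> R.
Proof.
move=> e0; have H0 : 0 < #|H|%:R :> R by rewrite ltr0n; apply/card_gt0P; exists 1%g.
exists (e / #|H|%:R) => [|n a b _ _ near j]; first exact: divr_gt0.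
apply: (@le_trans _ _ ((pnu b j)%:R + (\sum_h pdist (a h) (b h))%N%:R)).
  rewrite -natrD ler_nat; apply: leq_trans (leq_add (leqnn _) (sum_stab_neq_le _ _)).
  rewrite -big_split; apply: leq_sum => y _ /=.
  by case: (eqVneq (stab a y) (stab b y)) => [->|_]; rewrite ?leq_addr // addn1; apply: leq_trans (leq_b1 _) _.
rewrite lerD2l natr_sum; apply: le_trans (ler_sum _ (fun h _ => near h)) _.
by rewrite sumr_const -[leLHS]mulr_natr mulrAC divfK // gt_eqF.
Qed.

Lemma permD_conjugacy (H : finGroupType) (e : R) : 0 < e -> exists2 d, 0 < d &
  forall n (a b : H -> {perm 'I_n}) t, is_hom a -> is_hom b -> pnu a =1 pnu b ->
  (forall h, permD (t * b h)%g (a h * t)%g <= d * n%:R) ->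
  exists2 t', (forall h, t' * b h = a h * t')%g & permD t t' <= e * n%:R.
Proof.
move=> e0; have H0 : 0 < #|H|%:R :> R by rewrite ltr0n; apply/card_gt0P; exists 1%g.
exists (e / #|H|%:R) => [|n a b t ha hb ab near]; first exact: divr_gt0.
have [t' t'E D] := pnu_conjugacy t ha hb ab; exists t' => //.
apply: (@le_trans _ _ (\sum_h pdist (t * b h)%g (a h * t)%g)%N%:R); first by rewrite ler_nat.
rewrite natr_sum; apply: le_trans (ler_sum _ (fun h _ => near h)) _.
by rewrite sumr_const -[leLHS]mulr_natr mulrAC divfK // gt_eqF.
Qed.

Definition perm_system : block_system R := {|
  bgrp := fun n => {perm 'I_n};
  bD := permD;
  bsum := psum;
  bD_eq0 := permD_eq0;
  bD_ge0 := permD_ge0;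
  bD_sym := permD_sym;
  bD_tri := permD_tri;
  bD_le := permD_le;
  bD_mull := permD_mull;
  bD_mulr := permD_mulr;
  bsumM := psumM;
  bD_bsum := permD_psum;
  bcut := perm_cut;
  bidx := fun H => {set H} : finType;
  bnu := pnu;
  bnu_le := fun H n a j _ => pnu_le a j;
  bnu_conj := fun H n a u j _ => pnu_conj a u j;
  bnu_bsum := fun H m l n e a b j _ _ => pnu_psum e a b j;
  bnu_lip := pnu_lip;
  bnu_conjugacy := permD_conjugacy
|}.

End PermSystem.

(** * Types of permutation actions *)

Section PermTypes.
Variables (R : realType) (G : groupType) (H : finGroupType) (i : bool -> H -> G).
Hypothesis hom_i : forall k, is_hom (i k).
Hypothesis inj_i : forall k, injective (i k).
Hypothesis normal_i : forall k g h, exists h', i k h' = (g * i k h * g^-1)%g.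
Local Notation S := (perm_system R).

Definition twist k g h : H := sval (cid (normal_i k g h)).

Lemma twistE k g h : i k (twist k g h) = (g * i k h * g^-1)%g.
Proof. exact: (svalP (cid (normal_i k g h))). Qed.

Lemma twistM k g g' h : twist k (g * g')%g h = twist k g (twist k g' h).
Proof. by apply: (inj_i (k := k)); rewrite !twistE invgM !mulgA. Qed.

Lemma twist1 k h : twist k 1%g h = h.
Proof. by apply: (inj_i (k := k)); rewrite twistE mul1g invg1 mulg1. Qed.

(** A preimage rather than an image, because [psi] is a right action; see [stab_tpre]. *)
Definition tpre k g (A : {set H}) : {set H} := [set h | twist k g h \in A].

Lemma tpreM k g g' A : tpre k g' (tpre k g A) = tpre k (g * g')%g A.
Proof. by apply/setP => h; rewrite !inE twistM. Qed.

Lemma tpre1 k A : tpre k 1%g A = A.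
Proof. by apply/setP => h; rewrite inE twist1. Qed.

Lemma tpre_inj k g : injective (tpre k g).
Proof. by move=> A B E; rewrite -(tpre1 k A) -(tpre1 k B) -(mulgV g) -!tpreM E. Qed.

Definition tclass k (A : {set H}) : {set {set H}} := [set B | `[< exists g, B = tpre k g A >]].

Lemma tclassP k A B : (B \in tclass k A) <-> exists g, B = tpre k g A.
Proof. by rewrite inE; split => [/asboolP|h]; last apply/asboolP. Qed.

Lemma tclass_refl k A : A \in tclass k A.
Proof. by apply/tclassP; exists 1%g; rewrite tpre1. Qed.

Lemma tclass_tpre k g A : tclass k (tpre k g A) = tclass k A.
Proof.
apply/setP => B; apply/idP/idP => /tclassP[g' ->]; apply/tclassP.
  by exists (g * g')%g; rewrite tpreM.
by exists (g^-1 * g')%g; rewrite tpreM mulgA mulgV mul1g.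
Qed.

Lemma stab_tpre k n (psi : G -> {perm 'I_n}) g y : is_hom psi ->
  stab (psi \o i k) (psi g y) = tpre k g (stab (psi \o i k) y).
Proof.
move=> hp; apply/setP => h; rewrite !inE /= twistE !hp !permM (is_homV hp).
by rewrite -(inj_eq (@perm_inj _ (psi g)^-1%g)) permK.
Qed.

(** A finite type containing all pairs of classes; pairs that do not occur have size 0. *)
Definition ptype : finType := ({set {set H}} * {set {set H}})%type.

Definition pt_of n (psi : G -> {perm 'I_n}) y : ptype :=
  (tclass false (stab (psi \o i false) y), tclass true (stab (psi \o i true) y)).

Definition pnt n (psi : G -> {perm 'I_n}) (tau : ptype) : nat := (\sum_y (pt_of psi y == tau))%N.

Lemma pt_of_move n (psi : G -> {perm 'I_n}) g y : is_hom psi -> pt_of psi (psi g y) = pt_of psi y.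
Proof. by move=> hp; rewrite /pt_of !stab_tpre // !tclass_tpre. Qed.

Lemma pnt_sum n (psi : G -> {perm 'I_n}) : (\sum_tau pnt psi tau = n)%N.
Proof.
rewrite exchange_big /= -[RHS]card_ord -sum1_card; apply: eq_bigr => y _.
by rewrite (bigD1 (pt_of psi y)) //= eqxx big1 // => tau; rewrite eq_sym => /negbTE->.
Qed.

Lemma pnt_conj n (psi : G -> {perm 'I_n}) u tau :
  pnt (fun g => u * psi g * u^-1)%g tau = pnt psi tau.
Proof.
rewrite /pnt [RHS](reindex_inj (@perm_inj _ u)); apply: eq_bigr => y _.
by rewrite /pt_of -!(stab_conj _ u).
Qed.

Lemma pnt_psum m l n (e : (m + l = n)%N) (psi : G -> {perm 'I_m}) (psi' : G -> {perm 'I_l}) tau :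
  pnt (fun g => psum e (psi g) (psi' g)) tau = (pnt psi tau + pnt psi' tau)%N.
Proof.
case: n / e; rewrite /pnt big_split_ord /=; congr (_ + _)%N; apply: eq_bigr => y _.
  by rewrite /pt_of !(@stab_pblockL H m l (fun h => psi (i _ h)) (fun h => psi' (i _ h))).
by rewrite /pt_of !(@stab_pblockR H m l (fun h => psi (i _ h)) (fun h => psi' (i _ h))).
Qed.

Lemma pnt_lip (e : R) : 0 < e -> exists2 d, 0 < d &
  forall n (psi psi' : G -> {perm 'I_n}), is_hom psi -> is_hom psi' ->
  (forall k h, permD R (psi (i k h)) (psi' (i k h)) <= d * n%:R) ->
  forall tau, (pnt psi tau)%:R <= (pnt psi' tau)%:R + e * n%:R :> R.
Proof.
move=> e0; have H0 : 0 < #|H|%:R :> R by rewrite ltr0n; apply/card_gt0P; exists 1%g.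
exists (e / 2 / #|H|%:R) => [|n psi psi' _ _ near tau]; first by rewrite !divr_gt0.
pose s k := (\sum_h pdist (psi (i k h)) (psi' (i k h)))%N.
have sE k : (s k)%:R <= e / 2 * n%:R :> R.
  rewrite natr_sum; apply: le_trans (ler_sum _ (fun h _ => near k h)) _.
  by rewrite sumr_const -[leLHS]mulr_natr mulrAC divfK // gt_eqF.
apply: (@le_trans _ _ ((pnt psi' tau)%:R + (s false + s true)%N%:R)); last first.
  by rewrite lerD2l natrD; have := sE false; have := sE true; clear; lra.
rewrite -natrD ler_nat; apply: leq_trans (leq_add (leqnn _) (leq_add
  (sum_stab_neq_le (psi \o i false) (psi' \o i false))
  (sum_stab_neq_le (psi \o i true) (psi' \o i true)))).
rewrite -!big_split; apply: leq_sum => y _ /=.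
have [e1|] := eqVneq (stab (psi \o i false) y) (stab (psi' \o i false) y); last first.
  by move=> _; apply: leq_trans (leq_b1 _) _; rewrite addnA addnAC addn1.
have [e2|] := eqVneq (stab (psi \o i true) y) (stab (psi' \o i true) y); last first.
  by move=> _; apply: leq_trans (leq_b1 _) _; rewrite addnA addn1.
by rewrite /pt_of e1 e2 leq_addr.
Qed.

Lemma perm_onto m l (Y : {set 'I_(m + l)}) : #|Y| = m ->
  exists u : {perm 'I_(m + l)}, forall y, (u y < m)%N = (y \in Y).
Proof.
move=> cY; pose r := enum Y ++ enum (~: Y).
have memr y : y \in r by rewrite mem_cat !mem_enum inE orbN.
have sr : size r = (m + l)%N.
  rewrite size_cat -!cardE cY; congr (_ + _)%N.
  by apply/eqP; rewrite -(eqn_add2l #|Y|) cardsC card_ord cY.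
have lt_r y : (index y r < m + l)%N by have := memr y; rewrite -index_mem sr.
have inj_u : injective (fun y => Ordinal (lt_r y)).
  by move=> y z /(congr1 val) /= E; rewrite -(nth_index y (memr y)) E nth_index.
exists (perm inj_u) => y; rewrite permE /= index_cat mem_enum.
have sY : size (enum Y) = m by rewrite -cardE.
case: ifP => yY; last by apply/negbTE; rewrite sY -leqNgt leq_addr.
by have := yY; rewrite -mem_enum -index_mem sY.
Qed.

Lemma invariant_split m l n (e : (m + l)%N = n) (Y : {set 'I_n}) (psi : G -> {perm 'I_n}) :
  #|Y| = m -> (forall g y, (psi g y \in Y) = (y \in Y)) ->
  exists (u : {perm 'I_n}) (p1 : G -> {perm 'I_m}) (p2 : G -> {perm 'I_l}),
    psi = (fun g => u * psum e (p1 g) (p2 g) * u^-1)%g /\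
    forall z, exists2 y, y \in Y & pt_of p1 z = pt_of psi y.
Proof.
case: n / e Y psi => Y psi cY invY; have [u uY] := perm_onto cY.
have split_psi g : exists ab : {perm 'I_m} * {perm 'I_l}, (u^-1 * psi g * u)%g = pblock ab.1 ab.2.
  have [x|a [b E]] := @pblock_split m l (u^-1 * psi g * u)%g; last by exists (a, b).
  by rewrite !permM uY invY -uY permKV.
pose p1 g := (sval (cid (split_psi g))).1; pose p2 g := (sval (cid (split_psi g))).2.
have psiE : psi = (fun g => u * pblock (p1 g) (p2 g) * u^-1)%g.
  apply/funext => g; rewrite /= -(svalP (cid (split_psi g))).
  by rewrite !mulgA mulgV mul1g mulgK.
exists u, p1, p2; split=> // z; exists (u^-1 (lshift l z))%g.
  by rewrite -uY permKV /=.
rewrite /pt_of psiE !(stab_conj (fun h => pblock (p1 (i _ h)) (p2 (i _ h))) u) permKV.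
by rewrite !(@stab_pblockL H m l (fun h => p1 (i _ h)) (fun h => p2 (i _ h))).
Qed.

Lemma pnt_card n (psi : G -> {perm 'I_n}) tau : pnt psi tau = #|[set y | pt_of psi y == tau]|.
Proof. by rewrite /pnt -sum1dep_card [RHS]big_mkcond; apply: eq_bigr => y _; case: eqP. Qed.

Lemma pnt_split n (psi : G -> S n) tau : is_hom psi ->
  exists l (e : (pnt psi tau + l = n)%N) u (psi1 : G -> S (pnt psi tau)) (psi2 : G -> S l),
  [/\ is_hom psi1, is_hom psi2, pnt psi1 tau = pnt psi tau &
      psi = fun g => (u * bsum e (psi1 g) (psi2 g) * u^-1)%g].
Proof.
move=> hp; pose Y := [set y | pt_of psi y == tau].
have cY : #|Y| = pnt psi tau by rewrite pnt_card.
have le_n : (pnt psi tau <= n)%N.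
  by rewrite -{2}(pnt_sum psi) (bigD1 tau) //= leq_addr.
have e := subnKC le_n.
have invY g y : (psi g y \in Y) = (y \in Y) by rewrite !inE pt_of_move.
have [u [p1 [p2 [psiE ptE]]]] := invariant_split e cY invY.
have hh : is_hom (fun g => u * bsum (b0 := S) e (p1 g) (p2 g) * u^-1)%g by rewrite -psiE.
have [h1 h2] := @is_hom_split R S G _ _ _ e u p1 p2 hh.
exists _, e, u, p1, p2; split=> //.
rewrite -[RHS]card_ord -sum1_card; apply: eq_bigr => z _.
by have [y] := ptE z; rewrite inE => /eqP yt ->; rewrite yt eqxx.
Qed.

(** [G] permutes the members of the class [T] transitively, so each is the stabilizer of equally
    many points and [n] is shared out evenly. *)
Lemma pnu_pure n (psi : G -> {perm 'I_n}) tau k A : is_hom psi -> pnt psi tau = n ->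
  let T := if k then tau.2 else tau.1 in
  (A \notin T -> pnu (psi \o i k) A = 0%N) /\
  (A \in T -> pnu (psi \o i k) A * #|T| = n)%N.
Proof.
move=> hp pn T.
have tyE y : tclass k (stab (psi \o i k) y) = T.
  have : pt_of psi y == tau.
    apply: contraT => ny; suff : (pnt psi tau < n)%N by rewrite pn ltnn.
    rewrite -[X in (_ < X)%N]card_ord -sum1_card /pnt (bigD1 y) //= [X in (_ < X)%N](bigD1 y) //=.
    rewrite (negbTE ny) add0n add1n ltnS; apply: leq_sum => z _; exact: leq_b1.
  by rewrite /T => /eqP <-; case: (k).
have nuT B : B \notin T -> pnu (psi \o i k) B = 0%N.
  move=> BT; apply: big1 => y _; case: eqP => // E.
  by move: BT; rewrite -(tyE y) -E tclass_refl.
split=> [|AT]; first exact: nuT.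
(* Without points [T] need not be a class at all, but both sides are 0. *)
have [y0|y0] := set_0Vmem [set: 'I_n].
  have n0 : n = 0%N by rewrite -[LHS]card_ord -cardsT y0 cards0.
  by rewrite [pnu _ _]big1 ?n0 // => y; have := finset.in_setT y; rewrite y0 inE.
have {y0} [y _] := y0.
have nuE B : B \in T -> pnu (psi \o i k) B = pnu (psi \o i k) A.
  move: AT; rewrite -(tyE y) => /tclassP[g1 E1] /tclassP[g2 E2].
  have -> : B = tpre k (g1^-1 * g2)%g A by rewrite E1 E2 tpreM mulgA mulgV mul1g.
  rewrite /pnu (reindex_inj (@perm_inj _ (psi (g1^-1 * g2)%g))); apply: eq_bigr => z _.
  by rewrite stab_tpre // (inj_eq (@tpre_inj _ _)).
rewrite mulnC -sum_nat_const -(eq_bigr _ nuE) exchange_big /=.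
rewrite -[RHS]card_ord -sum1_card; apply: eq_bigr => z _.
rewrite (bigD1 (stab (psi \o i k) z)) /=; last by rewrite -(tyE z) tclass_refl.
by rewrite eqxx big1 // => B /andP[_]; rewrite eq_sym => /negbTE->.
Qed.

Lemma pnt_prop n n' (psi : G -> {perm 'I_n}) (psi' : G -> {perm 'I_n'}) tau k j :
  is_hom psi -> is_hom psi' -> pnt psi tau = n -> pnt psi' tau = n' ->
  (pnu (psi \o i k) j * n' = pnu (psi' \o i k) j * n)%N.
Proof.
move=> h1 h2 p1 p2; have [] := pnu_pure k j h1 p1; have [] := pnu_pure k j h2 p2.
set T := if k then _ else _; have [jT|jT] := boolP (j \in T); last first.
  by move=> /(_ isT)-> _ /(_ isT)->.
move=> _ /(_ isT) E2 _ /(_ isT) E1; apply/eqP.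
have T0 : (0 < #|T|)%N by apply/card_gt0P; exists j.
by rewrite -(eqn_pmul2r T0) mulnAC E1 mulnAC E2 mulnC.
Qed.

Definition perm_types : type_theory S i := {|
  gtype := ptype;
  nt := pnt : forall n, (G -> S n) -> ptype -> nat;
  nt_sum := fun n psi _ => pnt_sum psi;
  nt_conj := fun n psi u tau _ => pnt_conj psi u tau;
  nt_bsum := fun m l n e psi psi' tau _ _ => pnt_psum e psi psi' tau;
  nt_lip := pnt_lip;
  nt_split := pnt_split;
  nt_prop := pnt_prop
|}.

End PermTypes.

(** * HNN extensions *)

Local Open Scope quotient_scope.

Section HNNExtension.
Variables (G H : groupType) (i1 i2 : H -> G).
Local Notation Z := (Algebra.to_multiplicative int).
Local Notation FP := (free_prod G Z).
Local Notation E := (hnn i1 i2).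
Local Open Scope group_scope.

Definition hnn_in (g : G) : E := pi_nc (hnn_relators i1 i2) (@fp_inl G Z g).
Definition hnn_t : E := pi_nc (hnn_relators i1 i2) (stable_letter G).

Lemma fp_inl_hom : is_hom (@fp_inl G Z). Proof. exact: fp_inl_mul. Qed.
Lemma fp_inr_hom : is_hom (@fp_inr G Z). Proof. exact: fp_inr_mul. Qed.
Lemma pi_hom : is_hom (@pi_nc FP (hnn_relators i1 i2)). Proof. exact: pi_nc_mul. Qed.

Lemma hnn_in_hom : is_hom hnn_in.
Proof. by move=> x y; rewrite /hnn_in fp_inl_hom pi_hom. Qed.

Lemma hnn_relation h : hnn_in (i1 h) * hnn_t = hnn_t * hnn_in (i2 h).
Proof.
have : pi_nc (hnn_relators i1 i2) 1 =
    pi_nc (hnn_relators i1 i2) ((fp_inl Z (i1 h))^-1 * stable_letter G * fp_inl Z (i2 h) * (stable_letter G)^-1).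
  apply/eqP/pi_nc_eqP; rewrite invg1 mul1g => A [NA subA].
  by apply: subA; exists h.
rewrite !pi_hom !(is_homV pi_hom) -/hnn_t -!/(hnn_in _) => E1.
have p1 : pi_nc (hnn_relators i1 i2) 1 = 1.
  by apply: (@mulgI _ (pi_nc (hnn_relators i1 i2) 1)); rewrite -pi_hom !mulg1.
apply: (@mulgI _ (hnn_in (i1 h))^-1); rewrite mulKg.
by apply: (@mulIg _ hnn_t^-1); rewrite mulgV -p1 E1 !mulgA.
Qed.

Lemma fp_class_cat (u v : seq (G + Z)) : fp_class (u ++ v) = fp_class u * fp_class v.
Proof.
apply/esym/eqP/fp_classP.
have repr_class (w : seq (G + Z)) : fp_cong (repr (fp_class w)) w.
  by apply/fp_classP; rewrite /fp_class reprK.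
by apply: fp_cat; apply: repr_class.
Qed.

Lemma hnn_generated (A : set E) : is_subgroup A ->
  (forall g, A (hnn_in g)) -> A hnn_t -> forall x, A x.
Proof.
move=> [A1 AM AV] Ain At x.
have -> : x = pi_nc (hnn_relators i1 i2) (repr x) by rewrite /pi_nc reprK.
have -> : repr x = fp_class (repr (repr x)) by rewrite /fp_class reprK.
have p1 : pi_nc (hnn_relators i1 i2) 1 = 1.
  by apply: (@mulgI _ (pi_nc (hnn_relators i1 i2) 1)); rewrite -pi_hom !mulg1.
elim: (repr (repr x)) => [|l u IH].
  by have -> : fp_class [::] = 1 :> FP by []; rewrite p1.
rewrite -cat1s fp_class_cat pi_hom; apply: (AM _ _) => {IH}//.
case: l => [g|z]; first exact: Ain.
have An (k : nat) : A (pi_nc (hnn_relators i1 i2) (fp_class [:: inr (Posz k : Z)])).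
  elim: k => [|k IH].
    have -> : fp_class [:: inr (Posz 0 : Z)] = 1 :> FP by apply/eqP/fp_classP/fp_oner.
    by rewrite p1.
  have -> : fp_class [:: inr (Posz k.+1 : Z)] = stable_letter G * fp_inr G (Posz k : Z).
    by rewrite -fp_inr_hom /fp_inr; congr (fp_class [:: inr _]); rewrite -addn1 PoszD addrC.
  by rewrite pi_hom; apply: (AM _ _).
case: z => k; first exact: An.
have -> : fp_class [:: inr (Negz k : Z)] = (fp_inr G (Posz k.+1 : Z))^-1.
  by rewrite -(is_homV fp_inr_hom).
by rewrite (is_homV pi_hom); apply/AV/An.
Qed.

Section UniversalProperty.
Variables (K : groupType) (f : G -> K) (t : K).
Hypothesis hom_f : is_hom f.
Hypothesis ft : forall h, f (i1 h) * t = t * f (i2 h).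

Definition zpow (z : Z) : K :=
  match (z : int) with Posz n => t ^+ n | Negz n => t ^- n.+1 end.

Lemma zpow_succ (z : int) : zpow (z + 1)%R = zpow z * t.
Proof.
case: z => [n|[|n]]; first by rewrite -PoszD /= addn1 expgSr.
  by rewrite /= expg1 mulVg.
have -> : (Negz n.+1 + 1 = Negz n)%R by rewrite !NegzE -[n.+2]addn1 PoszD; ring.
by rewrite /= [t ^+ n.+2]expgS invgM mulgKV.
Qed.

Lemma zpow_hom : is_hom zpow.
Proof.
move=> x y; change (zpow ((x : int) + (y : int))%R = zpow x * zpow y).
have posE (n : nat) (z : int) : zpow (z + n%:Z)%R = zpow z * t ^+ n.
  elim: n z => [|n IH] z; first by rewrite addr0 mulg1.
  by rewrite -addn1 PoszD addrA zpow_succ IH addn1 expgSr mulgA.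
case: y => n; first exact: posE.
apply: (@mulIg _ (t ^+ n.+1)); rewrite -posE.
by rewrite NegzE subrK /= mulgKV.
Qed.

Definition letter_eval (l : G + Z) : K := match l with inl g => f g | inr z => zpow z end.
Definition word_eval (u : seq (G + Z)) : K := foldr (fun l x => letter_eval l * x) 1 u.

Lemma word_eval_cat u v : word_eval (u ++ v) = word_eval u * word_eval v.
Proof. by elim: u => [|l u IH]; rewrite /= ?mul1g // IH mulgA. Qed.

Lemma hom_f1 : f 1 = 1.
Proof. by apply: (@mulgI _ (f 1)); rewrite -hom_f !mulg1. Qed.

Lemma word_eval_cong u v : fp_cong u v -> word_eval u = word_eval v.
Proof.
elim=> {u v} //=.
- by move=> u v w _ -> _ ->.
- by move=> u u' v v' _ E1 _ E2; rewrite !word_eval_cat E1 E2.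
- by move=> x y; rewrite hom_f !mulg1.
- by move=> x y; rewrite zpow_hom !mulg1.
- by rewrite hom_f1 mulg1.
- by rewrite mulg1.
Qed.

Definition fp_eval (a : FP) : K := word_eval (repr a).

Lemma fp_eval_class u : fp_eval (fp_class u) = word_eval u.
Proof. by apply: word_eval_cong; apply/fp_classP; rewrite /fp_class reprK. Qed.

Lemma fp_eval_hom : is_hom fp_eval.
Proof.
move=> a b; have [Ea Eb] : a = fp_class (repr a) /\ b = fp_class (repr b).
  by rewrite /fp_class !reprK.
by rewrite {1}Ea {1}Eb -fp_class_cat fp_eval_class word_eval_cat.
Qed.

Lemma fp_eval_inl g : fp_eval (fp_inl Z g) = f g.
Proof. by rewrite fp_eval_class /= mulg1. Qed.

Lemma fp_eval_t : fp_eval (stable_letter G) = t.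
Proof. by rewrite fp_eval_class /= mulg1. Qed.

Lemma fp_eval_closure x : normal_closure (hnn_relators i1 i2) x -> fp_eval x = 1.
Proof.
have e1 : fp_eval 1 = 1 by apply: (@mulgI _ (fp_eval 1)); rewrite -fp_eval_hom !mulg1.
apply: (_ : normal_closure _ `<=` [set y | fp_eval y = 1])%classic.
apply: smallest_sub.
  split; first split=> //.
  - by move=> y z /= Ey Ez; rewrite fp_eval_hom Ey Ez mulg1.
  - by move=> y /= Ey; rewrite (is_homV fp_eval_hom) Ey invg1.
  by move=> g y /= Ey; rewrite !fp_eval_hom (is_homV fp_eval_hom) Ey mulg1 mulgV.
move=> _ [h _ <-] /=.
rewrite !fp_eval_hom !(is_homV fp_eval_hom) !fp_eval_inl !fp_eval_t.
by rewrite -!mulgA (mulgA t) -ft !mulgA mulVg mul1g mulgV.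
Qed.

(** Evaluation of words kills the relators, hence their normal closure, so its value at a
    representative depends on the coset only. *)
Lemma hnn_lift : exists F : E -> K, [/\ is_hom F, forall g, F (hnn_in g) = f g & F hnn_t = t].
Proof.
have piE x y : pi_nc (hnn_relators i1 i2) x = pi_nc (hnn_relators i1 i2) y -> fp_eval x = fp_eval y.
  move/eqP/pi_nc_eqP/fp_eval_closure; rewrite fp_eval_hom (is_homV fp_eval_hom) => xy.
  by apply: (@mulgI _ (fp_eval x)^-1); rewrite xy mulVg.
have reprE x : fp_eval (repr (pi_nc (hnn_relators i1 i2) x)) = fp_eval x.
  by apply: piE; rewrite /pi_nc reprK.
exists (fun a => fp_eval (repr a)); split=> [a b|g|]; rewrite ?reprE ?fp_eval_inl ?fp_eval_t //.
exact: fp_eval_hom.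
Qed.

End UniversalProperty.
End HNNExtension.

(** * Stability in block systems and its passage to the HNN extension *)

Section SystemStability.
Variables (R : realType) (S : block_system R).

(** Written without division, so that size 0 needs no separate treatment. *)
Definition negligible (X : nat -> nat) (u : nat -> R) : Prop :=
  forall e : R, 0 < e -> exists N, forall n, (N <= n)%N -> u n <= e * (X n)%:R.

Definition system_stable (G : groupType) : Prop :=
  forall (X : nat -> nat) (phi : forall n, G -> S (X n)),
    (forall g h, negligible X (fun n => bD (phi n g * phi n h)%g (phi n (g * h)%g))) ->
    exists2 psi : forall n, G -> S (X n), forall n, is_hom (psi n) &
      forall g, negligible X (fun n => bD (phi n g) (psi n g)).

Lemma negligible_le X (u v : nat -> R) :
  (forall n, u n <= v n) -> negligible X v -> negligible X u.
Proof.
by move=> uv hv e e0; have [N HN] := hv e e0; exists N => n Nn; apply: le_trans (uv n) (HN n Nn).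
Qed.

Lemma negligibleD X (u v : nat -> R) : negligible X u -> negligible X v ->
  negligible X (fun n => 2 * (u n + v n)).
Proof.
move=> hu hv e e0; have e4 : 0 < e / 4 by rewrite divr_gt0.
have [N HN] := hu _ e4; have [M HM] := hv _ e4.
exists (maxn N M) => n; rewrite geq_max => /andP[Nn Mn].
by have := HN n Nn; have := HM n Mn; clear; lra.
Qed.

Lemma negligible_tri X (b a c : forall n, S (X n)) :
  negligible X (fun n => bD (a n) (b n)) -> negligible X (fun n => bD (b n) (c n)) ->
  negligible X (fun n => bD (a n) (c n)).
Proof.
by move=> hab hbc; apply: negligible_le (negligibleD hab hbc) => n; apply: bD_tri.
Qed.

Lemma negligible_sym X (a b : forall n, S (X n)) :
  negligible X (fun n => bD (a n) (b n)) -> negligible X (fun n => bD (b n) (a n)).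
Proof. by apply: negligible_le => n; rewrite bD_sym. Qed.

(** A sequence of counterexamples would be an asymptotic homomorphism. The defect is assumed small
    on all pairs of [G] at once, which truncations of a homomorphism satisfy, so no finite set of
    test pairs enters. *)
Lemma uniform_stability (G : groupType) : system_stable G ->
  forall (F : seq G) (e : R), 0 < e -> exists2 d, 0 < d &
  forall m (phi : G -> S m),
  (forall g h, bD (phi g * phi h)%g (phi (g * h)%g) <= d * m%:R) ->
  exists2 psi, is_hom psi & forall g, g \in F -> bD (phi g) (psi g) <= e * m%:R.
Proof.
move=> stG F e e0; apply: contrapT => nex.
have /(_ _)/cid-/all_sig[Y HY] : forall k : nat, exists Y : {m & G -> S m},
    (forall g h, bD (projT2 Y g * projT2 Y h)%g (projT2 Y (g * h)%g) <= k.+1%:R^-1 * (projT1 Y)%:R) /\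
    ~ exists2 psi, is_hom psi & forall g, g \in F -> bD (projT2 Y g) (psi g) <= e * (projT1 Y)%:R.
  move=> k; apply: contrapT => nY; apply: nex.
  exists (k.+1%:R^-1) => [|m phi near]; first by rewrite invr_gt0 ltr0n.
  by apply: contrapT => npsi; apply: nY; exists (existT _ m phi).
have [|psi hpsi near] := stG (fun k => projT1 (Y k)) (fun k => projT2 (Y k)).
  move=> g h d d0; exists (Num.bound d^-1) => k Kk.
  have [near _] := HY k; apply: le_trans (near g h) _; apply: ler_wpM2r => //.
  rewrite -[d]invrK lef_pV2 ?posrE ?invr_gt0 ?ltr0n //.
  apply: le_trans (_ : (Num.bound d^-1)%:R <= _).
    by apply/ltW/archi_boundP; rewrite invr_ge0 ltW.
  by rewrite ler_nat leqW.
have [N HN] : exists N, forall k, (N <= k)%N -> forall g, g \in F ->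
    bD (projT2 (Y k) g) (psi k g) <= e * (projT1 (Y k))%:R.
  elim: F {nex HY} => [|g F [N IH]]; first by exists 0%N.
  have [M HM] := near g e e0; exists (maxn N M) => k; rewrite geq_max => /andP[Nk Mk] h.
  by rewrite inE => /orP[/eqP->|hF]; [apply: HM|apply: IH].
have [_ []] := HY N; exists (psi N) => // g gF; exact: HN.
Qed.

(** At index [n], take an element of the best quality [k <= n] available; by monotonicity it has
    every lower quality too. *)
Lemma diagonal_choice (A : nat -> Type) (a0 : forall n, A n) (Q : forall n, nat -> A n -> Prop) :
  (forall n k k' a, (k' <= k)%N -> Q n k a -> Q n k' a) ->
  (forall k, exists N, forall n, (N <= n)%N -> exists a, Q n k a) ->
  exists a : forall n, A n, forall k, exists N, forall n, (N <= n)%N -> Q n k (a n).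
Proof.
move=> Qmono Qev.
have best n : exists a : A n, forall k, (k <= n)%N -> (exists b, Q n k b) -> Q n k a.
  have h m : exists a : A n, forall k, (k <= m)%N -> (exists b, Q n k b) -> Q n k a.
    elim: m => [|m [a Ha]].
      case: (pselect (exists b, Q n 0%N b)) => [[b Qb]|nb].
        by exists b => k; rewrite leqn0 => /eqP->.
      by exists (a0 n) => k; rewrite leqn0 => /eqP-> /nb.
    case: (pselect (exists b, Q n m.+1 b)) => [[b Qb]|nb].
      by exists b => k km _; apply: Qmono Qb.
    exists a => k; rewrite leq_eqVlt => /orP[/eqP-> /nb//|]; rewrite ltnS; exact: Ha.
  exact: h.
exists (fun n => sval (cid (best n))) => k; have [N HN] := Qev k.
exists (maxn N k) => n; rewrite geq_max => /andP[Nn kn].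
by apply: (svalP (cid (best n)) k kn); apply: HN.
Qed.

Section HNNStability.
Variables (G : groupType) (H : finGroupType) (i1 i2 : H -> G).
Let i k := if k then i2 else i1.
Variable TT : type_theory S i.
Hypothesis hom_i : forall k, is_hom (i k).
Variable F : seq G.
Hypothesis genF : Defs.generated [set g | g \in F]%classic = setT.
Hypothesis stG : system_stable G.

(** Closeness then has to be tested on generators only: [F] and the stable letter. *)
Lemma asymptotic_hom_close (E : groupType) X (phi psi : forall n, E -> S (X n)) :
  (forall g h, negligible X (fun n => bD (phi n g * phi n h)%g (phi n (g * h)%g))) ->
  (forall n, is_hom (psi n)) ->
  is_subgroup [set g | negligible X (fun n => bD (phi n g) (psi n g))]%classic.
Proof.
move=> aphi hpsi; have psi1 n : psi n 1%g = 1%g.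
  by apply: (@mulgI _ (psi n 1%g)); rewrite -hpsi !mulg1.
have phi1 : negligible X (fun n => bD (phi n 1%g) 1%g).
  by apply: negligible_le (aphi 1%g 1%g) => n; rewrite mulg1 -[X in _ <= bD _ X]mulg1 bD_mull.
have close_mul g h : negligible X (fun n => bD (phi n g) (psi n g)) ->
    negligible X (fun n => bD (phi n h) (psi n h)) ->
    negligible X (fun n => bD (phi n (g * h)%g) (psi n (g * h)%g)).
  move=> hg hh; apply: (negligible_tri (b := fun n => phi n g * phi n h)%g).
    exact: negligible_sym.
  apply: (negligible_tri (b := fun n => phi n g * psi n h)%g).
    by apply: negligible_le hh => n; rewrite bD_mull.
  by apply: negligible_le hg => n; rewrite hpsi bD_mulr.
split => [|g h|g] /=; [|exact: close_mul|].
- by apply: negligible_le phi1 => n; rewrite psi1.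
- move=> hg; apply: (@negligible_le _ _ (fun n => bD (phi n g^-1%g * psi n g)%g 1%g)).
    by move=> n; rewrite -(bD_mulr (psi n g)) -hpsi mulVg psi1.
  apply: (negligible_tri (b := fun n => phi n g^-1 * phi n g)%g).
    by apply: negligible_le (negligible_sym hg) => n; rewrite bD_mull.
  apply: (negligible_tri (b := fun n => phi n 1%g)) phi1.
  by apply: negligible_le (aphi g^-1%g g) => n; rewrite mulVg.
Qed.

Theorem hnn_system_stable : system_stable (hnn i1 i2).
Proof.
move=> X phi aphi; pose j := @hnn_in G H i1 i2; pose t := hnn_t i1 i2.
have [|psi hpsi near] := stG (X := X) (phi := fun n g => phi n (j g)).
  by move=> g h; apply: negligible_le (aphi (j g) (j h)) => n; rewrite -hnn_in_hom.
(* [phi] nearly respects the relation [hnn_relation], and [psi] is near [phi] on [G]. *)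
have almost h : negligible X (fun n => bD (phi n t * psi n (i2 h))%g (psi n (i1 h) * phi n t)%g).
  apply: (negligible_tri (b := fun n => phi n t * phi n (j (i2 h)))%g).
    by apply: negligible_le (negligible_sym (near (i2 h))) => n; rewrite bD_mull.
  apply: (negligible_tri (b := fun n => phi n (t * j (i2 h))%g)); first exact: aphi.
  apply: (negligible_tri (b := fun n => phi n (j (i1 h)) * phi n t)%g).
    rewrite -hnn_relation; apply: negligible_sym; exact: aphi.
  by apply: negligible_le (near (i1 h)) => n; rewrite bD_mulr.
pose Q n k (Psi : hnn i1 i2 -> S (X n)) := [/\ is_hom Psi,
  forall s, s \in F -> bD (psi n s) (Psi (j s)) <= k.+1%:R^-1 * (X n)%:R &
  bD (phi n t) (Psi t) <= k.+1%:R^-1 * (X n)%:R].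
have [n k k' Psi kk [h1 h2 h3]|k|Psi HPsi] := @diagonal_choice _ (fun n _ => 1%g) Q.
- have le_k : k.+1%:R^-1 * (X n)%:R <= k'.+1%:R^-1 * (X n)%:R :> R.
    by apply: ler_wpM2r => //; rewrite lef_pV2 ?posrE ?ltr0n // ler_nat ltnS.
  split=> // [s sF|]; [exact: le_trans (h2 s sF) le_k|exact: le_trans h3 le_k].
- have [d d0 exact_psi] := near_exact TT hom_i (uniform_stability stG) F
    (e := k.+1%:R^-1) ltac:(by rewrite invr_gt0 ltr0n).
  have [N HN] : exists N, forall n, (N <= n)%N -> forall h,
      bD (phi n t * psi n (i2 h))%g (psi n (i1 h) * phi n t)%g <= d * (X n)%:R.
    have /fin_all_exists[N_ HN] := fun h => almost h d d0.
    exists (\max_h N_ h)%N => n Nn h; apply: HN; apply: leq_trans Nn; exact: leq_bigmax.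
  exists N => n Nn; have [psi' [t' [hpsi' ex near' Dt]]] := exact_psi _ _ (phi n t) (hpsi n) (HN n Nn).
  (* Exact intertwining is precisely the defining relation of the extension. *)
  have [Psi [hPsi PsiG Psit]] := hnn_lift hpsi' (fun h => esym (ex h)).
  by exists Psi; split=> // [s sF|]; rewrite ?PsiG ?Psit //; apply: near'.
have negQ (u : nat -> R) : (forall k, exists N, forall n, (N <= n)%N -> u n <= k.+1%:R^-1 * (X n)%:R) ->
    negligible X u.
  move=> hu e e0; have [N HN] := hu (Num.bound e^-1); exists N => n Nn.
  apply: le_trans (HN n Nn) _; apply: ler_wpM2r => //.
  rewrite -[leRHS]invrK lef_pV2 ?posrE ?invr_gt0 ?ltr0n //.
  apply: le_trans (_ : (Num.bound e^-1)%:R <= _).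
    by apply/ltW/archi_boundP; rewrite invr_ge0 ltW.
  by rewrite ler_nat leqnSn.
have [N0 HN0] := HPsi 0%N.
(* Before [N0] the chosen map need not be a homomorphism; finitely many terms may be replaced
   freely. *)
pose Psi' n := if (N0 <= n)%N then Psi n else (fun _ => 1%g).
have hPsi' n : is_hom (Psi' n).
  by rewrite /Psi'; case: ifP => [h|_]; [case: (HN0 n h)|apply: is_hom1].
have evPsi (P : forall n, (hnn i1 i2 -> S (X n)) -> Prop) :
    (exists N, forall n, (N <= n)%N -> P n (Psi n)) -> exists N, forall n, (N <= n)%N -> P n (Psi' n).
  move=> [N HN]; exists (maxn N N0) => n; rewrite geq_max => /andP[Nn N0n].
  by rewrite /Psi' N0n; apply: HN.
exists Psi' => // x.
pose A := [set g | negligible X (fun n => bD (phi n g) (Psi' n g))]%classic.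
have sA : is_subgroup A by apply: asymptotic_hom_close.
apply: (hnn_generated (A := A) sA) => [g|]; last first.
  apply: negQ => k; apply: (evPsi (fun n f => bD (phi n t) (f t) <= _)).
  by have [N HN] := HPsi k; exists N => n /HN[].
have hj : is_hom j by apply: hnn_in_hom.
have close_s s : s \in F -> A (j s).
  move=> sF; apply: (negligible_tri (b := fun n => psi n s)); first exact: near.
  apply: negQ => k; apply: (evPsi (fun n f => bD (psi n s) (f (j s)) <= _)).
  by have [N HN] := HPsi k; exists N => n /HN[_ + _]; apply.
have : Defs.generated [set g | g \in F]%classic g by rewrite genF.
apply: (_ : _ `<=` [set g | A (j g)])%classic; apply: smallest_sub => //.
have [A1 AM AV] := sA; split=> [|x1 x2 /=|x1 /=].
- by rewrite /= (_ : j 1%g = 1%g) //; apply: (@mulgI _ (j 1%g)); rewrite -hj !mulg1.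
- by rewrite hj; apply: AM.
- by rewrite (is_homV hj); apply: AV.
Qed.

End HNNStability.
End SystemStability.

Definition pack_hom (G K : groupType) (f : G -> K) (hf : is_hom f) : {multiplicative G -> K} :=
  HB.pack f (isMultiplicative.Build G K f hf).

Lemma multiplicative_hom (G K : groupType) (f : {multiplicative G -> K}) : is_hom f.
Proof. exact: gmulfM. Qed.

(** * Transfer between block systems and metric classes *)

Section Transfer.
Variables (R : realType) (C : group_class R) (S : block_system R) (p : nat).
Hypothesis p0 : (0 < p)%N.

(** The exponent [p] is 2 for the Hilbert-Schmidt metric, as [bD] is a squared norm, and 1 for the
    Hamming metric. In size 0 the quotient is 0 by convention, like the metrics themselves. *)
Definition represented (X : obj C) (n : nat) := exists (f : AutG X -> S n) (f' : S n -> AutG X),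
  [/\ cancel f f', cancel f' f, is_hom f & forall a b, 0 <= distG a b /\
      distG a b ^+ p = bD (f a) (f b) / n%:R].

Lemma cvg0_negligible (X : nat -> nat) (d D : nat -> R) :
  (forall n, 0 <= d n) -> (forall n, 0 <= D n <= 4 * (X n)%:R) ->
  (forall n, d n ^+ p = D n / (X n)%:R) ->
  (d n @[n --> \oo] --> (0 : R))%classic <-> negligible X D.
Proof.
move=> d0 D0 dD; have DE n : D n = d n ^+ p * (X n)%:R.
  case: (posnP (X n)) => [X0|X0]; last by rewrite dD divfK // pnatr_eq0 -lt0n.
  by have := D0 n; rewrite X0 !mulr0 => ?; apply/le_anti; rewrite andbC.
split=> [/cvgrPdist_lt dc e e0|neg].
  (* Below 1, raising to the power [p] does not increase [d n]. *)
  pose e' := Num.min 1 e; have e'0 : 0 < e' by rewrite lt_min ltr01.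
  have [N _ HN] := dc e' e'0; exists N => n Nn; rewrite DE; apply: ler_wpM2r => //.
  have /= := HN n Nn; rewrite sub0r normrN ger0_norm // => /ltW lt_e.
  have e'1 : e' <= 1 by rewrite ge_min lexx.
  apply: le_trans (_ : e' <= e); last by rewrite ge_min lexx orbT.
  apply: le_trans (lt_e); rewrite -[leRHS]expr1; apply: ler_wiXn2l => //.
  exact: le_trans lt_e e'1.
apply/cvgrPdist_lt => e e0.
have [N HN] := neg ((e / 2) ^+ p) ltac:(by rewrite exprn_gt0 // divr_gt0).
exists N => // n Nn; rewrite /= sub0r normrN ger0_norm //.
apply: le_lt_trans (_ : e / 2 < e); last by rewrite ltr_pdivrMr // ltr_pMr // ltr1n.
have le_p : d n ^+ p <= (e / 2) ^+ p.
  rewrite dD; case: (posnP (X n)) => [->|X0].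
    by rewrite invr0 mulr0 exprn_ge0 // divr_ge0 // ltW.
  by rewrite ler_pdivrMr ?ltr0n //; apply: HN.
by rewrite -(ler_pXn2r p0) // nnegrE // divr_ge0 // ltW.
Qed.

Lemma stable_represented (G : groupType) :
  (forall n, exists X, represented X n) -> stable C G -> system_stable S G.
Proof.
move=> rep stG X phi aphi.
have /(_ _)/cid-/all_sig[Y] := fun n => rep (X n).
move=> /(_ _)/cid-/all_sig[f /(_ _)/cid-/all_sig[f' H]].
pose phi' n g := f' n (phi n g).
have hf' n : is_hom (f' n).
  have [fK f'K hf _] := H n; move=> x y; apply: (can_inj fK).
  by rewrite hf !f'K.
have [g h|psi near] := stG Y phi'.
  have conv := cvg0_negligible (X := X)
    (d := fun n => distG (phi' n g * phi' n h)%g (phi' n (g * h)%g))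
    (D := fun n => bD (phi n g * phi n h)%g (phi n (g * h)%g)).
  apply/conv => [n|n|n|]; last exact: aphi.
  - by have [_ _ _ /(_ (phi' n g * phi' n h)%g (phi' n (g * h)%g))[]] := H n.
  - by rewrite bD_ge0 bD_le.
  - have [_ f'K hf /(_ (phi' n g * phi' n h)%g (phi' n (g * h)%g))[_ ->]] := H n.
    by rewrite hf !f'K.
exists (fun n => f n \o psi n) => [n|g].
  by have [_ _ hf _] := H n; apply: is_hom_comp => //; apply: multiplicative_hom.
have conv := cvg0_negligible (X := X)
  (d := fun n => distG (phi' n g) (psi n g)) (D := fun n => bD (phi n g) (f n (psi n g))).
apply/conv => [n|n|n|]; last exact: near.
- by have [_ _ _ /(_ (phi' n g) (psi n g))[]] := H n.
- by rewrite bD_ge0 bD_le.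
- by have [_ f'K hf /(_ (phi' n g) (psi n g))[_ ->]] := H n; rewrite f'K.
Qed.

Lemma represented_stable (G : groupType) :
  (forall X, exists n, represented X n) -> system_stable S G -> stable C G.
Proof.
move=> rep stG Y phi aphi.
have /(_ _)/cid-/all_sig[X] := fun n => rep (Y n).
move=> /(_ _)/cid-/all_sig[f /(_ _)/cid-/all_sig[f' H]].
have hf' n : is_hom (f' n).
  have [fK f'K hf _] := H n; move=> x y; apply: (can_inj fK).
  by rewrite hf !f'K.
have [g h|psi hpsi near] := stG X (fun n g => f n (phi n g)).
  have conv := cvg0_negligible (X := X)
    (d := fun n => distG (phi n g * phi n h)%g (phi n (g * h)%g))
    (D := fun n => bD (f n (phi n g) * f n (phi n h))%g (f n (phi n (g * h)%g))).
  apply/conv => [n|n|n|]; last exact: aphi.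
  - by have [_ _ _ /(_ (phi n g * phi n h)%g (phi n (g * h)%g))[]] := H n.
  - by rewrite bD_ge0 bD_le.
  - have [_ _ hf /(_ (phi n g * phi n h)%g (phi n (g * h)%g))[_ ->]] := H n.
    by rewrite hf.
exists (fun n => pack_hom (is_hom_comp (hf' n) (hpsi n))) => g.
have conv := cvg0_negligible (X := X)
  (d := fun n => distG (phi n g) (f' n (psi n g))) (D := fun n => bD (f n (phi n g)) (psi n g)).
apply/conv => [n|n|n|]; last exact: near.
- by have [_ _ _ /(_ (phi n g) (f' n (psi n g)))[]] := H n.
- by rewrite bD_ge0 bD_le.
- by have [_ f'K _ /(_ (phi n g) (f' n (psi n g)))[_ ->]] := H n; rewrite f'K.
Qed.

End Transfer.

Section Instances.
Variable R : realType.

Lemma HS_represented n : represented (C := C_HS R) (unitary_system R) 2 (n : obj (C_HS R)) n.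
Proof.
exists id, id; split=> // a b; split; first exact: sqrtr_ge0.
rewrite /= /hs_dist /hs_norm /bD /= /udist -/(hsn _).
have -> : complex.Re (n%:R^-1 * hsn (umx a - umx b)) = complex.Re (hsn (umx a - umx b)) / n%:R.
  rewrite natrC -fmorphV -(ReK (hsn_ge0 (umx a - umx b))) -rmorphM /= mulrC //.
by rewrite sqr_sqrtr // divr_ge0 // udist_ge0.
Qed.

Lemma P_represented (X : finType) : represented (C := C_P R) (perm_system R) 1 X #|X|.
Proof.
(* Transport along a bijection, used in both directions between [X] and the ordinals below its
   cardinality. *)
pose r (Y Z : finType) (f : Y -> Z) (f' : Z -> Y) (s : {perm Y}) z := f (s (f' z)).
have rI (Y Z : finType) (f : Y -> Z) (f' : Z -> Y) s : cancel f f' -> cancel f' f -> injective (r Y Z f f' s).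
  by move=> fK f'K x y /(can_inj fK)/perm_inj/(can_inj f'K).
pose F (s : {perm X}) : {perm 'I_#|X|} := perm (rI _ _ _ _ s enum_rankK enum_valK).
pose F' (s : {perm 'I_#|X|}) : {perm X} := perm (rI _ _ _ _ s enum_valK enum_rankK).
exists F, F'; split=> [s|s|s t|s t].
- by apply/permP => x; rewrite !permE /r permE /r enum_rankK enum_rankK.
- by apply/permP => x; rewrite !permE /r permE /r !enum_valK.
- by apply/permP => x; rewrite permM !permE /r enum_rankK permM.
rewrite /= /hamming_dist /bD /= /permD expr1; split; first by rewrite mulr_ge0 // invr_ge0.
rewrite mulrC; congr (_%:R / _); rewrite /pdist -[LHS]sum1_card big_mkcond /=.
rewrite (reindex_onto enum_val enum_rank) => [|x _]; last exact: enum_rankK.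
apply: eq_big => [x|x _]; first by rewrite enum_valK eqxx.
by rewrite !permE /r (inj_eq enum_rank_inj) inE; case: (s _ == t _).
Qed.

End Instances.

Theorem theorem9 (R : realType) (C : group_class R)
  (hC : C = C_HS R \/ C = C_P R)
  (G : groupType) (fgG : finitely_generated G) (stG : stable C G)
  (H : finGroupType) (i1 i2 : {multiplicative H -> G})
  (inj1 : injective i1) (inj2 : injective i2)
  (nor1 : is_normal_subgroup (range i1)) (nor2 : is_normal_subgroup (range i2)) :
  stable C (hnn i1 i2).
Proof.
pose i k : H -> G := if k then (i2 : H -> G) else (i1 : H -> G).
have hom_i k : is_hom (i k) by case: k; apply: multiplicative_hom.
have inj_i k : injective (i k) by case: k.
have normal_i k g h : exists h', i k h' = (g * i k h * g^-1)%g.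
  have norm (f : H -> G) : is_normal_subgroup (range f) -> exists h', f h' = (g * f h * g^-1)%g.
    by case=> _ /(_ g (f h))[|h' _ E]; [exists h|exists h'].
  by case: k; apply: norm.
have [F0 /finite_seqP[F ->] genF] := fgG.
case: hC stG => -> stG.
- apply: (@represented_stable R (C_HS R) (unitary_system R) 2) => // [n|].
    by exists n; apply: HS_represented.
  apply: (hnn_system_stable (unitary_types R hom_i inj_i normal_i) hom_i genF).
  apply: (@stable_represented R (C_HS R) (unitary_system R) 2) stG => // n.
  by exists n; apply: HS_represented.
- apply: (@represented_stable R (C_P R) (perm_system R) 1) => // [X|].
    by exists #|X|; apply: P_represented.
  apply: (hnn_system_stable (perm_types R inj_i normal_i) hom_i genF).
  apply: (@stable_represented R (C_P R) (perm_system R) 1) stG => // n; exists ('I_n : finType).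
  by have := P_represented R 'I_n; rewrite card_ord.
Qed.
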